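(* For $N\ge1$ let $-1=\xi_0<\xi_1<\dots<\xi_N=1$ be the $N+1$ Gauss--Lobatto points. Let $(f_0,\dots,f_N)\in\mathbb{R}^{N+1}$, let $u_N$ be the unique polynomial of degree at most $N$ with $u_N(\xi_i)=f_i$ for all $i$, and let $u_h$ be the unique continuous function on $[-1,1]$ that is piecewise linear with respect to the abscissas $\xi_i$ and satisfies $u_h(\xi_i)=f_i$ for all $i$. Then the following equivalences hold with constants independent of $N$ and of $(f_i)$: $$\|u_N\|_0^2\approx\|u_h\|_0^2,\qquad \|\partial_xu_N\|_0^2\approx\|\partial_xu_h\|_0^2,\qquad \|(1-x)^{1/2}\partial_xu_N\|_0^2\approx\|(1-x)^{1/2}\partial_xu_h\|_0^2 .$$ If $u_N$ (and hence $u_h$) vanishes at $x=1$, then $$\|(1-x)^{-1/2}u_N\|_0^2\approx\|(1-x)^{-1/2}u_h\|_0^2 .$$ If $u_N$ is of degree at most $N-1$, then $$\|(1-x)^{1/2}u_N\|_0^2\approx\|(1-x)^{1/2}u_h\|_0^2 .$$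
   Context: $\|\cdot\|_0$ is the $L^2(-1,1)$ norm. $a\approx b$ means $C^{-1}b\le a\le Cb$ with a constant $C>0$ independent of $N$ (and of the data). The Gauss--Lobatto points are the roots of $(1-x^2)P_N'(x)$, with $P_N$ the Legendre polynomial of degree $N$. *)

(* Defs.v *)
From HB Require Import structures.
From mathcomp Require Import all_boot all_order all_algebra.
From mathcomp Require Import all_classical all_reals all_analysis.

Set Implicit Arguments.
Unset Strict Implicit.
Unset Printing Implicit Defensive.
Import Order.TTheory GRing.Theory Num.Theory.
Import numFieldNormedType.Exports.

Local Open Scope classical_set_scope.
Local Open Scope ring_scope.

(* Rodrigues' formula, normalised so that P_n(1) = 1. *)
Definition legendre (R : realType) (n : nat) : {poly R} :=
  (2 ^+ n * (n`!)%:R)^-1 *: (('X ^+ 2 - 1) ^+ n)^`(n).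

Definition gauss_lobatto (R : realType) (N : nat) (xi : 'I_N.+1 -> R) : Prop :=
  [/\ xi ord0 = -1,
      xi ord_max = 1,
      (forall i j : 'I_N.+1, (i < j)%N -> xi i < xi j) &
      (forall x : R, root ((1 - 'X ^+ 2) * (legendre R N)^`()) x <->
                     exists i : 'I_N.+1, x = xi i)].

(* Values of u outside [-1, 1] are unconstrained. *)
Definition continuous_piecewise_linear (R : realType) (N : nat)
    (xi : 'I_N.+1 -> R) (u : R -> R) : Prop :=
  {within `[-1, 1], continuous u} /\
  (forall i j : 'I_N.+1, j = i.+1 :> nat ->
     exists a b : R, forall x : R, xi i <= x <= xi j -> u x = a * x + b).

(* The norm of L^2(-1, 1) is that of L^2(R) on extensions by zero (the default
   value of the restriction notation in R is point = 0); it is +oo when g is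
   measurable but not square integrable. *)
Definition L2norm (R : realType) (g : R -> R) : \bar R :=
  ('N[@lebesgue_measure R]_(2%:E)[EFin \o (g \_ `]-1, 1[)%R])%E.

Definition sqnorm0 (R : realType) (g : R -> R) : \bar R := (L2norm g ^+ 2)%E.

Lemma sqnorm0E (R : realType) (g : R -> R) :
  sqnorm0 g = (\int[@lebesgue_measure R]_(x in `](-1)%R, 1%R[) ((g x) ^+ 2)%:E)%E.
Proof.
rewrite /sqnorm0 /L2norm expe2.
have E (y : \bar R) : (0 <= y -> y * y = y `^ 2)%E.
  case: y => [r| |]//= r0; last by rewrite gt_eqF//= mulyy.
  by rewrite -EFinM powR_mulrn.
rewrite E ?Lnorm_ge0// poweR_Lnorm// [RHS]integral_mkcond; apply: eq_integral => x _ /=.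
rewrite !patchE; case: ifP => _ /=.
  by rewrite powR_mulrn// real_normK// num_real.
by rewrite normr0 powR0.
Qed.

Definition equiv_with (R : realType) (C : R) (a b : \bar R) : Prop :=
  ((C^-1)%:E * b <= a)%E /\ (a <= C%:E * b)%E.

(* Main.v *)
Require Import Defs.
From mathcomp Require Import all_boot all_order all_algebra.
From mathcomp Require Import all_classical all_reals all_analysis.
From mathcomp Require Import measurable_realfun polyrcf ring lra zify.
Import Order.TTheory GRing.Theory Num.Theory.
Import numFieldNormedType.Exports.
Set Implicit Arguments.
Unset Strict Implicit.
Unset Printing Implicit Defensive.
Local Open Scope classical_set_scope.
Local Open Scope ring_scope.

(* With Legendre weights [rho_i = 2 / (lam P_N(x_i)^2)], [lam = N (N + 1)],
   Gauss-Lobatto quadrature is exact up to degree [2 N - 1]. Sturm comparison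
   for [w = (1 - x^2) P_N'], which solves [(1 - x^2) w'' + lam w = 0] and vanishes
   exactly at the nodes, gives [lam h_i^2 ~ 1 - x^2] on each interval; Sonin's
   monotone amplitude shows that [rho_i] is comparable to
   [sqrt (1 - x_i^2)] times a constant independent of [i], and [sum rho_i = sum h_i = 2]
   identifies the constant: [rho_i ~ h_i]. The norms without derivatives then
   compare through quadrature.

   For [|(1 - x)^(1/2) u'|], the lower bound is Cauchy-Schwarz on each interval,
   except on the last one, where [u(1) - u(x_(N-1))] is controlled by testing [u']
   against [P_N], which is orthogonal to it. For the upper bound, the form
   [int (1 - x) u'^2] is diagonalized with respect to [int u^2 / (1 + x)] by
   polynomials [(1 + x) q_k], with eigenvalues [(k + 1)^2]. The inverse
   inequality and the spectral gap make interpolation stable in the energy, up to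
   the last increment; apply this to polynomials that interpolate the data, with energy
   at most three times that of [u_h] up to an arbitrarily small error. The unweighted norm
   of [u'] follows by reflection, as [(1 - x) + (1 + x) = 2]. *)

(** * Integration of polynomials *)

(** Two scalings govern the estimates: [lam h_i^2] is of the order of [(1 - x)(1 + x)], and the last
    width is of the order of [1 / lam]. The first one explains why the energy weight [1 - x] is
    paired with the mass weight [1 / (1 + x)]: a trace inequality on one interval costs
    [h^2 int u'^2], and after multiplication by [N^2 / (1 + x)] this becomes [int (1 - x) u'^2]. The
    obstacle is the endpoint 1. The weight vanishes there, so the energy does not control [u(1)],
    and the last interval needs an argument of its own in every weighted estimate. All estimates
    concern polynomials and formal primitives; this is why polynomials of high degree stand in for
    [u_h] in the stability estimate. The weight [1 / (1 - x)] is reduced to [1 - x] by writing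
    [u = (1 - x) g]. For [N = 1] both interpolants coincide; the estimates themselves are for
    [N >= 2], where interior nodes exist. The numerical constants are explicit but not sharp. *)

Section PolyIntegral.
Variable R : realType.
Implicit Types (p q f g w : {poly R}) (a b c x : R).

(* The constant coefficient is [q`_0 / 0 = 0]. *)
Definition primitive q : {poly R} := \poly_(i < (size q).+1) (q`_i.-1 / i%:R).

Lemma deriv_primitive q : (primitive q)^`() = q.
Proof.
apply/polyP => i; rewrite coef_deriv coef_poly ltnS /=.
case: leqP => [/(nth_default 0) ->|_]; first by rewrite mul0rn.
by rewrite -[LHS]mulr_natr divfK // pnatr_eq0.
Qed.

Lemma deriv_eq0 p : p^`() = 0 -> p = (p`_0)%:P.
Proof.
move=> dp; apply/polyP => -[|i]; rewrite coefC //=.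
have /eqP := congr1 (fun q : {poly R} => q`_i) dp.
by rewrite coef_deriv coef0 -mulr_natr mulf_eq0 pnatr_eq0 orbF => /eqP.
Qed.

(** An algebraic integral: linearity, integration by parts and reflection become polynomial
    identities, and positivity comes from the mean value theorem. [integral_poly] identifies it with
    the Lebesgue integral at the end. *)
Definition pint a b q : R := (primitive q).[b] - (primitive q).[a].

Lemma pintE a b p q : p^`() = q -> pint a b q = p.[b] - p.[a].
Proof.
move=> dp; rewrite /pint.
have /deriv_eq0 e : (primitive q - p)^`() = 0 by rewrite derivB deriv_primitive dp subrr.
move: (_`_0) e => c e.
have -> : primitive q = p + c%:P by rewrite -e addrC subrK.
by rewrite !hornerE; ring.
Qed.

Lemma pintD a b p q : pint a b (p + q) = pint a b p + pint a b q.
Proof.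
rewrite (@pintE a b (primitive p + primitive q)) ?derivD ?deriv_primitive //.
by rewrite !hornerD /pint; ring.
Qed.

Lemma pintZ a b c q : pint a b (c *: q) = c * pint a b q.
Proof.
rewrite (@pintE a b (c *: primitive q)) ?derivZ ?deriv_primitive //.
by rewrite !hornerZ /pint; ring.
Qed.

Lemma pintCM a b c q : pint a b (c%:P * q) = c * pint a b q.
Proof. by rewrite mul_polyC pintZ. Qed.

Lemma pintN a b q : pint a b (- q) = - pint a b q.
Proof. by rewrite -scaleN1r pintZ mulN1r. Qed.

Lemma pintB a b p q : pint a b (p - q) = pint a b p - pint a b q.
Proof. by rewrite pintD pintN. Qed.

Lemma pint0 a b : pint a b 0 = 0.
Proof. by rewrite -(scale0r (0 : {poly R})) pintZ mul0r. Qed.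

Lemma pint_sum a b (I : Type) (r : seq I) (P : pred I) (F : I -> {poly R}) :
  pint a b (\sum_(i <- r | P i) F i) = \sum_(i <- r | P i) pint a b (F i).
Proof.
by apply: (big_morph (pint a b)) => [p q|]; rewrite ?pintD ?pint0.
Qed.

Lemma pint_cat a b c q : pint a b q + pint b c q = pint a c q.
Proof. by rewrite /pint; ring. Qed.

Lemma pint_by_parts a b f g :
  pint a b (f^`() * g) = f.[b] * g.[b] - f.[a] * g.[a] - pint a b (f * g^`()).
Proof.
rewrite -!hornerM -(@pintE a b (f * g) _ erefl) derivM pintD; ring.
Qed.

Lemma pintC a b c : pint a b c%:P = c * (b - a).
Proof.
rewrite (@pintE a b (c%:P * 'X)); first by rewrite !hornerE; ring.
by rewrite deriv_mulC derivX mulr1.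
Qed.

Lemma pint_deriv a b p : pint a b p^`() = p.[b] - p.[a].
Proof. exact: pintE. Qed.

Lemma pint_comp_oppX a b q : pint a b (q \Po - 'X) = pint (- b) (- a) q.
Proof.
rewrite (@pintE a b (- (primitive q \Po - 'X))).
  by rewrite !hornerN !horner_comp !hornerN !hornerX /pint; ring.
by rewrite derivN deriv_comp deriv_primitive derivN derivX mulrN1 opprK.
Qed.

Lemma pint_mvt a b q : a < b ->
  exists2 c, a < c < b & pint a b q = q.[c] * (b - a).
Proof.
move=> ab; have [c cab e] := poly_mvt (primitive q) ab.
by exists c; [rewrite in_itv in cab | rewrite /pint e deriv_primitive].
Qed.

Lemma pint_ge0 a b q : a <= b -> (forall x, a < x < b -> 0 <= q.[x]) ->
  0 <= pint a b q.
Proof.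
rewrite le_eqVlt => /orP[/eqP <-|ab] q0; first by rewrite /pint subrr.
have [c cab ->] := pint_mvt q ab.
by rewrite mulr_ge0 ?q0 // subr_ge0 ltW.
Qed.

Lemma le_pint a b p q : a <= b -> (forall x, a < x < b -> p.[x] <= q.[x]) ->
  pint a b p <= pint a b q.
Proof.
move=> ab pq; rewrite -subr_ge0 -pintB pint_ge0 // => x xab.
by rewrite !hornerE subr_ge0 pq.
Qed.

Lemma poly_eq0_itv a b p : a < b -> (forall x, a < x < b -> p.[x] = 0) -> p = 0.
Proof.
move=> ab p0.
(* More points than the degree allows roots; all lie strictly inside because the denominators start
   at 2. *)
pose s := [seq a + (b - a) / i.+2%:R | i <- iota 0 (size p)].
apply: (@roots_geq_poly_eq0 _ p s).
- apply/allP => _ /mapP[i _ ->]; apply/rootP/p0.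
  have i2 : (2 : R) <= i.+2%:R by rewrite ler_nat.
  have i0 : (0 : R) < i.+2%:R by lra.
  have : (b - a) / i.+2%:R < b - a.
    by rewrite ltr_pdivrMr // ltr_pMr; lra.
  have : 0 < (b - a) / i.+2%:R by rewrite divr_gt0 // subr_gt0.
  by move: (_ / _) => t t0 tb; apply/andP; split; lra.
- rewrite map_inj_uniq ?iota_uniq // => i j /addrI.
  have ba : b - a != 0 by rewrite subr_eq0 gt_eqF.
  by move=> /(mulfI ba) /invr_inj /eqP; rewrite eqr_nat => /eqP [].
- by rewrite size_map size_iota.
Qed.

(** The primitive is nondecreasing with equal values at [a] and [b], hence constant in between; so
    [w * q ^+ 2] is 0, and [w] is not. *)
Lemma pint_sqr_eq0 a b w q : a < b -> (forall x, a < x < b -> 0 < w.[x]) ->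
  pint a b (w * q ^+ 2) = 0 -> q = 0.
Proof.
move=> ab w0 I0.
have wq0 x : a < x < b -> 0 <= (w * q ^+ 2).[x].
  by move=> /w0 wx; rewrite hornerM horner_exp mulr_ge0 ?sqr_ge0 // ltW.
have /deriv_eq0 : (primitive (w * q ^+ 2) - (primitive (w * q ^+ 2)).[a]%:P)^`() = 0.
  rewrite (@poly_eq0_itv a b (_ - _)) ?deriv0 // => x /andP[ax xb].
  have : 0 <= pint a x (w * q ^+ 2).
    by apply: pint_ge0 => [|y /andP[ay yx]]; rewrite ?wq0 ?ltW // ay (lt_trans yx).
  have : 0 <= pint x b (w * q ^+ 2).
    by apply: pint_ge0 => [|y /andP[ay yx]]; rewrite ?wq0 ?ltW // yx (lt_trans ax).
  by move: I0; rewrite !hornerD hornerN hornerC /pint; lra.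
move=> e; have : w * q ^+ 2 = 0.
  apply: (@poly_eq0_itv a b) => // x xab.
  rewrite -[w * q ^+ 2]deriv_primitive.
  have -> : primitive (w * q ^+ 2) =
    (primitive (w * q ^+ 2) - (primitive (w * q ^+ 2)).[a]%:P) +
    (primitive (w * q ^+ 2)).[a]%:P by ring.
  by rewrite e derivD !derivC addr0 horner0.
move/eqP; rewrite mulf_eq0 expf_eq0 /= => /orP[/eqP w00|/eqP //].
have := w0 ((a + b) / 2); rewrite w00 horner0 ltxx.
have -> : a < (a + b) / 2 < b by lra.
by move=> /(_ isT).
Qed.

Lemma pint_CS a b w f g : a <= b -> (forall x, a < x < b -> 0 <= w.[x]) ->
  pint a b (w * f * g) ^+ 2 <= pint a b (w * f ^+ 2) * pint a b (w * g ^+ 2).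
Proof.
move=> ab w0; set F := pint a b (w * f ^+ 2); set G := pint a b (w * g ^+ 2).
set B := pint a b _.
have quad s t : 0 <= s ^+ 2 * F + 2 * s * t * B + t ^+ 2 * G.
  have -> : s ^+ 2 * F + 2 * s * t * B + t ^+ 2 * G =
      pint a b (w * (s *: f + t *: g) ^+ 2).
    rewrite -!pintZ -!pintD; congr pint.
    by rewrite -!mul_polyC; ring.
  by apply: pint_ge0 => // x /w0 wx; rewrite hornerM horner_exp mulr_ge0 ?sqr_ge0.
have F0 : 0 <= F by have := quad 1 0; rewrite !(expr1n, mulr1, mulr0, mul0r, expr0n, addr0, mul1r).
have G0 : 0 <= G by have := quad 0 1; rewrite !(expr1n, mulr1, mulr0, mul0r, expr0n, add0r, mul1r).
(* If [F = 0], the form at [(- (G + 1), B)] equals [- (G + 2) B^2], which forces [B = 0]. Otherwise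
   its value at [(B, - F)] is [F (F G - B^2)]. *)
have [F00|Fn0] := eqVneq F 0.
  have h1 := quad (- B) G.
  have h2 := quad (- (G + 1)) B.
  rewrite F00 mul0r in h2 *.
  rewrite F00 in h1.
  nra.
have := quad B (- F); have {Fn0} : 0 < F by rewrite lt_def Fn0.
nra.
Qed.

Lemma pint_CS1 a b q : a <= b -> pint a b q ^+ 2 <= (b - a) * pint a b (q ^+ 2).
Proof.
move=> ab; have := @pint_CS a b 1 1 q ab.
rewrite expr1n !mul1r => /(_ _) h.
have /h : forall x, a < x < b -> 0 <= (1 : {poly R}).[x].
  by move=> x _; rewrite hornerE.
by rewrite -[X in pint a b X * _]/(1%:P) pintC mul1r.
Qed.

End PolyIntegral.

(** * Legendre polynomials *)

Section Legendre.
Variable R : realType.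
Implicit Types (p q t v : {poly R}) (a x : R) (n j : nat).

(** Each derivative lowers the order of the zero at [a] by one. The surviving order kills boundary
    terms in integrations by parts; the value of the cofactor at [a], for [n = 0], normalizes
    Rodrigues' formula. *)
Lemma derivn_root_mul a q n j :
  exists r, (('X - a%:P) ^+ (n + j) * q)^`(j) = ('X - a%:P) ^+ n * r /\
            r.[a] = ((n + j) ^_ j)%:R * q.[a].
Proof.
elim: j q => [|j IH] q; first by exists q; rewrite addn0 ffactn0 mul1r derivn0.
have [r [e ra]] := IH ((n + j).+1%:R *: q + ('X - a%:P) * q^`()).
exists r; split.
  rewrite -e derivSn addnS derivM deriv_exp derivXsubC mul1r /= exprSr.
  by congr (_^`(j)); rewrite -mul_polyC; ring.
rewrite ra hornerD hornerZ hornerM !hornerE subrr mul0r addr0 mulrA -natrM.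
by rewrite addnS ffactnS /= mulnC.
Qed.

Lemma size_deriv_le p n : (size p <= n.+1)%N -> (size p^`() <= n)%N.
Proof.
move=> sp; have [->|p0] := eqVneq p 0; first by rewrite deriv0 size_poly0.
by rewrite -ltnS (leq_trans (lt_size_deriv p0)).
Qed.

Lemma size_derivn_le p n j : (size p <= n + j)%N -> (size p^`(j) <= n)%N.
Proof.
elim: j n => [|j IH] n; first by rewrite addn0.
by rewrite addnS -addSn derivnS => /IH /size_deriv_le.
Qed.

Lemma size_mul_le p q n m k : (size p <= n)%N -> (size q <= m)%N ->
  ((n + m).-1 <= k)%N -> (size (p * q)%R <= k)%N.
Proof. by have := size_polyMleq p q; lia. Qed.

Let y n : {poly R} := ('X ^+ 2 - 1) ^+ n.

Let yE n : y n = ('X - 1%:P) ^+ n * ('X - (-1)%:P) ^+ n.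
Proof. by rewrite -exprMn; congr (_ ^+ n); rewrite polyCN polyC1; ring. Qed.

Let y_vanish n j : (j < n)%N -> (y n)^`(j).[1] = 0 /\ (y n)^`(j).[-1] = 0.
Proof.
move=> jn; have -> : n = ((n - j).-1.+1 + j)%N by lia.
set m := (n - j).-1; split.
  have [r [e _]] := derivn_root_mul 1 (('X - (-1)%:P) ^+ (m.+1 + j)) m.+1 j.
  by rewrite yE e hornerM horner_exp hornerXsubC subrr expr0n mul0r.
have [r [e _]] := derivn_root_mul (-1) (('X - 1%:P) ^+ (m.+1 + j)) m.+1 j.
by rewrite yE mulrC e hornerM horner_exp hornerXsubC subrr expr0n mul0r.
Qed.

Let c_neq0 n : 2 ^+ n * (n`!)%:R != 0 :> R.
Proof. by rewrite mulf_neq0 // ?expf_neq0 // pnatr_eq0 // -lt0n fact_gt0. Qed.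

Lemma legendre1 n : (legendre R n).[1] = 1.
Proof.
have [r [e r1]] := derivn_root_mul 1 (('X - (-1)%:P) ^+ n) 0 n.
rewrite /legendre hornerZ -/(y n) yE -[X in ('X - 1%:P) ^+ X](add0n n) e.
rewrite mul1r r1 add0n ffactnn horner_exp hornerXsubC opprK.
by rewrite [X in _ * X]mulrC mulVf // c_neq0.
Qed.

Lemma legendre_comp_oppX n : legendre R n \Po - 'X = (-1) ^+ n *: legendre R n.
Proof.
have derivn_comp p j : (p \Po - 'X)^`(j) = (-1) ^+ j *: (p^`(j) \Po - 'X).
  elim: j => [|j IH]; first by rewrite scale1r.
  by rewrite derivnS IH derivZ deriv_comp derivN derivX mulrN1 exprS mulN1r scaleNr scalerN -derivnS.
rewrite /legendre -/(y n) comp_polyZ [RHS]scalerA [in RHS]mulrC -scalerA.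
congr (_ *: _); have {2}-> : y n = y n \Po - 'X.
  by rewrite /y rmorphXn rmorphB rmorphXn rmorph1 /= comp_polyX sqrrN.
by rewrite derivn_comp scalerA -exprD addnn -mul2n exprM sqrrN !expr1n scale1r.
Qed.

Lemma legendreN1_sqr n : (legendre R n).[-1] ^+ 2 = 1.
Proof.
have := congr1 (fun p => p.[1]) (legendre_comp_oppX n).
rewrite horner_comp [RHS]hornerZ hornerN hornerX legendre1 mulr1 => ->.
by rewrite exprAC sqrrN !expr1n.
Qed.

Lemma size_legendre_le n : (size (legendre R n) <= n.+1)%N.
Proof.
apply: leq_trans (size_scale_leq _ _) _; apply: size_derivn_le.
apply: leq_trans (size_poly_exp_leq _ _) _.
by rewrite size_XnsubC //= mul2n addSn addnn.
Qed.

(** Repeated integration by parts: the derivatives of [(X^2 - 1)^n] of order below [n] vanish at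
    both endpoints, and each step takes one degree from [v]. *)
Lemma legendre_orth n v : (size v <= n)%N -> pint (-1) 1 (legendre R n * v) = 0.
Proof.
move=> sv; rewrite /legendre -scalerAl pintZ; apply/eqP.
rewrite mulf_eq0; apply/orP; right; apply/eqP.
suff : forall j, (j <= n)%N -> forall v, (size v <= j)%N ->
    pint (-1) 1 ((y n)^`(j) * v) = 0 by move/(_ n); exact.
elim=> [|j IH] jn u su.
  by move: su; rewrite size_poly_leq0 => /eqP ->; rewrite mulr0 pint0.
have [y1 ym1] := y_vanish jn.
rewrite derivnS pint_by_parts y1 ym1 !mul0r IH ?subrr //; first exact: ltnW.
exact: size_deriv_le.
Qed.

Local Opaque legendre.

Lemma pint_sqr_itv_eq0 v : pint (-1) 1 (v ^+ 2) = 0 -> v = 0.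
Proof.
move=> v0; apply: (@pint_sqr_eq0 R (-1) 1 1); first by lra.
  by move=> x _; rewrite hornerC.
by rewrite mul1r.
Qed.

Lemma size_legendre n : size (legendre R n) = n.+1.
Proof.
apply/eqP; rewrite eqn_leq size_legendre_le ltnNge; apply/negP => /legendre_orth.
rewrite -expr2 => /pint_sqr_itv_eq0 e; have := legendre1 n.
by rewrite e horner0 => /eqP; rewrite eq_sym oner_eq0.
Qed.

Lemma coef_legendre_neq0 n : (legendre R n)`_n != 0.
Proof.
have := lead_coef_eq0 (legendre R n); rewrite lead_coefE size_legendre /= => ->.
by rewrite -size_poly_eq0 size_legendre.
Qed.

Lemma size_sub_coef p q n : (size p <= n.+1)%N -> (size q <= n.+1)%N ->
  p`_n = q`_n -> (size (p - q)%R <= n)%N.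
Proof.
move=> sp sq e; apply/leq_sizeP => j nj; rewrite coefB.
have [->|jn] := eqVneq j n; first by rewrite e subrr.
have {}nj : (n < j)%N by rewrite ltn_neqAle eq_sym jn.
by rewrite !nth_default ?subrr // (leq_trans _ nj).
Qed.

Lemma orth_legendre_unique n v : (size v <= n.+1)%N ->
  (forall t, (size t <= n)%N -> pint (-1) 1 (v * t) = 0) ->
  v = (v`_n / (legendre R n)`_n) *: legendre R n.
Proof.
move=> sv vt; set k := _ / _.
have sw : (size (v - k *: legendre R n)%R <= n)%N.
  apply: size_sub_coef => //.
    exact: leq_trans (size_scale_leq _ _) (size_legendre_le _).
  by rewrite coefZ divfK // coef_legendre_neq0.
apply/eqP; rewrite -subr_eq0; apply/eqP/pint_sqr_itv_eq0.
rewrite expr2 mulrBl pintB vt // -scalerAl pintZ legendre_orth // mulr0 subrr //.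
Qed.

Lemma size_1subX2 : size (1 - 'X^2 : {poly R}) = 3%N.
Proof. by rewrite -opprB size_polyN size_XnsubC. Qed.

(** The operator [((1 - x^2) p')'] is symmetric and does not raise degrees, so its value at [P_n] is
    orthogonal to all lower degrees, hence a multiple of [P_n]; leading coefficients give the
    factor. *)
Lemma legendre_ode n :
  ((1 - 'X^2) * (legendre R n)^`())^`() = - (n * n.+1)%:R *: legendre R n.
Proof.
case: n => [|n].
  have s0 := size_legendre_le 0.
  rewrite (size1_polyC s0) derivC mulr0 deriv0.
  by rewrite mul0n oppr0 scale0r.
set P := legendre R n.+1; set v := (_ * _)^`().
have sP' : (size P^`() <= n.+1)%N by rewrite size_deriv_le ?size_legendre_le.
have sv : (size v <= n.+2)%N.
  by apply: size_deriv_le; apply: (@size_mul_le _ _ 3 n.+1); rewrite ?size_1subX2.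
rewrite (orth_legendre_unique sv) => [|t st].
  congr (_ *: _); rewrite coef_deriv mulrBl mul1r coefB coefXnM /=.
  rewrite nth_default; last by rewrite (leq_trans sP').
  rewrite subn2 /= coef_deriv sub0r.
  have := coef_legendre_neq0 n.+1; rewrite -/P => P0.
  by rewrite -[X in X / _ = _]mulr_natr -[X in - X]mulr_natr natrM; field.
rewrite pint_by_parts.
rewrite ![((1 - 'X^2) * _).[_]]hornerM !(hornerD,hornerN,horner_exp,hornerX,hornerC).
rewrite sqrrN expr1n subrr !mul0r subrr sub0r.
have -> : (1 - 'X^2) * P^`() * t^`() = P^`() * ((1 - 'X^2) * t^`()) by ring.
rewrite pint_by_parts.
rewrite ![((1 - 'X^2) * _).[_]]hornerM !(hornerD,hornerN,horner_exp,hornerX,hornerC).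
rewrite sqrrN expr1n subrr !mul0r !mulr0 subrr sub0r opprK.
apply: legendre_orth; apply: size_deriv_le.
have [->|t0] := eqVneq t 0; first by rewrite deriv0 mulr0 size_poly0.
apply: (@size_mul_le _ _ 3 (size t).-1); rewrite ?size_1subX2 //.
  by rewrite size_deriv_le // prednK // size_poly_gt0.
by have := size_poly_gt0 t; rewrite t0; lia.
Qed.

Lemma pint_legendre_lead n v : (size v <= n.+1)%N ->
  pint (-1) 1 (v * legendre R n) =
  v`_n / (legendre R n)`_n * pint (-1) 1 (legendre R n ^+ 2).
Proof.
move=> sv; set k := _ / _.
have sw : (size (v - k *: legendre R n)%R <= n)%N.
  apply: size_sub_coef => //.
    exact: leq_trans (size_scale_leq _ _) (size_legendre_le _).
  by rewrite coefZ divfK // coef_legendre_neq0.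
have := legendre_orth sw.
rewrite mulrBr pintB -scalerAr -expr2 pintZ => /eqP; rewrite subr_eq0 => /eqP <-.
by rewrite mulrC.
Qed.

(** The integral of [x P' P] is computed twice: [x P'] has [n] times the leading coefficient of [P],
    and integration by parts with [P(1)^2 = P(-1)^2 = 1] gives [(2 - I) / 2]. *)
Lemma pint_legendre_sqr n :
  pint (-1) 1 (legendre R n ^+ 2) = 2 / (2 * n + 1)%:R.
Proof.
set P := legendre R n; set I := pint _ _ _.
have e1 : pint (-1) 1 ('X * P^`() * P) = n%:R * I.
  rewrite pint_legendre_lead.
    congr (_ * _); rewrite coefXM; case: n @P @I => [|n] P I; first by rewrite mul0r.
    by rewrite coef_deriv /= -[P`_n.+1 *+ _]mulr_natr mulrC mulKf ?coef_legendre_neq0//.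
  apply: (@size_mul_le _ _ 2 n); rewrite ?size_polyX //.
  exact/size_deriv_le/size_legendre_le.
have e2 : 2 * pint (-1) 1 ('X * P^`() * P) = 2 - I.
  rewrite -pintZ; have := pint_by_parts (-1) 1 (P ^+ 2) 'X.
  rewrite deriv_exp derivX mulr1 -/I !hornerX !horner_exp legendre1 legendreN1_sqr.
  have -> : P^`() * P ^+ 2.-1 *+ 2 * 'X = 2 *: ('X * P^`() * P).
    by rewrite scaler_nat /= expr1; ring.
  by move=> ->; ring.
have n0 : (2 * n + 1)%:R != 0 :> R by rewrite pnatr_eq0 addn1.
apply/(canRL (mulfK n0)); rewrite natrD natrM; lra.
Qed.

Lemma deriv_legendre1 n : (legendre R n)^`().[1] = (n * n.+1)%:R / 2.
Proof.
have := congr1 (fun p => p.[1]) (legendre_ode n).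
rewrite derivM hornerZ legendre1 derivB derivC derivXn.
rewrite !(hornerD,hornerN,hornerM,horner_exp,hornerX,hornerC,hornerMn).
rewrite /= !expr1 !mulr1 subrr mul0r; lra.
Qed.

End Legendre.

(** * Gauss-Lobatto quadrature *)

Section Nodes.
Variable R : realType.

Definition lobatto_poly n : {poly R} := (1 - 'X^2) * (legendre R n)^`().

(** Nodes are indexed by [nat] so that [x i.+1] needs no cast; values beyond [n] are left open. *)
Definition lobatto_nodes n (x : nat -> R) :=
  [/\ x 0%N = -1, x n = 1,
      forall i j, (i < j <= n)%N -> x i < x j,
      forall i, (i <= n)%N -> root (lobatto_poly n) (x i) &
      forall y, root (lobatto_poly n) y -> exists2 i, (i <= n)%N & y = x i].

Section LobattoQuadrature.
Variables (N : nat) (x : nat -> R).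
Hypotheses (N1 : (1 <= N)%N) (nodes : lobatto_nodes N x).
Local Notation P := (legendre R N).
Local Notation w := (lobatto_poly N).
Local Notation lam := ((N * N.+1)%:R : R).

Lemma x0E : x 0%N = -1. Proof. by case: nodes. Qed.
Lemma xNE : x N = 1. Proof. by case: nodes. Qed.

Lemma ltx i j : (i < j <= N)%N -> x i < x j.
Proof. by case: nodes => _ _ lt_x _ _; exact: lt_x. Qed.

Lemma lex i j : (i <= j <= N)%N -> x i <= x j.
Proof.
move=> /andP[]; rewrite leq_eqVlt => /orP[/eqP -> //|ij jN].
by rewrite ltW // ltx // ij.
Qed.

Lemma eqx i j : (i <= N)%N -> (j <= N)%N -> (x i == x j) = (i == j).
Proof.
move=> iN jN; apply/eqP/eqP => [e|-> //]; apply/eqP; rewrite eqn_leq.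
rewrite leqNgt [X in _ && X]leqNgt; apply/andP; split; apply/negP => ij.
  by have := @ltx j i; rewrite ij iN e ltxx => /(_ isT).
by have := @ltx i j; rewrite ij jN e ltxx => /(_ isT).
Qed.

Lemma lam_gt0 : 0 < lam.
Proof. by rewrite ltr0n muln_gt0 N1. Qed.

Lemma deriv_lobatto_poly : w^`() = - lam *: P.
Proof. exact: legendre_ode. Qed.

Lemma size_lobatto_poly : size w = N.+2.
Proof.
have P'0 : P^`() != 0.
  apply/eqP => e; have := deriv_legendre1 R N; rewrite e horner0 => /eqP.
  by rewrite eq_sym mulf_eq0 invr_eq0 [_ == 0]gt_eqF ?lam_gt0 // pnatr_eq0.
apply/eqP; rewrite eqn_leq; apply/andP; split.
  apply: (@size_mul_le _ _ _ 3 N); rewrite ?size_1subX2 //.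
  exact/size_deriv_le/size_legendre_le.
have w0 : w != 0 by rewrite mulf_neq0 // -size_poly_gt0 size_1subX2.
have := lt_size_deriv w0; rewrite deriv_lobatto_poly size_scale ?size_legendre //.
by rewrite oppr_eq0 gt_eqF ?lam_gt0.
Qed.

Lemma lobatto_poly_neq0 : w != 0.
Proof. by rewrite -size_poly_eq0 size_lobatto_poly. Qed.

Definition lobatto_cofactor (i : 'I_N.+1) : {poly R} :=
  lead_coef w *: \prod_(j < N.+1 | j != i) ('X - (x j)%:P).
Local Notation wq := lobatto_cofactor.

Lemma lobatto_cofactorE (i : 'I_N.+1) : w = ('X - (x i)%:P) * wq i.
Proof.
rewrite {1}(@all_roots_prod_XsubC _ w [seq x (val j) | j <- enum 'I_N.+1]).
- by rewrite big_map big_enum /= (bigD1 i) //= /wq scalerAr.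
- by rewrite size_lobatto_poly size_map size_enum_ord.
- apply/allP => _ /mapP[j _ ->]; case: nodes => _ _ _ r _; apply: r.
  exact: leq_ord.
- rewrite uniq_rootsE map_inj_uniq ?enum_uniq // => j k /eqP.
  by rewrite eqx ?leq_ord // => /eqP /val_inj.
Qed.

Lemma lobatto_cofactor_neq0 i : wq i != 0.
Proof.
apply/eqP => e; have := lobatto_poly_neq0.
by rewrite (lobatto_cofactorE i) e mulr0 eqxx.
Qed.

Lemma size_lobatto_cofactor i : size (wq i) = N.+1.
Proof.
have := size_lobatto_poly; rewrite (lobatto_cofactorE i) size_mul.
- by rewrite size_XsubC => /= -[].
- by rewrite polyXsubC_eq0.
- exact: lobatto_cofactor_neq0.
Qed.

Lemma lobatto_cofactor_eq0 (i j : 'I_N.+1) : i != j -> (wq i).[x j] = 0.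
Proof.
move=> ij; rewrite /wq hornerZ horner_prod (bigD1 j) 1?eq_sym //=.
by rewrite hornerXsubC subrr mul0r mulr0.
Qed.

Lemma lobatto_cofactor_diag i : (wq i).[x i] = - lam * P.[x i].
Proof.
have := congr1 (fun p : {poly R} => p.[x i]) deriv_lobatto_poly.
rewrite {1}(lobatto_cofactorE i) derivM derivXsubC mul1r hornerZ => <-.
by rewrite hornerD hornerM hornerXsubC subrr mul0r addr0.
Qed.

Lemma legendre_node_neq0 i : (i <= N)%N -> P.[x i] != 0.
Proof.
rewrite -ltnS => iN; have := lobatto_cofactor_diag (Ordinal iN).
rewrite /= /wq hornerZ horner_prod => e; apply/eqP => P0; move: e.
rewrite P0 mulr0 => /eqP; rewrite mulf_eq0 lead_coef_eq0 (negPf lobatto_poly_neq0) /=.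
apply/negP/prodf_neq0 => j ji; rewrite hornerXsubC subr_eq0 eqx ?leq_ord //.
by rewrite eq_sym.
Qed.

Lemma lobatto_poly_node i : (i <= N)%N -> w.[x i] = 0.
Proof. by case: nodes => _ _ _ r _ /r /rootP. Qed.

Lemma poly_nodes_eq0 (t : {poly R}) : (size t <= N.+1)%N ->
  (forall i, (i <= N)%N -> t.[x i] = 0) -> t = 0.
Proof.
move=> st t0; apply: (@roots_geq_poly_eq0 _ t [seq x (val j) | j <- enum 'I_N.+1]).
- by apply/allP => _ /mapP[j _ ->]; apply/rootP/t0/leq_ord.
- rewrite map_inj_uniq ?enum_uniq // => j k /eqP.
  by rewrite eqx ?leq_ord // => /eqP /val_inj.
- by rewrite size_map size_enum_ord.
Qed.

(** A closed form; [pint_lobatto_lagrange] shows that it is the integral of the Lagrange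
    polynomial. *)
Definition weight i : R := 2 / (lam * P.[x i] ^+ 2).

Lemma weight_gt0 i : (i <= N)%N -> 0 < weight i.
Proof.
move=> /legendre_node_neq0 P0; rewrite divr_gt0 // mulr_gt0 ?lam_gt0 //.
by rewrite exprn_even_gt0.
Qed.

Definition lobatto_lagrange (i : 'I_N.+1) : {poly R} := (- lam * P.[x i])^-1 *: wq i.

Lemma size_lobatto_lagrange i : (size (lobatto_lagrange i) <= N.+1)%N.
Proof. by rewrite (leq_trans (size_scale_leq _ _)) ?size_lobatto_cofactor. Qed.

Lemma lobatto_lagrangeE (i j : 'I_N.+1) : (lobatto_lagrange i).[x j] = (i == j)%:R.
Proof.
rewrite /lobatto_lagrange hornerZ; have [<-|ij] := eqVneq i j; last first.
  by rewrite lobatto_cofactor_eq0 // mulr0.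
rewrite lobatto_cofactor_diag mulVf // mulf_neq0 ?oppr_eq0 ?legendre_node_neq0 ?leq_ord //.
by rewrite gt_eqF ?lam_gt0.
Qed.

Lemma lobatto_interpolation (t : {poly R}) : (size t <= N.+1)%N ->
  t = \sum_(i < N.+1) t.[x i] *: lobatto_lagrange i.
Proof.
move=> st; apply/eqP; rewrite -subr_eq0; apply/eqP/poly_nodes_eq0.
  rewrite (leq_trans (size_polyD _ _)) // geq_max st size_polyN /=.
  apply: (leq_trans (size_sum _ _ _)); apply/bigmax_leqP => i _.
  by rewrite (leq_trans (size_scale_leq _ _)) ?size_lobatto_lagrange.
move=> i; rewrite -ltnS => iN; rewrite hornerD hornerN horner_sum.
rewrite (bigD1 (Ordinal iN)) //= hornerZ (lobatto_lagrangeE _ (Ordinal iN)) eqxx mulr1.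
rewrite big1 ?addr0 ?subrr // => j /negPf ji.
by rewrite hornerZ (lobatto_lagrangeE _ (Ordinal iN)) ji mulr0.
Qed.

(** [w] vanishes at both ends and [w' = - lam P_N], so integration by parts trades [w] for [P_N].
    Hence [w] is orthogonal to all degrees up to [N - 2], the source of the exactness of the
    quadrature. *)
Lemma pint_lobatto_poly (s : {poly R}) :
  pint (-1) 1 (w * s) = lam * pint (-1) 1 (P * primitive s).
Proof.
rewrite mulrC -[s in LHS]deriv_primitive pint_by_parts deriv_lobatto_poly.
have := lobatto_poly_node (leqnn N); have := lobatto_poly_node (leq0n N).
rewrite x0E xNE => -> ->; rewrite !mulr0 subrr sub0r.
by rewrite -scalerAr pintZ mulNr opprK [P * _]mulrC.
Qed.

Lemma size_primitive (s : {poly R}) : (size (primitive s) <= (size s).+1)%N.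
Proof. exact: size_poly. Qed.

Lemma coef_lobatto_poly : w`_N.+1 = - N%:R * P`_N.
Proof.
have := congr1 (fun p : {poly R} => p`_N) deriv_lobatto_poly.
rewrite coef_deriv coefZ -[LHS]mulr_natr natrM => e.
have N0 : N.+1%:R != 0 :> R by rewrite pnatr_eq0.
by apply: (mulIf N0); rewrite e; ring.
Qed.

Lemma coef_XsubC_mul c (q : {poly R}) n : (size q <= n.+1)%N ->
  (('X - c%:P) * q)`_n.+1 = q`_n.
Proof.
by move=> sq; rewrite mulrBl coefB coefXM coefCM /= [q`_n.+1]nth_default ?mulr0 ?subr0.
Qed.

(** Two evaluations of the integral of [w_i P_N], where [w_i = w / (X - x_i)]. By leading
    coefficients it is [- 2 N / (2 N + 1)]. With [P_N = P_N(x_i) + (X - x_i) s] it is the integral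
    of [w s], which is [2 (N + 1) / (2 N + 1)], plus the quantity sought. *)
Lemma pint_lobatto_cofactor (i : 'I_N.+1) : P.[x i] * pint (-1) 1 (wq i) = - 2.
Proof.
have PN0 := coef_legendre_neq0 R N.
have lt0 := lam_gt0.
have N0 : N%:R != 0 :> R by rewrite pnatr_eq0 -lt0n.
have e1 : pint (-1) 1 (wq i * P) = - N%:R * (2 / (2 * N + 1)%:R).
  rewrite pint_legendre_lead ?size_lobatto_cofactor // pint_legendre_sqr.
  congr (_ * _); rewrite -(@coef_XsubC_mul (x i)) ?size_lobatto_cofactor //.
  by rewrite -lobatto_cofactorE coef_lobatto_poly mulfK.
have /factor_theorem [s es] : root (P - P.[x i]%:P) (x i).
  by apply/rootP; rewrite hornerD hornerN hornerC subrr.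
have ss : (size s <= N)%N.
  have [->|s0] := eqVneq s 0; first by rewrite size_poly0.
  have := size_Mmonic s0 (monicXsubC (x i)); rewrite -es size_XsubC addn2 /=.
  have : (size (P - P.[x i]%:P)%R <= N.+1)%N.
    rewrite (leq_trans (size_polyD _ _)) // geq_max size_legendre_le size_polyN.
    by rewrite (leq_trans (size_polyC_leq1 _)).
  by move=> h e; move: h; rewrite e.
have e2 : pint (-1) 1 (w * s) = N.+1%:R * (2 / (2 * N + 1)%:R).
  rewrite pint_lobatto_poly [P * _]mulrC pint_legendre_lead; last first.
    by rewrite (leq_trans (size_primitive _)).
  rewrite pint_legendre_sqr [LHS]mulrA; congr (_ * _).
  have : (primitive s)`_N * N%:R = P`_N.
    have -> : P`_N = s`_N.-1.
      have := coef_XsubC_mul (x i) (n := N.-1) (q := s).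
      rewrite prednK // mulrC -es => /(_ ss) <-.
      by rewrite coefB coefC -[N == 0%N]negbK -lt0n N1 subr0.
    have := congr1 (fun p : {poly R} => p`_N.-1) (deriv_primitive s).
    by rewrite coef_deriv prednK // -[LHS]mulr_natr.
  move=> h; have a0 : (primitive s)`_N != 0.
    by apply: contraNneq PN0 => a0; rewrite -h a0 mul0r.
  by rewrite -h natrM; field; rewrite N0 a0.
have : pint (-1) 1 (wq i * P) = pint (-1) 1 (w * s) + P.[x i] * pint (-1) 1 (wq i).
  rewrite -pintCM -pintD; congr pint; rewrite (lobatto_cofactorE i).
  by rewrite -[P in LHS](subrK (P.[x i])%:P) es; ring.
rewrite e1 e2 => e; have : P.[x i] * pint (-1) 1 (wq i) =
    - (2 * N + 1)%:R * (2 / (2 * N + 1)%:R).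
  have -> : (2 * N + 1)%:R = N%:R + N.+1%:R :> R by rewrite -natrD; congr _%:R; lia.
  by move: e; have -> : (2 * N + 1)%:R = N%:R + N.+1%:R :> R; [rewrite -natrD; congr _%:R; lia | lra].
move=> ->; rewrite mulNr mulrCA divff ?mulr1 // pnatr_eq0 addn1.
Qed.

Lemma pint_lobatto_lagrange (i : 'I_N.+1) : pint (-1) 1 (lobatto_lagrange i) = weight i.
Proof.
have P0 := legendre_node_neq0 (leq_ord i).
have l0 : lam != 0 by rewrite gt_eqF ?lam_gt0.
rewrite /lobatto_lagrange /weight pintZ.
have -> : pint (-1) 1 (wq i) = - 2 / P.[x i].
  by apply: (mulfI P0); rewrite pint_lobatto_cofactor; field.
by move: (lam) l0 => l l0; field; rewrite P0 l0.
Qed.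

Definition quad (q : {poly R}) : R := \sum_(i < N.+1) weight i * q.[x i].

(** Euclidean division by [w]: the quotient has degree at most [N - 2], so its term integrates to 0,
    and the remainder is determined by its nodal values, which are those of [q]. *)
Lemma quad_exact (q : {poly R}) : (size q <= 2 * N)%N -> pint (-1) 1 q = quad q.
Proof.
move=> sq; have w0 := lobatto_poly_neq0.
have srem : (size (q %% w)%R <= N.+1)%N.
  by have := ltn_modp q w; rewrite w0 size_lobatto_poly.
have sdiv : (size (q %/ w)%R <= N.-1)%N.
  by rewrite size_divp // size_lobatto_poly; move: (size q) sq => k; lia.
rewrite {1}(divp_eq q w) pintD mulrC pint_lobatto_poly legendre_orth ?mulr0 ?add0r.
  rewrite {1}(lobatto_interpolation srem) pint_sum; apply: eq_bigr => i _.
  rewrite pintZ pint_lobatto_lagrange mulrC; congr (_ * _).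
  rewrite {2}(divp_eq q w) hornerD hornerM lobatto_poly_node ?leq_ord //.
  by rewrite mulr0 add0r.
by rewrite (leq_trans (size_primitive _)) //; move: (size _) sdiv N1 => k; lia.
Qed.

Lemma sum_weight : \sum_(i < N.+1) weight i = 2.
Proof.
have := @quad_exact 1; rewrite size_poly1 /quad (@pintC R (-1) 1 1) => e.
transitivity (1 * (1 - -1) : R); last by lra.
by rewrite e; [apply: eq_bigr => i _; rewrite hornerC mulr1 | lia].
Qed.

Lemma deriv_prod_XsubC (I : Type) (r : seq I) (Q : pred I) (a : I -> R) y :
  (forall i, Q i -> y != a i) ->
  (\prod_(i <- r | Q i) ('X - (a i)%:P))^`().[y] =
  (\prod_(i <- r | Q i) ('X - (a i)%:P)).[y] * \sum_(i <- r | Q i) (y - a i)^-1.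
Proof.
move=> ya; elim: r => [|i r IH]; first by rewrite !big_nil derivC horner0 mulr0.
rewrite !big_cons; case: ifP => // Qi.
have yi : y - a i != 0 by rewrite subr_eq0 ya.
rewrite derivM derivXsubC mul1r !(hornerXsubC, hornerD, hornerM) IH.
by field.
Qed.

(** Stieltjes' relations: the sum is the logarithmic derivative at [x_i] of the cofactor [w_i].
    Differentiating [w = (X - x_i) w_i] twice gives [w'' = 2 w_i'] there, while
    [w'' = - lam P_N']. *)
Lemma sum_inv_node_dist (i : 'I_N.+1) :
  \sum_(j < N.+1 | j != i) (x i - x j)^-1 = P^`().[x i] / (2 * P.[x i]).
Proof.
have P0 := legendre_node_neq0 (leq_ord i).
have l0 : lam != 0 by rewrite gt_eqF ?lam_gt0.
have e : (wq i)^`().[x i] = (wq i).[x i] * \sum_(j < N.+1 | j != i) (x i - x j)^-1.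
  rewrite /wq derivZ !hornerZ deriv_prod_XsubC ?mulrA // => j ji.
  by rewrite eqx ?leq_ord // eq_sym.
have := congr1 (fun p : {poly R} => p^`().[x i]) deriv_lobatto_poly.
rewrite derivZ hornerZ {1}(lobatto_cofactorE i) derivM derivXsubC mul1r.
rewrite derivD derivM derivXsubC mul1r !(hornerXsubC, hornerD, hornerM) subrr.
rewrite mul0r addr0 e lobatto_cofactor_diag => h.
have {}h : 2 * P.[x i] * \sum_(j < N.+1 | j != i) (x i - x j)^-1 = P^`().[x i].
  by apply: (mulfI l0); lra.
by rewrite -h [X in _ = X / _]mulrC mulfK // mulf_neq0 // pnatr_eq0.
Qed.

(** Stieltjes' relation at the node 1. It bounds every [1 - x_i] from below and is the total mass of
    the Cauchy-Schwarz weights [1 / (1 - x_i)] used near the endpoint. *)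
Lemma sum_inv_dist1 : \sum_(i < N) (1 - x i)^-1 = lam / 4.
Proof.
have := sum_inv_node_dist ord_max; rewrite big_mkcond big_ord_recr /= eqxx addr0.
rewrite xNE legendre1 deriv_legendre1 => e.
transitivity (lam / 2 / (2 * 1)); last by field.
rewrite -e; apply: eq_bigr => i _.
by rewrite -val_eqE /= neq_ltn ltn_ord.
Qed.

End LobattoQuadrature.
End Nodes.

(** * Mesh size *)

Local Opaque legendre.

Section Reflection.
Variable R : realType.

Lemma root_lobatto_polyN n (y : R) : root (lobatto_poly R n) (- y) = root (lobatto_poly R n) y.
Proof.
have e : (legendre R n)^`().[- y] = - ((-1) ^+ n * (legendre R n)^`().[y]).
  move: (legendre R n) (legendre_comp_oppX R n) => q.
  move/(congr1 (fun p : {poly R} => p^`().[y])).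
  rewrite deriv_comp derivN derivX mulrN1 hornerN horner_comp hornerN hornerX.
  by rewrite derivZ hornerZ => <-; rewrite opprK.
rewrite !rootE !hornerM e mulf_eq0 [RHS]mulf_eq0; congr orb.
  by rewrite !(hornerD, hornerN, hornerM, hornerX, hornerC); congr (_ == _); ring.
by rewrite oppr_eq0 mulf_eq0 expf_eq0 oppr_eq0 oner_eq0 andbF.
Qed.

(** Through the reflected nodes, each estimate near 1 has its counterpart near [-1]. *)
Lemma lobatto_nodes_opp n (x : nat -> R) : lobatto_nodes n x ->
  lobatto_nodes n (fun i => - x (n - i)%N).
Proof.
move=> [x0 xn ltx r ex]; split.
- by rewrite subn0 xn.
- by rewrite subnn x0 opprK.
- by move=> i j ij; rewrite ltrN2 ltx //; lia.
- by move=> i _; rewrite root_lobatto_polyN r // leq_subr.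
- move=> y; rewrite -root_lobatto_polyN => /ex[i iN e].
  by exists (n - i)%N; rewrite ?leq_subr // subKn // -e opprK.
Qed.

End Reflection.

Section Monotonicity.
Variable R : realType.

Lemma ratio_nondecreasing (f g : {poly R}) (a b : R) : a <= b ->
  (forall y, a <= y <= b -> 0 < g.[y]) ->
  (forall y, a < y < b -> 0 <= (f^`() * g - f * g^`()).[y]) ->
  f.[a] * g.[b] <= f.[b] * g.[a].
Proof.
rewrite le_eqVlt => /orP[/eqP <- //|ab] g0 h0.
pose r y := f.[y] / g.[y].
have gab y : a <= y <= b -> g.[y] != 0 by move=> /g0/lt0r_neq0.
have dr y : a <= y <= b ->
    is_derive y 1 r ((f^`() * g - f * g^`()).[y] / g.[y] ^+ 2).
  move=> yab; have gy := gab _ yab.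
  have dV : is_derive y (1 : R) (fun z => (g.[z])^-1) (- (g.[y]) ^- 2 *: g^`().[y]).
    by apply: is_deriveV.
  apply: trigger_derive.
  rewrite /= !(hornerD, hornerN, hornerM) /GRing.scale /=.
  by field.
have [y + e] : exists2 y, y \in `]a, b[ &
    r b - r a = (f^`() * g - f * g^`()).[y] / g.[y] ^+ 2 * (b - a).
  apply: MVT => // [y|].
    by rewrite in_itv => /andP[ay yb]; apply: dr; rewrite !ltW.
  apply: derivable_within_continuous => y; rewrite in_itv => yab.
  by have [] := dr y yab.
rewrite in_itv /= => yab.
have : r a <= r b.
  rewrite -subr_ge0 e mulr_ge0 ?subr_ge0 ?(ltW ab) //.
  by rewrite mulr_ge0 ?h0 // invr_ge0 sqr_ge0.
have ga : 0 < g.[a] by rewrite g0 // lexx ltW.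
have gb : 0 < g.[b] by rewrite g0 // lexx ltW.
by rewrite /r ler_pdivrMr // mulrAC ler_pdivlMr.
Qed.

Lemma ratio_nonincreasing (f g : {poly R}) (a b : R) : a <= b ->
  (forall y, a <= y <= b -> 0 < g.[y]) ->
  (forall y, a < y < b -> (f^`() * g - f * g^`()).[y] <= 0) ->
  f.[b] * g.[a] <= f.[a] * g.[b].
Proof.
move=> ab g0 h0; have := @ratio_nondecreasing (- f) g a b ab g0.
rewrite !hornerN !mulNr lerN2; apply=> y /h0.
by rewrite derivN !mulNr -opprD hornerN oppr_ge0.
Qed.

End Monotonicity.

Section Mesh.
Variable R : realType.
Variables (N : nat) (x : nat -> R).
Hypotheses (N1 : (1 <= N)%N) (nodes : lobatto_nodes N x).
Local Notation P := (legendre R N).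
Local Notation w := (lobatto_poly R N).
Local Notation lam := ((N * N.+1)%:R : R).

Let x0 := x0E nodes.
Let xN := xNE nodes.
Let lam0 := lam_gt0 R N1.

Lemma node_ge i : (i <= N)%N -> -1 <= x i.
Proof. by move=> iN; rewrite -x0 (lex nodes). Qed.

Lemma node_le i : (i <= N)%N -> x i <= 1.
Proof. by move=> iN; rewrite -xN (lex nodes) // iN leqnn. Qed.

Lemma node_gt i : (0 < i <= N)%N -> -1 < x i.
Proof. by move=> iN; rewrite -x0 (ltx nodes). Qed.

Lemma node_lt i : (i < N)%N -> x i < 1.
Proof. by move=> iN; rewrite -xN (ltx nodes) // iN leqnn. Qed.

Lemma node_ltS i : (i < N)%N -> x i < x i.+1.
Proof. by move=> iN; rewrite (ltx nodes) // ltnSn. Qed.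

Lemma deriv_legendre_neq0 i y : (i < N)%N -> x i < y < x i.+1 -> P^`().[y] != 0.
Proof.
move=> iN /andP[iy yi]; apply/eqP => P'0.
have [_ _ _ _ /(_ y)] := nodes; case.
  by rewrite rootM; apply/orP; right; apply/rootP.
move=> j jN e; move: iy yi; rewrite e.
have [ij|ji] := ltnP i j.
  by move=> _ /lt_geF/negP; apply; rewrite (lex nodes) // ij jN.
by move=> /lt_geF/negP + _; apply; rewrite (lex nodes) // ji ltnW.
Qed.

Lemma horner_lobatto_poly y : w.[y] = (1 - y ^+ 2) * P^`().[y].
Proof. by rewrite hornerM !(hornerD, hornerN, horner_exp, hornerX, hornerC). Qed.

Lemma horner_deriv_lobatto_poly y : w^`().[y] = - lam * P.[y].
Proof. by rewrite deriv_lobatto_poly hornerZ. Qed.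

Lemma horner_deriv2_lobatto_poly y : w^`()^`().[y] = - lam * P^`().[y].
Proof. by rewrite deriv_lobatto_poly derivZ hornerZ. Qed.

Lemma deriv_wronskian (p q : {poly R}) :
  (p * q^`() - p^`() * q)^`() = p * q^`()^`() - p^`()^`() * q.
Proof. by rewrite derivB !derivM; ring. Qed.

(* The Sturm comparison for [w'' = - lam / (1 - x^2) w], whose zeros are the nodes. *)
Lemma sturm i (z : {poly R}) : (i < N)%N -> z.[x i] = 0 -> z.[x i.+1] = 0 ->
  exists2 y, x i < y < x i.+1 & (1 - y ^+ 2) * z^`()^`().[y] + lam * z.[y] = 0.
Proof.
move=> iN zi zi1.
have wi := lobatto_poly_node nodes (ltnW iN).
have wi1 := lobatto_poly_node nodes iN.
(* The Wronskian of [w] and [z] vanishes at both nodes. Its derivative is [P_N'] times the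
   expression sought, and [P_N'] has no zero between consecutive nodes. *)
have [] := @poly_rolle _ (x i) (x i.+1) (w * z^`() - w^`() * z).
- exact: node_ltS.
- by rewrite !(wi, wi1, zi, zi1, hornerD, hornerN, hornerM) !mul0r !mulr0.
move=> y; rewrite in_itv /= deriv_wronskian => yi e; exists y => //.
apply: (mulfI (deriv_legendre_neq0 iN yi)); rewrite mulr0 -[RHS]e.
rewrite !(horner_lobatto_poly, horner_deriv2_lobatto_poly, hornerD, hornerN, hornerM).
by ring.
Qed.

(** Sturm comparison with a squared parabola: [z = s^2] and [z'' = 2 h^2 - 12 s], where
    [s = (y - x_i)(x_(i+1) - y)]. As [z''] must be negative, [1 - y^2] may be replaced by [m]; then
    [lam s^2 - 12 m s + 2 m h^2 <= 0], and the discriminant yields 18. *)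
Lemma spacing_upper i (m : R) : (i < N)%N ->
  (forall y, x i < y < x i.+1 -> 1 - y ^+ 2 <= m) ->
  lam * (x i.+1 - x i) ^+ 2 <= 18 * m.
Proof.
move=> iN pm; rewrite leNgt; apply/negP => lt.
pose z : {poly R} := (('X - (x i)%:P) * ((x i.+1)%:P - 'X)) ^+ 2.
have [||y yi] := sturm (z := z) iN.
- by rewrite !(horner_exp, hornerM, hornerXsubC) subrr mul0r expr0n.
- by rewrite !(horner_exp, hornerM, hornerD, hornerN, hornerC, hornerX) subrr mulr0 expr0n.
have := pm y yi; have yN : -1 < y < 1.
  by have := node_ge (ltnW iN); have := node_le iN; lra.
set h := x i.+1 - x i; pose s := (y - x i) * (x i.+1 - y).
have s0 : 0 < s by rewrite mulr_gt0; lra.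
have -> : z^`()^`().[y] = 2 * h ^+ 2 - 12 * s.
  rewrite /z expr2 !(derivM, derivD, derivN, deriv0, derivC, derivX).
  rewrite !(hornerD, hornerN, hornerM, hornerC, hornerX, horner_exp).
  by rewrite /h /s; ring.
have -> : z.[y] = s ^+ 2.
  by rewrite /z horner_exp hornerM hornerXsubC !(hornerD, hornerN, hornerC, hornerX).
rewrite -/h in lt; have p0 : 0 < 1 - y ^+ 2 by nra.
move: (1 - y ^+ 2) p0 => p p0 le_pm e.
have ls : 0 < lam * s ^+ 2 by rewrite mulr_gt0 // exprn_gt0.
have [h12|h12] := leP 0 (2 * h ^+ 2 - 12 * s).
  by have : 0 <= p * (2 * h ^+ 2 - 12 * s) by [rewrite mulr_ge0 // ltW]; lra.
have A : m * (2 * h ^+ 2 - 12 * s) + lam * s ^+ 2 <= 0.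
  by rewrite -e lerD2r ler_wnM2r // ltW.
have m0 : 0 < m by apply: lt_le_trans le_pm.
have := sqr_ge0 (lam * s - 6 * m).
have := mulr_ge0_le0 (ltW lam0) A.
have : m * (18 * m) < m * (lam * h ^+ 2) by rewrite ltr_pM2l.
by move: (lam) => l; lra.
Qed.

(** Now the parabola itself is the test function: [2 (1 - y^2) = lam s] and [s <= h^2 / 4]. *)
Lemma spacing_lower i (m : R) : (i < N)%N ->
  (forall y, x i < y < x i.+1 -> m <= 1 - y ^+ 2) ->
  8 * m <= lam * (x i.+1 - x i) ^+ 2.
Proof.
move=> iN pm.
pose z : {poly R} := ('X - (x i)%:P) * ((x i.+1)%:P - 'X).
have [||y yi] := sturm (z := z) iN.
- by rewrite !(hornerM, hornerXsubC) subrr mul0r.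
- by rewrite !(hornerM, hornerD, hornerN, hornerC, hornerX) subrr mulr0.
have -> : z^`()^`().[y] = - 2.
  rewrite /z !(derivM, derivD, derivN, deriv0, derivC, derivX).
  rewrite !(hornerD, hornerN, hornerM, hornerC, hornerX, horner_exp).
  by ring.
have -> : z.[y] = (y - x i) * (x i.+1 - y).
  by rewrite /z hornerM hornerXsubC !(hornerD, hornerN, hornerC, hornerX).
have := pm y yi; move: (1 - y ^+ 2) => p mp e.
have : 4 * ((y - x i) * (x i.+1 - y)) <= (x i.+1 - x i) ^+ 2.
  by have := sqr_ge0 (y - x i - (x i.+1 - y)); nra.
move: (_ * (x i.+1 - y)) e => s e.
by move/(ler_wpM2l (ltW lam0)); lra.
Qed.

(** The factor [1 - x] of the test function cancels the zero of [1 - x^2] at 1. With [1 + y <= 2]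
    this leaves [lam t^2 - 12 t + 4 d <= 0], whose discriminant forces [lam d <= 9]. *)
Lemma last_spacing_upper : lam * (1 - x N.-1) <= 9.
Proof.
have iN : (N.-1 < N)%N by rewrite prednK.
have eN : N.-1.+1 = N by rewrite prednK.
rewrite leNgt; apply/negP => lt.
pose z : {poly R} := (1 - 'X) * ('X - (x N.-1)%:P) ^+ 2.
have [||y] := sturm (z := z) iN.
- by rewrite !(hornerM, horner_exp, hornerXsubC) subrr mul0r mulr0.
- by rewrite eN xN !(hornerM, horner_exp, hornerD, hornerN, hornerC, hornerX) subrr mul0r.
rewrite eN xN => /andP[ay y1].
set d := 1 - x N.-1; set t := y - x N.-1.
have -> : z^`()^`().[y] = 2 * d - 6 * t.
  rewrite /z expr2 !(derivM, derivD, derivN, deriv0, derivC, derivX).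
  rewrite !(hornerD, hornerN, hornerM, hornerC, hornerX, horner_exp).
  by rewrite /d /t; ring.
have -> : z.[y] = (1 - y) * t ^+ 2.
  by rewrite /z hornerM horner_exp hornerXsubC !(hornerD, hornerN, hornerC, hornerX).
have t0 : 0 < t by rewrite subr_gt0.
have ym : -1 < y by have := node_ge (ltnW iN); lra.
have y10 : 1 - y != 0 by rewrite subr_eq0 gt_eqF.
move=> e; have {}e : (1 + y) * (2 * d - 6 * t) + lam * t ^+ 2 = 0.
  by apply: (mulfI y10); rewrite mulr0 -[RHS]e; ring.
have ls : 0 < lam * t ^+ 2 by rewrite mulr_gt0 // exprn_gt0.
have [h12|h12] := leP 0 (2 * d - 6 * t).
  by have : 0 <= (1 + y) * (2 * d - 6 * t) by [rewrite mulr_ge0 //; lra]; lra.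
have : 2 * (2 * d - 6 * t) + lam * t ^+ 2 <= 0.
  by rewrite -e lerD2r ler_wnM2r //; lra.
rewrite -/d in lt; move=> A; have := sqr_ge0 (lam * t - 6).
have := mulr_ge0_le0 (ltW lam0) A.
by move: (lam) lt => l; lra.
Qed.

Lemma dist1_lower i : (i < N)%N -> 4 <= lam * (1 - x i).
Proof.
move=> iN; have d0 : 0 < 1 - x i by rewrite subr_gt0 node_lt.
have : (1 - x i)^-1 <= lam / 4.
  rewrite -(sum_inv_dist1 N1 nodes) (bigD1 (Ordinal iN)) //= lerDl.
  by apply: sumr_ge0 => j _; rewrite invr_ge0 subr_ge0 node_le // ltnW.
by rewrite -div1r ler_pdivrMr //; lra.
Qed.

Lemma dist1_ratio i : (i.+1 < N)%N -> 1 - x i <= 11 * (1 - x i.+1).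
Proof.
move=> iN; have := dist1_lower iN.
have iN' := ltnW iN; have := node_lt iN; have := node_lt iN'.
have m1 := node_ge (ltnW iN').
have := @spacing_upper i (2 * (1 - x i)) iN'.
have -> : x i.+1 - x i = (1 - x i) - (1 - x i.+1) by ring.
move=> h; have {}h := h _; move: h.
set u := 1 - x i; set v := 1 - x i.+1 => h u0 v0 lv.
have {}h : lam * (u - v) ^+ 2 <= 18 * (2 * u).
  by apply: h => y yi; have := node_ltS iN'; have := node_le iN'; rewrite /u; nra.
rewrite -subr_gt0 -/u in u0; rewrite -subr_gt0 -/v in v0.
(* The bound [lam v >= 4] removes [lam]. What remains is [u^2 - 11 u v + v^2 <= 0], whence the
   factor 11. *)
have : 4 * (u - v) ^+ 2 <= 36 * u * v.
  have : 4 * (u - v) ^+ 2 <= lam * v * (u - v) ^+ 2 by rewrite ler_wpM2r ?sqr_ge0.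
  have : lam * (u - v) ^+ 2 * v <= 18 * (2 * u) * v by rewrite ler_wpM2r // ltW.
  lra.
nra.
Qed.

End Mesh.

(** * Mesh size and weights *)

Section Amplitude.
Variable R : realType.
Variables (N : nat) (x : nat -> R).
Hypotheses (N2 : (2 <= N)%N) (nodes : lobatto_nodes N x).
Local Notation P := (legendre R N).
Local Notation w := (lobatto_poly R N).
Local Notation lam := ((N * N.+1)%:R : R).

Let N1 : (1 <= N)%N := ltnW N2.
Let x0 := x0E nodes.
Let xN := xNE nodes.

Lemma distN1_lower i : (0 < i <= N)%N -> 4 <= lam * (1 + x i).
Proof.
move=> iN; have := dist1_lower N1 (lobatto_nodes_opp nodes) (i := (N - i)%N).
by rewrite subKn ?opprK; [apply; lia | lia].
Qed.

Lemma distN1_ratio i : (0 < i < N)%N -> 1 + x i.+1 <= 11 * (1 + x i).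
Proof.
move=> iN; have := dist1_ratio N1 (lobatto_nodes_opp nodes) (i := (N - i.+1)%N).
rewrite subKn ?opprK; last by lia.
have -> : (N - (N - i.+1).+1)%N = i by lia.
by apply; lia.
Qed.

Lemma first_spacing_upper : lam * (1 + x 1%N) <= 9.
Proof.
have := last_spacing_upper N1 (lobatto_nodes_opp nodes).
by rewrite opprK; have -> : (N - N.-1)%N = 1%N by lia.
Qed.

(** This is [1 - x_j^2], kept factored because neighbouring nodes are compared factor by factor. *)
Definition node_metric j : R := (1 - x j) * (1 + x j).
Local Notation p := node_metric.

Lemma node_metric_gt0 j : (0 < j < N)%N -> 0 < p j.
Proof.
move=> /andP[j0 jN]; rewrite mulr_gt0 //.
  by rewrite subr_gt0 (node_lt nodes).
by have := node_gt nodes (i := j); rewrite j0 (ltnW jN) => /(_ isT); lra.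
Qed.

Lemma node_metric_lower j : (0 < j < N)%N -> 4 <= lam * p j.
Proof.
move=> /andP[j0 jN].
have d0 : 0 < 1 - x j by rewrite subr_gt0 (node_lt nodes).
have D0 : 0 < 1 + x j.
  by have := node_gt nodes (i := j); rewrite j0 (ltnW jN) => /(_ isT); lra.
have d4 := dist1_lower N1 nodes jN.
have D4 : 4 <= lam * (1 + x j) by apply: distN1_lower; rewrite j0 (ltnW jN).
move: (lam) d4 D4 => l d4 D4; rewrite /p mulrA; have [xj|xj] := leP 0 (x j).
  by apply: (le_trans d4); rewrite ler_peMr //; lra.
by rewrite mulrAC; apply: (le_trans D4); rewrite ler_peMr //; lra.
Qed.

Lemma metric_interval_le i j y : (i < N)%N -> (0 < j < N)%N ->
  (j == i) || (j == i.+1) -> x i <= y <= x i.+1 -> 1 - y ^+ 2 <= 11 * p j.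
Proof.
move=> iN jN ij /andP[iy yi].
have -> : 1 - y ^+ 2 = (1 - y) * (1 + y) by ring.
have yy : -1 <= y <= 1.
  by have := node_ge nodes (ltnW iN); have := node_le nodes iN; lra.
rewrite /p; case/orP: ij => /eqP jE.
  have := distN1_ratio jN; rewrite jE => D11.
  rewrite mulrCA; apply: ler_pM; lra.
have iN' : (i.+1 < N)%N by lia.
have := dist1_ratio N1 nodes iN'; rewrite -jE => D11.
rewrite mulrA; apply: ler_pM; rewrite ?jE; rewrite ?jE in D11; lra.
Qed.

Lemma spacing_sqr_upper i j : (i < N)%N -> (0 < j < N)%N ->
  (j == i) || (j == i.+1) -> lam * (x i.+1 - x i) ^+ 2 <= 198 * p j.
Proof.
move=> iN jN ij.
have : lam * (x i.+1 - x i) ^+ 2 <= 18 * (11 * p j).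
  apply: (spacing_upper N1 nodes iN) => y /andP[iy yi].
  by apply: (metric_interval_le iN jN ij); rewrite !ltW.
lra.
Qed.

Lemma spacing_sqr_lower i j : (i < N)%N -> (0 < j < N)%N ->
  (j == i) || (j == i.+1) -> 8 * p j <= 11 * (lam * (x i.+1 - x i) ^+ 2).
Proof.
move=> iN jN ij; have pj0 := node_metric_gt0 jN.
have jN' : (j < N)%N by case/andP: jN.
have d0 : 0 < 1 - x j by rewrite subr_gt0 (node_lt nodes).
have D0 : 0 < 1 + x j.
  by have := node_gt nodes (i := j); case/andP: jN => -> /ltnW -> /(_ isT); lra.
(* On the two end intervals the infimum of [1 - y^2] is 0 and the parabola gives nothing. There the
   width is the distance from the inner node to the endpoint, which is at least [4 / lam]. *)
have [i0|i_gt0] := posnP i.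
  have j1 : j = 1%N by move: ij jN; rewrite i0; case/orP => /eqP ->.
  have := distN1_lower (i := 1%N) N1; rewrite i0 x0 /p j1 in D0 d0 *.
  move: (lam) => l D4; have : 4 * (1 + x 1) <= l * (1 + x 1) * (1 + x 1).
    by rewrite ler_wpM2r // ltW.
  by have := mulr_ge0 (ltW D0) (ltW D0); lra.
have [iN'|iN'] := ltnP i.+1 N; last first.
  have eN : i.+1 = N by apply/eqP; rewrite eqn_leq iN iN'.
  have ji : j = i by case/orP: ij jN => /eqP -> //; rewrite eN ltnn andbF.
  have := dist1_lower N1 nodes iN; rewrite eN xN /p ji in D0 d0 *.
  move: (lam) => l D4; have : 4 * (1 - x i) <= l * (1 - x i) * (1 - x i).
    by rewrite ler_wpM2r // ltW.
  by have := mulr_ge0 (ltW d0) (ltW d0); lra.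
have : 8 * ((1 - x i.+1) * (1 + x i)) <= lam * (x i.+1 - x i) ^+ 2.
  apply: (spacing_lower N1 nodes iN) => y /andP[iy yi].
  have -> : 1 - y ^+ 2 = (1 - y) * (1 + y) by ring.
  have := node_ge nodes (ltnW iN); have := node_le nodes iN.
  by move=> h1 h2; apply: ler_pM; lra.
have : p j <= 11 * ((1 - x i.+1) * (1 + x i)).
  have Di : 0 <= 1 + x i by have := node_ge nodes (ltnW iN); lra.
  have di : 0 <= 1 - x i.+1 by have := node_le nodes iN; lra.
  rewrite /p; case/orP: ij => /eqP jE; rewrite jE.
    by rewrite mulrA ler_wpM2r // (dist1_ratio N1 nodes).
  by rewrite mulrCA ler_wpM2l // distN1_ratio // i_gt0.
lra.
Qed.

(* [amplitude] is [4 (v_theta^2 + Q v^2) sin theta] for the Liouville normal form [v'' + Q v = 0],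
   [Q = (N + 1/2)^2 + 1 / (4 sin^2 theta)], [v = sqrt (sin theta) P_N (cos theta)]; the quantities
   [v_theta^2 + Q v^2] and [v^2 + v_theta^2 / Q] are monotone in opposite directions on both sides of 0. *)
Definition phase_weight : {poly R} := (4 * lam + 1) *: (1 - 'X^2) + 1.
Definition amplitude : {poly R} := (2 *: w - 'X * P) ^+ 2 + phase_weight * P ^+ 2.
Local Notation q := phase_weight.
Local Notation B := amplitude.

Lemma phase_weightE y : q.[y] = (4 * lam + 1) * (1 - y ^+ 2) + 1.
Proof.
by rewrite /q; move: (4 * lam + 1) => k; rewrite !(hornerZ, hornerD, hornerN, horner_exp, hornerX, hornerC).
Qed.

Lemma amplitudeE y : B.[y] = (2 * w.[y] - y * P.[y]) ^+ 2 + q.[y] * P.[y] ^+ 2.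
Proof.
rewrite /B; move: q w P => q' w' P'.
by rewrite !expr2 !(hornerM, hornerD, hornerN, hornerZ, hornerX).
Qed.

Lemma deriv_phase_weight y : q^`().[y] = - 2 * (4 * lam + 1) * y.
Proof.
rewrite /q; move: (4 * lam + 1) => k.
rewrite !(derivD, derivZ, derivN, derivXn, derivC) /= !expr1.
by rewrite !(hornerZ, hornerD, hornerN, hornerX, hornerC, hornerMn); ring.
Qed.

(** The Legendre equation, as [w' = - lam P_N] with [w = (1 - x^2) P_N'], collapses everything to
    one term with the sign of [y]; this makes 0 the turning point. *)
Lemma deriv_amplitude y :
  (1 - y ^+ 2) * B^`().[y] + y * B.[y] = 2 * y * P.[y] ^+ 2.
Proof.
have e : B^`().[y] = 2 * (2 * w.[y] - y * P.[y]) *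
    (2 * w^`().[y] - P.[y] - y * P^`().[y]) +
    (q^`().[y] * P.[y] ^+ 2 + q.[y] * (2 * P.[y] * P^`().[y])).
  rewrite /B; move: q w P => q' w' P'.
  rewrite !expr2 !(derivM, derivD, derivN, derivZ, derivX).
  by rewrite !(hornerM, hornerD, hornerN, hornerZ, hornerX, hornerC); ring.
rewrite e amplitudeE horner_deriv_lobatto_poly horner_lobatto_poly deriv_phase_weight phase_weightE.
by move: (lam) (P.[y]) (P^`().[y]) => l a b; ring.
Qed.

Lemma phase_weight_ge1 (y : R) : -1 <= y <= 1 -> 1 <= q.[y].
Proof.
move=> y1; rewrite phase_weightE lerDr mulr_ge0 //.
by nra.
Qed.

Lemma amplitude_ge0 (y : R) : -1 <= y <= 1 -> 0 <= B.[y].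
Proof.
move=> y1; rewrite amplitudeE addr_ge0 ?sqr_ge0 // mulr_ge0 ?sqr_ge0 //.
by have := phase_weight_ge1 y1; lra.
Qed.

Let one_sub_sqr : {poly R} := 1 - 'X^2.

Let one_sub_sqrE y : one_sub_sqr.[y] = 1 - y ^+ 2.
Proof. by rewrite !(hornerD, hornerN, horner_exp, hornerX, hornerC). Qed.

Let deriv_one_sub_sqr y : one_sub_sqr^`().[y] = - 2 * y.
Proof.
rewrite !(derivB, derivC, derivXn) /= expr1.
by rewrite !(hornerD, hornerN, hornerMn, hornerX, hornerC); ring.
Qed.

Lemma horner_derivM (f g : {poly R}) y :
  (f * g)^`().[y] = f^`().[y] * g.[y] + f.[y] * g^`().[y].
Proof. by rewrite derivM hornerD !hornerM. Qed.

(** The numerator of the derivative of [B^2 / (1 - y^2)]; squaring avoids the square root of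
    [1 - y^2]. *)
Let F_deriv y : ((B ^+ 2)^`() * one_sub_sqr - B ^+ 2 * one_sub_sqr^`()).[y] =
  y * (4 * (B.[y] * P.[y] ^+ 2)).
Proof.
have e := deriv_amplitude y.
transitivity (2 * B.[y] * ((1 - y ^+ 2) * B^`().[y] + y * B.[y])).
  rewrite -one_sub_sqrE; have := deriv_one_sub_sqr y.
  move: one_sub_sqr B => s b ds.
  by rewrite expr2 !(hornerD, hornerN, hornerM, horner_derivM) ds; ring.
by rewrite e; ring.
Qed.

(** The numerator of the derivative of [(1 - y^2) B^2 / q^2]. On the interval its sign is opposite
    to that of [y], so this quantity bounds the amplitude from the other side. *)
Let G_deriv y :
  ((one_sub_sqr * B ^+ 2)^`() * q ^+ 2 - one_sub_sqr * B ^+ 2 * (q ^+ 2)^`()).[y] =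
  - (y * (4 * (q.[y] * B.[y] * (2 * w.[y] - y * P.[y]) ^+ 2))).
Proof.
transitivity (q.[y] * B.[y] * ((- 2 * y * B.[y] + 2 * ((1 - y ^+ 2) * B^`().[y])) * q.[y]
    - 2 * (1 - y ^+ 2) * B.[y] * q^`().[y])).
  rewrite -one_sub_sqrE; have := deriv_one_sub_sqr y.
  move: one_sub_sqr B q => s b q' ds.
  by rewrite !expr2 !(hornerD, hornerN, hornerM, horner_derivM) ds; ring.
have -> : (1 - y ^+ 2) * B^`().[y] = 2 * y * P.[y] ^+ 2 - y * B.[y].
  by rewrite -deriv_amplitude; ring.
rewrite deriv_phase_weight.
have e : q.[y] * P.[y] ^+ 2 = B.[y] - (2 * w.[y] - y * P.[y]) ^+ 2.
  by rewrite amplitudeE; ring.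
have e2 : (4 * lam + 1) * (1 - y ^+ 2) = q.[y] - 1 by rewrite phase_weightE; ring.
have -> : (- 2 * y * B.[y] + 2 * (2 * y * P.[y] ^+ 2 - y * B.[y])) * q.[y] -
   2 * (1 - y ^+ 2) * B.[y] * (-2 * (4 * lam + 1) * y) =
   4 * y * (q.[y] * P.[y] ^+ 2) - 4 * y * B.[y] * q.[y]
   + 4 * y * B.[y] * ((4 * lam + 1) * (1 - y ^+ 2)) by ring.
by rewrite e e2; ring.
Qed.

Lemma amplitude_monotone (t : R) : -1 < t < 1 ->
  (1 - t ^+ 2) * B.[0] ^+ 2 <= B.[t] ^+ 2.
Proof.
move=> t1; have B0 (y : R) : -1 <= y <= 1 -> 0 <= 4 * (B.[y] * P.[y] ^+ 2).
  by move=> /amplitude_ge0 By; rewrite mulr_ge0 // mulr_ge0 // sqr_ge0.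
have s0 (a b : R) : -1 < a -> b < 1 -> forall y, a <= y <= b -> 0 < one_sub_sqr.[y].
  by move=> a1 b1 y yab; rewrite one_sub_sqrE; nra.
suff : (B ^+ 2).[0] * one_sub_sqr.[t] <= (B ^+ 2).[t] * one_sub_sqr.[0].
  by rewrite !one_sub_sqrE !horner_exp expr0n subr0 mulr1 mulrC.
have [t0|t0] := leP 0 t.
  apply: ratio_nondecreasing => // [|y yt]; first by apply: s0; lra.
  by rewrite F_deriv mulr_ge0 ?B0 //; lra.
apply: ratio_nonincreasing => [||y yt]; [exact: ltW | by apply: s0; lra|].
by rewrite F_deriv mulr_le0_ge0 ?B0 //; lra.
Qed.

Lemma normalized_amplitude_monotone (t : R) : -1 < t < 1 ->
  (1 - t ^+ 2) * B.[t] ^+ 2 * q.[0] ^+ 2 <= B.[0] ^+ 2 * q.[t] ^+ 2.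
Proof.
move=> t1.
have B0 (y : R) : -1 <= y <= 1 -> 0 <= 4 * (q.[y] * B.[y] * (2 * w.[y] - y * P.[y]) ^+ 2).
  move=> y1; have By := amplitude_ge0 y1; have qy := phase_weight_ge1 y1.
  by rewrite mulr_ge0 // mulr_ge0 ?sqr_ge0 // mulr_ge0 //; lra.
have s0 (a b : R) : -1 < a -> b < 1 -> forall y, a <= y <= b -> 0 < (q ^+ 2).[y].
  move=> a1 b1 y yab; rewrite horner_exp exprn_gt0 //.
  by have := @phase_weight_ge1 y; lra.
suff : (one_sub_sqr * B ^+ 2).[t] * (q ^+ 2).[0] <= (one_sub_sqr * B ^+ 2).[0] * (q ^+ 2).[t].
  have := one_sub_sqrE t; have := one_sub_sqrE 0; move: one_sub_sqr B q => s b k s0E stE.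
  by rewrite !expr2 !hornerM s0E stE !expr2 mul0r subr0 mul1r.
have [t0|t0] := leP 0 t.
  apply: ratio_nonincreasing => // [|y yt]; first by apply: s0; lra.
  by rewrite G_deriv oppr_le0 mulr_ge0 ?B0 //; lra.
apply: ratio_nondecreasing => [||y yt]; [exact: ltW | by apply: s0; lra|].
by rewrite G_deriv oppr_ge0 mulr_le0_ge0 ?B0 //; lra.
Qed.

End Amplitude.

Section Squares.
Variable R : realDomainType.
Implicit Types a b : R.

Lemma le_sqr a b : 0 <= a -> a <= b -> a ^+ 2 <= b ^+ 2.
Proof. by move=> a0 ab; rewrite lerXn2r // nnegrE (le_trans a0). Qed.

Lemma sqr_le a b : 0 <= b -> a ^+ 2 <= b ^+ 2 -> a <= b.
Proof.
move=> b0 ab; rewrite leNgt; apply/negP => ba; move: ab; apply/negP.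
by rewrite -ltNge ltrXn2r // nnegrE (le_trans b0) // ltW.
Qed.

End Squares.

Lemma big_nat_pred (V : nmodType) n (g : nat -> V) : (0 < n)%N ->
  \sum_(0 <= k < n) g k = \sum_(0 <= k < n.-1) g k + g n.-1.
Proof. by case: n => // n _; rewrite big_nat_recr. Qed.

(** * Comparability of quadrature weights and mesh widths *)

Section WeightComparison.
Variable R : realType.
Variables (N : nat) (x : nat -> R).
Hypotheses (N2 : (2 <= N)%N) (nodes : lobatto_nodes N x).
Local Notation P := (legendre R N).
Local Notation lam := ((N * N.+1)%:R : R).
Local Notation p := (node_metric x).
Local Notation rho := (weight N x).

Let N1 : (1 <= N)%N := ltnW N2.
Let x0 := x0E nodes.
Let xN := xNE nodes.
Let lam0 := lam_gt0 R N1.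

(** At a node [w = 0], so the amplitude is [(x^2 + q) P_N^2], and the two monotone quantities pin
    [p P_N^4] between multiples of [K^2], where [K = B(0) / q(0)]. The size of [K] is not computed
    here; it follows later from the sums of weights and widths. *)
Lemma legendre_node_bounds : exists2 K : R, 0 <= K &
  forall j, (0 < j < N)%N ->
    p j * P.[x j] ^+ 4 <= K ^+ 2 /\ 64 * K ^+ 2 <= 81 * (p j * P.[x j] ^+ 4).
Proof.
set B := amplitude R N; set q := phase_weight R N.
have B0 : 0 <= B.[0] by apply: (amplitude_ge0 N); lra.
have q0E : q.[0] = 4 * lam + 2 by rewrite phase_weightE expr0n subr0; ring.
have l0 := lam0; have q0 : 0 < q.[0] by rewrite q0E; lra.
exists (B.[0] / q.[0]); first by rewrite divr_ge0 // ltW.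
move=> j jN; have p0 := node_metric_gt0 nodes jN.
have p4 := node_metric_lower N2 nodes jN.
have pE : p j = 1 - x j ^+ 2 by rewrite /node_metric; ring.
have xj : -1 < x j < 1.
  by case/andP: jN => j0 jN; rewrite (node_gt nodes) ?(node_lt nodes) // j0 (ltnW jN).
have := amplitude_monotone N xj; have := normalized_amplitude_monotone N xj.
rewrite -/B -/q.
have -> : B.[x j] = (x j ^+ 2 + q.[x j]) * P.[x j] ^+ 2.
  by rewrite /B amplitudeE (lobatto_poly_node nodes) ?mulr0 ?add0r -/q; [ring | lia].
have qE : q.[x j] = (4 * lam + 1) * p j + 1 by rewrite /q phase_weightE pE.
have q1 : 0 < q.[x j] by rewrite qE; have := mulr_ge0 (ltW lam0) (ltW p0); lra.
move: q.[x j] q.[0] B.[0] P.[x j] q1 q0 qE q0E B0 => qj q0 B0 Pj qj0 q0p qE q0E B00.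
have x20 := sqr_ge0 (x j).
have P40 : 0 <= Pj ^+ 4 by rewrite exprn_even_ge0.
rewrite -pE => G F; rewrite expr_div_n; split.
  rewrite ler_pdivlMr ?exprn_gt0 //.
  rewrite -(ler_pM2r (exprn_gt0 2 qj0)); apply: le_trans G.
  have -> : p j * ((x j ^+ 2 + qj) * Pj ^+ 2) ^+ 2 * q0 ^+ 2 =
            p j * Pj ^+ 4 * q0 ^+ 2 * (x j ^+ 2 + qj) ^+ 2 by ring.
  apply: ler_wpM2l; last by apply: le_sqr; lra.
  by apply: mulr_ge0 (sqr_ge0 _); apply: mulr_ge0 P40; exact: ltW.
rewrite [leLHS]mulrA ler_pdivrMr ?exprn_gt0 // -(ler_pM2l p0).
have -> : p j * (64 * B0 ^+ 2) = 64 * (p j * B0 ^+ 2) by ring.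
apply: (@le_trans _ _ (64 * ((x j ^+ 2 + qj) * Pj ^+ 2) ^+ 2)); first by rewrite ler_pM2l.
have -> : 64 * ((x j ^+ 2 + qj) * Pj ^+ 2) ^+ 2 = Pj ^+ 4 * (8 * (x j ^+ 2 + qj)) ^+ 2 by ring.
have -> : p j * (81 * (p j * Pj ^+ 4) * q0 ^+ 2) = Pj ^+ 4 * (9 * p j * q0) ^+ 2 by ring.
rewrite ler_wpM2l //.
(* The claim [8 (x^2 + q) <= 9 p q(0)] reduces to [8 + 8 x^2 <= 4 lam p + 10 p], which [lam p >= 4]
   provides; hence the ratio [81 / 64]. *)
have x1 : x j ^+ 2 <= 1 by lra.
by apply: le_sqr; rewrite qE ?q0E; lra.
Qed.

Lemma weight0 : rho 0%N = 2 / lam.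
Proof. by rewrite /weight x0 legendreN1_sqr mulr1. Qed.

Lemma weightN : rho N = 2 / lam.
Proof. by rewrite /weight xN legendre1 expr1n mulr1. Qed.

Lemma sum_interior_weight : \sum_(1 <= j < N) rho j = 2 - 4 / lam.
Proof.
have := sum_weight N1 nodes; rewrite -(big_mkord xpredT (weight N x)) big_nat_recr //=.
rewrite big_ltn // weight0 weightN.
by move: (\sum_(_ <= _ < _) _) (lam) => S l; lra.
Qed.

Lemma sum_spacing : \sum_(0 <= i < N) (x i.+1 - x i) = 2.
Proof. by rewrite telescope_sumr // x0 xN; lra. Qed.

(** With [L = sqrt lam] and [s_j = sqrt (p j)], both [L h_i] and [lam K rho_j] are comparable to
    [s_j]. Only the size of [L K] is missing; summation over the mesh gives it, since the sums of
    [rho] and of [h] are known. *)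
Lemma interior_spacing_weight i j : (i < N)%N -> (0 < j < N)%N ->
  (j == i) || (j == i.+1) ->
  x i.+1 - x i <= 13 * rho j /\ rho j <= 43 * (x i.+1 - x i).
Proof.
have [K K0 nodeK] := legendre_node_bounds.
pose s k := Num.sqrt (p k); pose L := Num.sqrt lam.
have L0 : 0 < L by rewrite sqrtr_gt0.
have LL : L * L = lam by rewrite -expr2 sqr_sqrtr // ltW.
have s0 k : (0 < k < N)%N -> 0 < s k by move=> kN; rewrite sqrtr_gt0 (node_metric_gt0 nodes).
have ss k : (0 < k < N)%N -> s k ^+ 2 = p k.
  by move=> kN; rewrite sqr_sqrtr // ltW // (node_metric_gt0 nodes).
have lK k : (0 < k < N)%N -> 2 * s k <= lam * K * rho k /\ lam * K * rho k <= 9 / 4 * s k.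
  move=> kN; have [] := nodeK k kN.
  have -> : p k * P.[x k] ^+ 4 = (s k * P.[x k] ^+ 2) ^+ 2.
    by rewrite exprMn ss // -exprM.
  have P0 : P.[x k] != 0 by apply: (legendre_node_neq0 N1 nodes); lia.
  have P2 : 0 < P.[x k] ^+ 2 by rewrite exprn_even_gt0.
  have sk := s0 k kN; have sP : 0 < s k * P.[x k] ^+ 2 by rewrite mulr_gt0.
  have -> : lam * K * rho k = K * 2 / P.[x k] ^+ 2.
    rewrite /weight; have l0 : lam != 0 by rewrite gt_eqF.
    by move: (lam) l0 => l l0; field; rewrite P0.
  move/(sqr_le K0) => le1.
  have -> : 64 * K ^+ 2 = (8 * K) ^+ 2 by ring.
  have -> : 81 * (s k * P.[x k] ^+ 2) ^+ 2 = (9 * (s k * P.[x k] ^+ 2)) ^+ 2 by ring.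
  move/(sqr_le (mulr_ge0 (ler0n R 9) (ltW sP))) => le2.
  by rewrite ler_pdivlMr // ler_pdivrMr //; split; lra.
pose S := \sum_(1 <= k < N) s k.
have S_le : S <= L.
  have : S <= \sum_(1 <= k < N) (1 : R).
    rewrite /S big_nat [leRHS]big_nat; apply: ler_sum => k kN.
    have pk : p k <= 1 by rewrite /node_metric; have := sqr_ge0 (x k); lra.
    by rewrite -sqrtr1 ler_sqrt.
  rewrite sumr_const_nat => /le_trans; apply.
  apply: (sqr_le (ltW L0)); rewrite expr2 [leRHS]expr2 LL -natrM ler_nat.
  by rewrite leq_mul //; lia.
have lam6 : 6 <= lam by rewrite (ler_nat _ 6) (leq_trans (_ : 6 <= 2 * 3)%N) // leq_mul.
have LK_le : L * K <= 27 / 16.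
  (* The interior weights sum to at least [4 / 3] because [lam >= 6]; together with [S <= L] this
     gives [27 / 16]. *)
  have : lam * K * (2 - 4 / lam) <= 9 / 4 * S.
    rewrite -sum_interior_weight !mulr_sumr big_nat [leRHS]big_nat; apply: ler_sum => k kN.
    by have [] := lK k kN.
  have : 4 / lam <= 2 / 3 by rewrite ler_pdivrMr //; lra.
  move: (4 / lam) => c h1; rewrite -LL => h2.
  have : L * L * K * (4 / 3) <= L * L * K * (2 - c).
    by apply: ler_wpM2l; [rewrite !mulr_ge0 // ltW | lra].
  by move=> h3; rewrite -(ler_pM2l L0); lra.
(* Each interval is charged to its right node, the last one to its left node, so
   [2 L <= 15 (S + s_(N-1)) <= 30 S]. The 15 satisfies [198 <= 15^2]. *)
have L_le_S : L <= 15 * S.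
  have Lh k j' : (k < N)%N -> (0 < j' < N)%N -> (j' == k) || (j' == k.+1) ->
      L * (x k.+1 - x k) <= 15 * s j'.
    move=> kN jN' kj; apply: sqr_le; first by have := s0 j' jN'; lra.
    rewrite !exprMn ss // [L ^+ 2]expr2 LL.
    have := spacing_sqr_upper N2 nodes kN jN' kj; have := node_metric_gt0 nodes jN'.
    by lra.
  have e : L * 2 = \sum_(0 <= k < N) L * (x k.+1 - x k) by rewrite -mulr_sumr sum_spacing.
  have SE : S = \sum_(0 <= k < N.-1) s k.+1 by rewrite /S big_add1.
  move: e; rewrite big_nat_pred // => e.
  have : \sum_(0 <= k < N.-1) L * (x k.+1 - x k) <= 15 * S.
    rewrite SE mulr_sumr big_nat [leRHS]big_nat; apply: ler_sum => k kN.
    by apply: Lh; rewrite ?eqxx ?orbT //; lia.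
  have : L * (x N.-1.+1 - x N.-1) <= 15 * s N.-1.
    by apply: Lh; rewrite ?eqxx //; lia.
  have : s N.-1 <= S.
    have {1}-> : N.-1 = N.-2.+1 by lia.
    rewrite SE big_nat_pred; last by lia.
    rewrite lerDr big_nat; apply: sumr_ge0 => k kN.
    by rewrite ltW // s0 //; lia.
  lra.
have LK_ge : 1 / 15 <= L * K.
  have : 2 * S <= lam * K * (2 - 4 / lam).
    rewrite -sum_interior_weight !mulr_sumr big_nat [leRHS]big_nat; apply: ler_sum => k kN.
    by have [] := lK k kN.
  have : 0 <= 4 / lam by rewrite divr_ge0 // ltW.
  move: (4 / lam) => c c0; rewrite -LL => h2.
  have : L * L * K * (2 - c) <= L * L * K * 2.
    by apply: ler_wpM2l; [rewrite !mulr_ge0 // ltW | lra].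
  by move=> h3; rewrite -(ler_pM2l L0); lra.
move=> iN jN ij; have [lo up] := lK j jN; have sj := s0 j jN.
set h := x i.+1 - x i; have h0 : 0 < h by rewrite subr_gt0 (node_ltS nodes).
have Lh0 : 0 < L * h by rewrite mulr_gt0.
have rho0 : 0 < rho j by apply: (weight_gt0 N1 nodes); lia.
have Lr0 : 0 < L * rho j by rewrite mulr_gt0.
have h_up : L * h <= 15 * s j.
  apply: sqr_le; first by lra.
  rewrite !exprMn ss // [L ^+ 2]expr2 LL.
  have := spacing_sqr_upper N2 nodes iN jN ij; have := node_metric_gt0 nodes jN.
  by rewrite -/h; lra.
have h_lo : 4 / 5 * s j <= L * h.
  apply: (sqr_le (ltW Lh0)).
  rewrite !exprMn ss // [L ^+ 2]expr2 LL.
  have := spacing_sqr_lower N2 nodes iN jN ij; have := node_metric_gt0 nodes jN.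
  by rewrite -/h; lra.
have r_lo : 2 * s j <= 27 / 16 * (L * rho j).
  apply: (le_trans lo); rewrite -LL.
  have -> : L * L * K * rho j = (L * K) * (L * rho j) by ring.
  by rewrite ler_wpM2r // ltW.
have r_up : 1 / 15 * (L * rho j) <= 9 / 4 * s j.
  apply: le_trans up; rewrite -LL.
  have -> : L * L * K * rho j = (L * K) * (L * rho j) by ring.
  by rewrite ler_wpM2r // ltW.
(* The constants come from [15 * 27 / 32 < 13] and [15 * 9 / 4 * 5 / 4 < 43]. *)
by split; rewrite -(ler_pM2l L0); lra.
Qed.

(** The end nodes are added to the interior case: their weight is [2 / lam], and the adjacent width
    satisfies [4 <= lam h <= 9]. *)
Lemma spacing_weight i j : (i < N)%N -> (j == i) || (j == i.+1) ->
  x i.+1 - x i <= 13 * rho j /\ rho j <= 43 * (x i.+1 - x i).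
Proof.
move=> iN ij.
have aux (h : R) : 4 <= lam * h -> lam * h <= 9 -> h <= 13 * (2 / lam) /\ 2 / lam <= 43 * h.
  rewrite mulrA ler_pdivlMr // ler_pdivrMr // => h4 h9.
  by rewrite [h * _]mulrC -[43 * h * _]mulrA [h * _]mulrC; split; lra.
have [j0|j0] := posnP j.
  have i0 : i = 0%N by lia.
  rewrite j0 i0 weight0 x0 opprK addrC; apply: aux.
    by apply: (distN1_lower N2 nodes); rewrite N1.
  exact: first_spacing_upper.
have [jN|jN] := ltnP j N; first by apply: interior_spacing_weight; rewrite ?j0.
have jE : j = N by lia.
have iE : i = N.-1 by lia.
have iN' : N.-1.+1 = N by lia.
rewrite jE weightN iE iN' xN; apply: aux.
  by apply: (dist1_lower N1 nodes); rewrite iN' leqnn.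
exact: last_spacing_upper.
Qed.

End WeightComparison.

(** * Discrete norms *)

Section Lines.
Variable R : realType.
Implicit Types (a b c s t : R).

Definition line a b s t : {poly R} := s%:P + ((t - s) / (b - a)) *: ('X - a%:P).

Lemma lineE a b s t y : (line a b s t).[y] = s + (t - s) / (b - a) * (y - a).
Proof. by rewrite hornerD hornerC hornerZ hornerXsubC. Qed.

Lemma line_left a b s t : (line a b s t).[a] = s.
Proof. by rewrite lineE subrr mulr0 addr0. Qed.

Lemma line_right a b s t : a != b -> (line a b s t).[b] = t.
Proof. by move=> ab; rewrite lineE divfK ?subr_eq0 1?eq_sym // addrC subrK. Qed.

Lemma pint_line_sqr a b s t : a != b ->
  3 * pint a b (line a b s t ^+ 2) = (b - a) * (s ^+ 2 + s * t + t ^+ 2).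
Proof.
move=> ab; have ba : b - a != 0 by rewrite subr_eq0 eq_sym.
rewrite /line; set k := _ / _; have tE : t = s + k * (b - a) by rewrite divfK // addrC subrK.
move: k tE => k tE.
rewrite -pintCM (@pintE R a b (('X - a%:P) * ((3 * s ^+ 2)%:P + (3 * s * k)%:P * ('X - a%:P)
   + (k ^+ 2)%:P * ('X - a%:P) ^+ 2))).
  rewrite !expr2 !(hornerXsubC, hornerM, hornerD, hornerC) tE; ring.
by rewrite -mul_polyC expr2 !(derivM, derivD, derivN, derivC, derivX); ring.
Qed.

Lemma pint_1subX a : 2 * pint a 1 (1 - 'X) = (1 - a) ^+ 2.
Proof.
rewrite -pintCM (@pintE R a 1 (- (1 - 'X) ^+ 2)).
  by rewrite expr2 !(hornerN, hornerM, hornerD, hornerC, hornerX); ring.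
by rewrite expr2 !(derivM, derivD, derivN, derivC, derivX); ring.
Qed.

Lemma pint_1subX_line_sqr a s t : a != 1 ->
  12 * pint a 1 ((1 - 'X) * line a 1 s t ^+ 2) =
  (1 - a) ^+ 2 * (3 * s ^+ 2 + 2 * s * t + t ^+ 2).
Proof.
move=> ab; have ba : 1 - a != 0 by rewrite subr_eq0 eq_sym.
rewrite /line; set k := _ / _; have tE : t = s + k * (1 - a) by rewrite divfK // addrC subrK.
move: k tE => k tE.
rewrite -pintCM (@pintE R a 1 (- ((1 - 'X) ^+ 2 * ((6 * t ^+ 2)%:P - (8 * t * k)%:P * (1 - 'X)
   + (3 * k ^+ 2)%:P * (1 - 'X) ^+ 2)))).
  by rewrite !expr2 !(hornerN, hornerM, hornerD, hornerC, hornerX) tE; ring.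
rewrite -mul_polyC tE !expr2 !(derivM, derivD, derivN, derivC, derivX).
by rewrite !polyCM !polyCD !polyCM polyCB; ring.
Qed.

End Lines.

Section Sums.
Variable R : realType.

Lemma sum_adjacent_le n (g : nat -> R) : (forall i, (i <= n)%N -> 0 <= g i) ->
  \sum_(i < n) (g i + g i.+1) <= 2 * \sum_(i < n.+1) g i.
Proof.
move=> g0; rewrite big_split /= mulr2n mulrDl mul1r; apply: lerD.
  by rewrite big_ord_recr /= lerDl g0.
by rewrite big_ord_recl /= lerDr g0.
Qed.

Lemma sum_adjacent_ge n (g : nat -> R) : (0 < n)%N ->
  (forall i, (i <= n)%N -> 0 <= g i) ->
  \sum_(i < n.+1) g i <= \sum_(i < n) (g i + g i.+1).
Proof.
case: n => // n _ g0; rewrite big_split /= big_ord_recr /= lerD2l.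
by rewrite big_ord_recr /= lerDr; apply: sumr_ge0 => i _; apply/g0/leqW/ltn_ord.
Qed.

(** The hypothesis [a_i^2 <= b_i c_i] spares square roots and lets Cauchy-Schwarz estimates on
    single intervals be summed directly. *)
Lemma sum_CS n (a b c : 'I_n -> R) : (forall i, 0 <= b i) -> (forall i, 0 <= c i) ->
  (forall i, a i ^+ 2 <= b i * c i) ->
  (\sum_(i < n) a i) ^+ 2 <= (\sum_(i < n) b i) * \sum_(i < n) c i.
Proof.
elim: n a b c => [|n IH] a b c b0 c0 abc; first by rewrite !big_ord0 expr0n mul0r.
rewrite !big_ord_recr /=; set A := \sum_(_ < _) a _; set B := \sum_(_ < _) b _.
set C := \sum_(_ < _) c _.
have B0 : 0 <= B by apply: sumr_ge0.
have C0 : 0 <= C by apply: sumr_ge0.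
have ABC : A ^+ 2 <= B * C by apply: IH.
have bm := b0 ord_max; have cm := c0 ord_max; have := abc ord_max.
move: (a ord_max) (b ord_max) (c ord_max) bm cm => a' b' c' bm cm abc'.
have cross : 2 * (A * a') <= B * c' + b' * C.
  apply: (@le_trans _ _ `|2 * (A * a')|); first exact: ler_norm.
  rewrite -(ler_pXn2r (n := 2)) ?nnegrE ?addr_ge0 ?mulr_ge0 //.
  rewrite real_normK ?num_real //.
  have : (A * a') ^+ 2 <= (B * C) * (b' * c') by rewrite exprMn ler_pM ?sqr_ge0.
  have := sqr_ge0 (B * c' - b' * C); lra.
lra.
Qed.

End Sums.

Section NormEquivalences.
Variable R : realType.
Variables (N : nat) (x : nat -> R).
Hypotheses (N2 : (2 <= N)%N) (nodes : lobatto_nodes N x).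
Local Notation P := (legendre R N).
Local Notation lam := ((N * N.+1)%:R : R).
Local Notation rho := (weight N x).
Implicit Type u : {poly R}.

Let N1 : (1 <= N)%N := ltnW N2.
Let lam0 := lam_gt0 R N1.

Definition chord u i : {poly R} := line (x i) (x i.+1) u.[x i] u.[x i.+1].

Let rho_ge0 j : (j <= N)%N -> 0 <= rho j.
Proof. by move=> jN; apply/ltW/(weight_gt0 N1 nodes). Qed.

Let h_ge0 i : (i < N)%N -> 0 <= x i.+1 - x i.
Proof. by move=> iN; rewrite subr_ge0 (ltW (node_ltS nodes iN)). Qed.

Let hw i : (i < N)%N -> x i.+1 - x i <= 13 * rho i /\ rho i <= 43 * (x i.+1 - x i).
Proof. by move=> iN; apply: (spacing_weight N2 nodes); rewrite ?eqxx. Qed.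

Let hwS i : (i < N)%N -> x i.+1 - x i <= 13 * rho i.+1 /\ rho i.+1 <= 43 * (x i.+1 - x i).
Proof. by move=> iN; apply: (spacing_weight N2 nodes); rewrite ?eqxx ?orbT. Qed.

Lemma pint_chord_sqr u i : (i < N)%N ->
  (x i.+1 - x i) * (u.[x i] ^+ 2 + u.[x i.+1] ^+ 2) <= 6 * pint (x i) (x i.+1) (chord u i ^+ 2) /\
  2 * pint (x i) (x i.+1) (chord u i ^+ 2) <= (x i.+1 - x i) * (u.[x i] ^+ 2 + u.[x i.+1] ^+ 2).
Proof.
move=> iN; have xx : x i != x i.+1 by rewrite lt_eqF // (node_ltS nodes).
have := pint_line_sqr u.[x i] u.[x i.+1] xx; rewrite -/(chord u i).
have := h_ge0 iN; move: (x i.+1 - x i) (pint _ _ _) u.[x i] u.[x i.+1] => h I s t h0 e.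
have := mulr_ge0 h0 (sqr_ge0 (s + t)); have := mulr_ge0 h0 (sqr_ge0 (s - t)).
by split; lra.
Qed.

Lemma quadD p q : quad N x (p + q) = quad N x p + quad N x q.
Proof. by rewrite /quad -big_split; apply: eq_bigr => i _; rewrite hornerD mulrDr. Qed.

Lemma quadZ c q : quad N x (c *: q) = c * quad N x q.
Proof. by rewrite /quad mulr_sumr; apply: eq_bigr => i _; rewrite hornerZ mulrCA. Qed.

Lemma quad_legendre_sqr : quad N x (P ^+ 2) = 2 / N%:R.
Proof.
have e (i : 'I_N.+1) : rho i * (P ^+ 2).[x i] = 2 / lam.
  have P0 := legendre_node_neq0 N1 nodes (leq_ord i).
  have l0 : lam != 0 by rewrite gt_eqF.
  by rewrite /weight horner_exp; move: (lam) l0 => l l0; field; rewrite P0 l0.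
rewrite /quad; under eq_bigr do rewrite e.
have n0 : N%:R != 0 :> R by rewrite pnatr_eq0 -lt0n.
have n1 : N.+1%:R != 0 :> R by rewrite pnatr_eq0.
rewrite sumr_const card_ord -[LHS]mulr_natr natrM.
by move: (N%:R : R) (N.+1%:R : R) n0 n1 => a b a0 b0; field; rewrite a0 b0.
Qed.

(** Only the square of the top Legendre component escapes exactness: there quadrature gives [2 / N]
    in place of [2 / (2 N + 1)], a ratio between 1 and 3. *)
Lemma quad_sqr u : (size u <= N.+1)%N ->
  pint (-1) 1 (u ^+ 2) <= quad N x (u ^+ 2) /\ quad N x (u ^+ 2) <= 3 * pint (-1) 1 (u ^+ 2).
Proof.
move=> su; pose c := u`_N / P`_N; pose v := u - c *: P.
have sv : (size v <= N)%N.
  apply: size_sub_coef => //.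
    exact: leq_trans (size_scale_leq _ _) (size_legendre_le _ _).
  by rewrite coefZ divfK // coef_legendre_neq0.
have uE : u ^+ 2 = v ^+ 2 + (2 * c) *: (v * P) + (c ^+ 2) *: P ^+ 2.
  by rewrite /v; move: P => q; rewrite -!mul_polyC; ring.
have vP : pint (-1) 1 (v * P) = 0 by rewrite mulrC legendre_orth.
have qvP : quad N x (v * P) = 0.
  rewrite -(quad_exact N1 nodes) //; apply: (size_mul_le sv (size_legendre_le _ _)); lia.
have qv : quad N x (v ^+ 2) = pint (-1) 1 (v ^+ 2).
  by rewrite -(quad_exact N1 nodes) // expr2; apply: (size_mul_le sv sv); lia.
have v0 : 0 <= pint (-1) 1 (v ^+ 2).
  by apply: pint_ge0 => [|y _]; [lra | rewrite horner_exp sqr_ge0].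
rewrite uE !quadD !quadZ !pintD !pintZ vP qvP qv quad_legendre_sqr pint_legendre_sqr.
have n0 : (1 : R) <= N%:R by rewrite ler1n.
have c0 := sqr_ge0 c.
have e1 : 2 / (2 * N + 1)%:R <= 2 / N%:R :> R.
  by rewrite ler_pM2l // lef_pV2 ?posrE ?ltr0n ?ler_nat //; lia.
have e2 : 2 / N%:R <= 3 * (2 / (2 * N + 1)%:R) :> R.
  rewrite ler_pdivrMr; last by lra.
  rewrite mulrA mulrAC ler_pdivlMr; last by rewrite ltr0n; lia.
  by rewrite natrD natrM; lra.
have := ler_wpM2l c0 e1; have := ler_wpM2l c0 e2.
by rewrite !mulr0 !addr0; split; lra.
Qed.

(** The constants are [258 = 6 * 43] and [39 = 13 * 3]: 6 compares a chord with its end values, 13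
    and 43 compare widths with weights, and 3 is the loss in the quadrature. *)
Lemma L2_equiv u : (size u <= N.+1)%N ->
  pint (-1) 1 (u ^+ 2) <= 258 * \sum_(i < N) pint (x i) (x i.+1) (chord u i ^+ 2) /\
  \sum_(i < N) pint (x i) (x i.+1) (chord u i ^+ 2) <= 39 * pint (-1) 1 (u ^+ 2).
Proof.
move=> su; have [q1 q2] := quad_sqr su.
pose g i := rho i * u.[x i] ^+ 2.
have g0 i : (i <= N)%N -> 0 <= g i by move=> iN; rewrite mulr_ge0 ?rho_ge0 ?sqr_ge0.
have qE : quad N x (u ^+ 2) = \sum_(i < N.+1) g i.
  by apply: eq_bigr => i _; rewrite horner_exp.
split.
  apply: (le_trans q1); rewrite qE; apply: (le_trans (sum_adjacent_ge N1 g0)).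
  rewrite mulr_sumr; apply: ler_sum => i _.
  have iN := ltn_ord i; have [lo _] := pint_chord_sqr u iN.
  have [_ r1] := hw iN; have [_ r2] := hwS iN.
  have := ler_wpM2r (sqr_ge0 u.[x i]) r1; have := ler_wpM2r (sqr_ge0 u.[x i.+1]) r2.
  by rewrite /g; lra.
apply: (@le_trans _ _ (13 * \sum_(i < N.+1) g i)); last by rewrite -qE; lra.
have := sum_adjacent_le g0; rewrite -(ler_pM2l (_ : 0 < 13 / 2 :> R)); last by lra.
have -> : 13 / 2 * (2 * \sum_(i < N.+1) g i) = 13 * \sum_(i < N.+1) g i by field.
apply: le_trans; rewrite mulr_sumr; apply: ler_sum => i _.
have iN := ltn_ord i; have [_ up] := pint_chord_sqr u iN.
have [r1 _] := hw iN; have [r2 _] := hwS iN.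
have := ler_wpM2r (sqr_ge0 u.[x i]) r1; have := ler_wpM2r (sqr_ge0 u.[x i.+1]) r2.
by rewrite /g; lra.
Qed.

End NormEquivalences.

Lemma big_ord_pred (V : nmodType) n (g : nat -> V) : (0 < n)%N ->
  \sum_(k < n) g k = \sum_(k < n.-1) g k + g n.-1.
Proof. by case: n => // n _; rewrite big_ord_recr. Qed.

Lemma size_1subX (R : realType) : size (1 - 'X : {poly R}) = 2%N.
Proof. by rewrite -opprB size_polyN -polyC1 size_XsubC. Qed.

(** * Norms without derivatives, weighted by powers of [1 - x] *)

Section WeightedEquivalences.
Variable R : realType.
Variables (N : nat) (x : nat -> R).
Hypotheses (N2 : (2 <= N)%N) (nodes : lobatto_nodes N x).
Local Notation P := (legendre R N).
Local Notation lam := ((N * N.+1)%:R : R).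
Local Notation rho := (weight N x).
Local Notation h i := (x i.+1 - x i).
Local Notation d i := (1 - x i).
Implicit Types u g v : {poly R}.

Let N1 : (1 <= N)%N := ltnW N2.
Let xN := xNE nodes.
Let lam0 := lam_gt0 R N1.
Let NE : N.-1.+1 = N. Proof. by rewrite prednK. Qed.
Let pN : (N.-1 < N)%N. Proof. by rewrite NE. Qed.

Let rho_ge0 j : (j <= N)%N -> 0 <= rho j.
Proof. by move=> jN; apply/ltW/(weight_gt0 N1 nodes). Qed.

Let h_gt0 i : (i < N)%N -> 0 < h i.
Proof. by move=> iN; rewrite subr_gt0 (node_ltS nodes iN). Qed.

Let d_gt0 i : (i < N)%N -> 0 < d i.
Proof. by move=> iN; rewrite subr_gt0 (node_lt nodes). Qed.

Let d_ge0 i : (i <= N)%N -> 0 <= d i.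
Proof. by move=> iN; rewrite subr_ge0 (node_le nodes). Qed.

Let hw i : (i < N)%N -> h i <= 13 * rho i /\ rho i <= 43 * h i.
Proof. by move=> iN; apply: (spacing_weight N2 nodes); rewrite ?eqxx. Qed.

Let hwS i : (i < N)%N -> h i <= 13 * rho i.+1 /\ rho i.+1 <= 43 * h i.
Proof. by move=> iN; apply: (spacing_weight N2 nodes); rewrite ?eqxx ?orbT. Qed.

Lemma pint_dist1_bounds i (q : {poly R}) : (i < N)%N ->
  (forall y, x i < y < x i.+1 -> 0 <= q.[y]) ->
  d i.+1 * pint (x i) (x i.+1) q <= pint (x i) (x i.+1) ((1 - 'X) * q) /\
  pint (x i) (x i.+1) ((1 - 'X) * q) <= d i * pint (x i) (x i.+1) q.
Proof.
move=> iN q0; have le_xx := ltW (node_ltS nodes iN).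
rewrite -!pintCM; split; apply: le_pint => // y yi; have := q0 y yi.
  by move=> qy; rewrite !hornerM ler_wpM2r // !(hornerC, hornerD, hornerN, hornerX); lra.
by move=> qy; rewrite !hornerM ler_wpM2r // !(hornerC, hornerD, hornerN, hornerX); lra.
Qed.

Lemma pint_dist1_sqr_bounds (v : {poly R}) i : (i < N)%N ->
  d i.+1 * pint (x i) (x i.+1) (v ^+ 2) <= pint (x i) (x i.+1) ((1 - 'X) * v ^+ 2) /\
  pint (x i) (x i.+1) ((1 - 'X) * v ^+ 2) <= d i * pint (x i) (x i.+1) (v ^+ 2).
Proof.
by move=> iN; apply: pint_dist1_bounds => // y _; rewrite horner_exp sqr_ge0.
Qed.

(* Quadrature of [u P_N], whose integral is 0, expresses [u(1)] through the other nodal values. *)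
Lemma endpoint_value_le u : (size u <= N)%N ->
  8 * u.[1] ^+ 2 <= lam ^+ 2 * \sum_(j < N) rho j * (d j * u.[x j] ^+ 2).
Proof.
move=> su; pose a (j : 'I_N) := u.[x j] / P.[x j].
have uE : u.[1] = - \sum_(j < N) a j.
  have : pint (-1) 1 (P * u) = 0 by rewrite legendre_orth.
  rewrite (quad_exact N1 nodes); last first.
    by apply: (size_mul_le (size_legendre_le _ _) su); lia.
  have -> : quad N x (P * u) = 2 / lam * \sum_(j < N.+1) u.[x j] / P.[x j].
    rewrite mulr_sumr; apply: eq_bigr => j _.
    have P0 := legendre_node_neq0 N1 nodes (leq_ord j).
    have l0 : lam != 0 by rewrite gt_eqF.
    by rewrite /weight hornerM; move: (lam) l0 => l l0; field; rewrite P0 l0.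
  move/eqP; rewrite mulf_eq0 gt_eqF ?divr_gt0 //= big_ord_recr /= xN legendre1 divr1.
  by rewrite addrC addr_eq0 => /eqP.
have := @sum_CS R N a (fun j => lam / 2 * (d j)^-1) (fun j => rho j * (d j * u.[x j] ^+ 2)).
rewrite -mulr_sumr (sum_inv_dist1 N1 nodes) uE sqrrN => CS.
have /CS : forall i : 'I_N, 0 <= lam / 2 * (d i)^-1.
  by move=> i; rewrite mulr_ge0 ?invr_ge0 ?d_ge0 ?divr_ge0 ?(ltW lam0) // ltnW.
move=> {}CS; have /CS : forall i : 'I_N, 0 <= rho i * (d i * u.[x i] ^+ 2).
  by move=> i; have iN := ltnW (ltn_ord i); rewrite mulr_ge0 ?rho_ge0 // mulr_ge0 ?sqr_ge0 ?d_ge0.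
move=> {}CS; have {CS} : (\sum_(i < N) a i) ^+ 2 <=
    lam / 2 * (lam / 4) * (\sum_(j < N) rho j * (d j * u.[x j] ^+ 2)).
  apply: CS => i; have P0 := legendre_node_neq0 N1 nodes (ltnW (ltn_ord i)).
  have l0 : lam != 0 by rewrite gt_eqF.
  have d0 : d i != 0 by rewrite gt_eqF ?d_gt0.
  rewrite /a /weight le_eqVlt; apply/orP; left; apply/eqP.
  by move: (lam) l0 => l l0; field; rewrite P0 l0 d0.
by move: (lam) => l; lra.
Qed.

Lemma quad_dist1_sqr u : quad N x ((1 - 'X) * u ^+ 2) =
  \sum_(j < N) rho j * (d j * u.[x j] ^+ 2).
Proof.
rewrite /quad big_ord_recr /= hornerM xN.
have -> : (1 - 'X : {poly R}).[1] = 0 by rewrite !(hornerD, hornerN, hornerC, hornerX) subrr.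
rewrite mul0r mulr0 addr0; apply: eq_bigr => j _.
by rewrite hornerM horner_exp !(hornerD, hornerN, hornerC, hornerX).
Qed.

Lemma weighted_exact u : (size u <= N)%N ->
  pint (-1) 1 ((1 - 'X) * u ^+ 2) = \sum_(j < N) rho j * (d j * u.[x j] ^+ 2).
Proof.
move=> su; rewrite -quad_dist1_sqr (quad_exact N1 nodes) //.
have s1 : (size (1 - 'X : {poly R})%R <= 2)%N by rewrite size_1subX.
have s2 : (size (u ^+ 2)%R <= (2 * N).-1)%N.
  by rewrite expr2; apply: (size_mul_le su su); lia.
by apply: (size_mul_le s1 s2); lia.
Qed.

Lemma last_chord_weighted u :
  12 * pint (x N.-1) (x N.-1.+1) ((1 - 'X) * chord x u N.-1 ^+ 2) =
  d N.-1 ^+ 2 * (3 * u.[x N.-1] ^+ 2 + 2 * u.[x N.-1] * u.[1] + u.[1] ^+ 2).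
Proof.
rewrite /chord NE xN; apply: pint_1subX_line_sqr.
by rewrite lt_eqF // (node_lt nodes).
Qed.

(** Quadrature with the weight [1 - x] does not see [u(1)], but the last chord does;
    [endpoint_value_le] and [lam d <= 9] absorb it. On the other intervals [1 - x] varies at most by
    the factor 11, whence [2838 = 6 * 43 * 11] and a share [143 = 13 * 11] of the 150; the last
    chord adds less than 7. *)
Lemma weighted_L2_equiv u : (size u <= N)%N ->
  pint (-1) 1 ((1 - 'X) * u ^+ 2) <=
    2838 * \sum_(i < N) pint (x i) (x i.+1) ((1 - 'X) * chord x u i ^+ 2) /\
  \sum_(i < N) pint (x i) (x i.+1) ((1 - 'X) * chord x u i ^+ 2) <=
    150 * pint (-1) 1 ((1 - 'X) * u ^+ 2).
Proof.
move=> su; rewrite (weighted_exact su).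
have e1 := endpoint_value_le su.
pose G j := rho j * (d j * u.[x j] ^+ 2); rewrite -/(G _).
pose T i := pint (x i) (x i.+1) ((1 - 'X) * chord x u i ^+ 2).
rewrite -/(T _).
have G0 j : (j <= N)%N -> 0 <= G j.
  by move=> jN; rewrite mulr_ge0 ?rho_ge0 // mulr_ge0 ?sqr_ge0 ?d_ge0.
have Tlo i : (i.+1 < N)%N -> d i.+1 * (h i * (u.[x i] ^+ 2 + u.[x i.+1] ^+ 2)) <= 6 * T i.
  move=> iN; have iN' := ltnW iN; have [lo _] := pint_chord_sqr nodes u iN'.
  have [wlo _] := pint_dist1_sqr_bounds (chord x u i) iN'.
  have := ler_wpM2l (d_ge0 iN') lo; rewrite /T; lra.
have Tup i : (i.+1 < N)%N -> 2 * T i <= d i * (h i * (u.[x i] ^+ 2 + u.[x i.+1] ^+ 2)).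
  move=> iN; have iN' := ltnW iN; have [_ up] := pint_chord_sqr nodes u iN'.
  have [_ wup] := pint_dist1_sqr_bounds (chord x u i) iN'.
  have := ler_wpM2l (d_ge0 (ltnW iN')) up; rewrite /T; lra.
have TN := last_chord_weighted u.
have [] := hw pN; have -> : h N.-1 = d N.-1 by rewrite NE xN.
move=> r1 r2; have h0 := d_gt0 pN.
split.
  rewrite (big_ord_pred G N1) (big_ord_pred T N1) mulrDr mulr_sumr; apply: lerD.
    apply: ler_sum => i _; have iN : (i.+1 < N)%N by have := ltn_ord i; lia.
    have iN' := ltnW iN; have [_ r] := hw iN'.
    have d11 := dist1_ratio N1 nodes iN; have := Tlo i iN; have := d_gt0 iN'.
    have := d_gt0 iN; have := h_gt0 iN'; rewrite /G.
    have := sqr_ge0 u.[x i]; have := sqr_ge0 u.[x i.+1].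
    move: (h i) (d i) (d i.+1) (rho i) (u.[x i] ^+ 2) (u.[x i.+1] ^+ 2) (T i) r d11 => hh d1 d2 r' s t T' r d11 t0 s0 h0' d20 d10 T6.
    have : r' * (d1 * s) <= 43 * hh * (d1 * s) by rewrite ler_wpM2r // mulr_ge0 // ltW.
    have : hh * s * d1 <= hh * s * (11 * d2) by rewrite ler_wpM2l // mulr_ge0 // ltW.
    have : 0 <= d2 * (hh * t) by rewrite !mulr_ge0 // ltW.
    lra.
  move: TN; rewrite /G /T; move: (pint _ _ _) (d _) (rho _) u.[x _] u.[1] r2 h0 => T' hh r a b r2 h0 TN.
  have : r * (hh * a ^+ 2) <= 43 * hh * (hh * a ^+ 2) by rewrite ler_wpM2r // mulr_ge0 ?sqr_ge0 // ltW.
  have := mulr_ge0 (sqr_ge0 hh) (sqr_ge0 (a + b)); have := mulr_ge0 (sqr_ge0 hh) (sqr_ge0 a).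
  lra.
rewrite (big_ord_pred T N1).
have s1 : \sum_(i < N.-1) T i <= 143 * \sum_(j < N) G j.
  have := @sum_adjacent_le R N.-1 G; rewrite NE => sa.
  have {sa} : \sum_(i < N.-1) (G i + G i.+1) <= 2 * \sum_(i < N) G i.
    by apply: sa => i iN; apply: G0; lia.
  rewrite -(ler_pM2l (_ : 0 < 143 / 2 :> R)); last by lra.
  rewrite mulrA; have -> : 143 / 2 * 2 = 143 :> R by field.
  apply: le_trans; rewrite mulr_sumr; apply: ler_sum => i _.
  have iN : (i.+1 < N)%N by have := ltn_ord i; lia.
  have iN' := ltnW iN; have [r _] := hw iN'; have [rS _] := hwS iN'.
  have d11 := dist1_ratio N1 nodes iN; have := Tup i iN; have := d_gt0 iN'.
  have := d_gt0 iN; have := h_gt0 iN'; rewrite /G.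
  have := sqr_ge0 u.[x i]; have := sqr_ge0 u.[x i.+1].
  move: (h i) (d i) (d i.+1) (rho i) (rho i.+1) (u.[x i] ^+ 2) (u.[x i.+1] ^+ 2) (T i) r rS d11 => hh d1 d2 r' r'' s t T' r rS d11 t0 s0 h0' d20 d10 T6.
  have : hh * (d1 * s) <= 13 * r' * (d1 * s) by rewrite ler_wpM2r // mulr_ge0 // ltW.
  have : hh * (d2 * t) <= 13 * r'' * (d2 * t) by rewrite ler_wpM2r // mulr_ge0 // ltW.
  have : hh * t * d1 <= hh * t * (11 * d2) by rewrite ler_wpM2l // mulr_ge0 // ltW.
  have : 0 <= hh * (d1 * s) by rewrite !mulr_ge0 // ltW.
  lra.
have GN : G N.-1 <= \sum_(j < N) G j.
  by rewrite (big_ord_pred G N1) lerDr; apply: sumr_ge0 => i _; apply: G0; have := ltn_ord i; lia.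
have S0 : 0 <= \sum_(j < N) G j by apply: sumr_ge0 => i _; apply/G0/ltnW.
have hb : 8 * (d N.-1 ^+ 2 * u.[1] ^+ 2) <= 81 * \sum_(j < N) G j.
  have l9 : (lam * d N.-1) ^+ 2 <= 9 ^+ 2.
    by apply: le_sqr; [rewrite mulr_ge0 // ltW | exact: last_spacing_upper].
  have := ler_wpM2l (sqr_ge0 (d N.-1)) e1.
  have := ler_wpM2r S0 l9; rewrite -/(G _).
  by move: (lam) (d _) (\sum_(_ < _) _) => l hh S; lra.
move: TN; rewrite /T.
have : d N.-1 * (d N.-1 * u.[x N.-1] ^+ 2) <= 13 * G N.-1.
  by rewrite /G [leRHS]mulrA ler_wpM2r // mulr_ge0 ?sqr_ge0 // ltW.
have := mulr_ge0 (sqr_ge0 (d N.-1)) (sqr_ge0 (u.[x N.-1] - u.[1])).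
move: (pint _ _ _) (d N.-1) (\sum_(j < N) G j) (\sum_(i < N.-1) _) (G N.-1) u.[x _] u.[1] s1 GN S0 hb {e1} => T' hh S S' g a b.
lra.
Qed.

(** In terms of [u = (1 - x) g], the integral is that of [u^2 / (1 - x)], and quadrature is exact
    for it. To stay polynomial, [1 / (1 - x)] is frozen at the left end of an interval as a lower
    bound and at the right end as an upper bound. On the last interval the chord is a multiple of
    [1 - x] and contributes [u(x_(N-1))^2 / 2]. *)
Lemma Hardy_equiv g : (size g <= N)%N ->
  pint (-1) 1 ((1 - 'X) * g ^+ 2) <=
    258 * (\sum_(i < N.-1) (d i)^-1 * pint (x i) (x i.+1) (chord x ((1 - 'X) * g) i ^+ 2) +
           ((1 - 'X) * g).[x N.-1] ^+ 2 / 2) /\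
  \sum_(i < N.-1) (d i.+1)^-1 * pint (x i) (x i.+1) (chord x ((1 - 'X) * g) i ^+ 2) +
    ((1 - 'X) * g).[x N.-1] ^+ 2 / 2 <= 150 * pint (-1) 1 ((1 - 'X) * g ^+ 2).
Proof.
move=> sg; rewrite (weighted_exact sg); set u := _ * g.
have uE y : u.[y] = (1 - y) * g.[y].
  by rewrite hornerM; congr (_ * _); rewrite !(hornerD, hornerN, hornerC, hornerX).
pose G j := rho j * (d j * g.[x j] ^+ 2); rewrite -/(G _).
have G0 j : (j <= N)%N -> 0 <= G j.
  by move=> jN; rewrite mulr_ge0 ?rho_ge0 // mulr_ge0 ?sqr_ge0 ?d_ge0.
have [] := hw pN; have -> : h N.-1 = d N.-1 by rewrite NE xN.
move=> r1 r2; have h0 := d_gt0 pN.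
split.
  rewrite (big_ord_pred G N1) mulrDr mulr_sumr; apply: lerD.
    apply: ler_sum => i _; have iN : (i.+1 < N)%N by have := ltn_ord i; lia.
    have iN' := ltnW iN; have [_ r] := hw iN'; have [lo _] := pint_chord_sqr nodes u iN'.
    have di := d_gt0 iN'; have hi := h_gt0 iN'.
    have := sqr_ge0 u.[x i.+1]; move: lo; rewrite /G [u.[x i]]uE mulrC.
    move: (h i) (d i) (rho i) (g.[x i]) (u.[x i.+1] ^+ 2) (pint _ _ _) r di hi => hh d1 r' s t T' r d10 h00 lo t0.
    have : r' * (d1 * s ^+ 2) <= 43 * hh * (d1 * s ^+ 2).
      by rewrite ler_wpM2r // mulr_ge0 ?sqr_ge0 // ltW.
    move=> le1; rewrite [leRHS]mulrCA ler_pdivlMl //.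
    apply: (@le_trans _ _ (d1 * (43 * hh * (d1 * s ^+ 2)))); first by rewrite ler_wpM2l // ltW.
    have := mulr_ge0 (ltW h00) t0; lra.
  rewrite uE /G; move: (d _) (rho _) g.[x _] r2 h0 => hh r a r2 h0.
  have : r * (hh * a ^+ 2) <= 43 * hh * (hh * a ^+ 2) by rewrite ler_wpM2r // mulr_ge0 ?sqr_ge0 // ltW.
  have : 0 <= (hh * a) ^+ 2 by rewrite sqr_ge0.
  lra.
have s1 : \sum_(i < N.-1) (d i.+1)^-1 * pint (x i) (x i.+1) (chord x u i ^+ 2) <= 143 * \sum_(j < N) G j.
  have := @sum_adjacent_le R N.-1 G; rewrite NE => sa.
  have {sa} : \sum_(i < N.-1) (G i + G i.+1) <= 2 * \sum_(i < N) G i.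
    by apply: sa => i iN; apply: G0; lia.
  rewrite -(ler_pM2l (_ : 0 < 143 / 2 :> R)); last by lra.
  rewrite mulrA; have -> : 143 / 2 * 2 = 143 :> R by field.
  apply: le_trans; rewrite mulr_sumr; apply: ler_sum => i _.
  have iN : (i.+1 < N)%N by have := ltn_ord i; lia.
  have iN' := ltnW iN; have [r _] := hw iN'; have [rS _] := hwS iN'.
  have [_ up] := pint_chord_sqr nodes u iN'; move: up.
  have d11 := dist1_ratio N1 nodes iN; have := d_gt0 iN'.
  have := d_gt0 iN; have := h_gt0 iN'; rewrite /G !uE.
  move: (h i) (d i) (d i.+1) (rho i) (rho i.+1) g.[x i] g.[x i.+1] (pint _ _ _) r rS d11 => hh d1 d2 r' r'' s t T' r rS d11 h0' d20 d10 up.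
  rewrite ler_pdivrMl //.
  have s0 := sqr_ge0 s; have t0 := sqr_ge0 t.
  have : hh * (d1 * s ^+ 2) <= 13 * r' * (d1 * s ^+ 2) by rewrite ler_wpM2r // mulr_ge0 // ltW.
  move/(ler_wpM2l (ltW d20)) => l1.
  have : hh * (d2 * t ^+ 2) <= 13 * r'' * (d2 * t ^+ 2) by rewrite ler_wpM2r // mulr_ge0 // ltW.
  move/(ler_wpM2l (ltW d20)) => l2.
  have l3 : hh * s ^+ 2 * d1 * d1 <= hh * s ^+ 2 * d1 * (11 * d2).
    by rewrite ler_wpM2l // mulr_ge0 ?(ltW d10) // mulr_ge0 // ltW.
  have l4 : 0 <= d2 * (hh * (d2 * t ^+ 2)) by rewrite mulr_ge0 ?(ltW d20) // mulr_ge0 ?(ltW h0') // mulr_ge0 // ltW.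
  lra.
have GN : G N.-1 <= \sum_(j < N) G j.
  by rewrite (big_ord_pred G N1) lerDr; apply: sumr_ge0 => i _; apply: G0; have := ltn_ord i; lia.
have : u.[x N.-1] ^+ 2 <= 13 * G N.-1.
  have -> : u.[x N.-1] ^+ 2 = d N.-1 * (d N.-1 * g.[x N.-1] ^+ 2) by rewrite uE; ring.
  by rewrite /G [leRHS]mulrA ler_wpM2r // mulr_ge0 ?sqr_ge0 // ltW.
by have GNN := G0 _ (ltnW pN); move: s1 GN GNN; rewrite /G; lra.
Qed.

End WeightedEquivalences.

(** * Increments and the weighted energy *)

Lemma big_ord_pred_recl (V : nmodType) n (g : nat -> V) : (0 < n)%N ->
  \sum_(k < n) g k = g 0%N + \sum_(k < n.-1) g k.+1.
Proof. by case: n => // n _; rewrite big_ord_recl. Qed.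

Section DerivativeLower.
Variable R : realType.
Variables (N : nat) (x : nat -> R).
Hypotheses (N2 : (2 <= N)%N) (nodes : lobatto_nodes N x).
Local Notation P := (legendre R N).
Local Notation w := (lobatto_poly R N).
Local Notation lam := ((N * N.+1)%:R : R).
Local Notation rho := (weight N x).
Local Notation h i := (x i.+1 - x i).
Local Notation d i := (1 - x i).
Implicit Types u v g : {poly R}.

Let N1 : (1 <= N)%N := ltnW N2.
Let x0 := x0E nodes.
Let xN := xNE nodes.
Let lam0 := lam_gt0 R N1.
Let NE : N.-1.+1 = N. Proof. by rewrite prednK. Qed.
Let pN : (N.-1 < N)%N. Proof. by rewrite NE. Qed.

Lemma pint_nodes q : pint (-1) 1 q = \sum_(i < N) pint (x i) (x i.+1) q.
Proof.
rewrite -(big_mkord xpredT (fun i => pint (x i) (x i.+1) q)) /pint.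
by rewrite (telescope_sumr (fun i => (primitive q).[x i])) // x0 xN.
Qed.

Lemma deriv_legendre_sign i y z : (i < N)%N -> x i < y < x i.+1 -> x i < z < x i.+1 ->
  0 <= P^`().[y] * P^`().[z].
Proof.
move=> iN; wlog yz : y z / y <= z => [H yi zi|yi zi].
  by have [|/ltW] := leP y z => yz; [|rewrite mulrC]; apply: H.
rewrite leNgt; apply/negP => /(poly_ivtoo yz)[c]; rewrite in_itv /= => /andP[yc cz].
by move/rootP; apply/eqP/(deriv_legendre_neq0 nodes iN); move: yi zi; lra.
Qed.

(** [P_N] is monotone between consecutive nodes, so [(P(y) - P(x_i)) (P(x_(i+1)) - P(y)) >= 0]; the
    rest is algebra. *)
Lemma legendre_sqr_le i y : (i < N)%N -> x i < y < x i.+1 ->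
  P.[y] ^+ 2 <= P.[x i] ^+ 2 + P.[x i.+1] ^+ 2.
Proof.
move=> iN yi; have /andP[iy yi1] := yi.
have [c ci e1] := poly_mvt P iy; have [c' ci' e2] := poly_mvt P yi1.
rewrite in_itv /= in ci; rewrite in_itv /= in ci'.
have : 0 <= P^`().[c] * P^`().[c'] by apply: (deriv_legendre_sign iN); move: yi ci ci'; lra.
have s0 : 0 <= (y - x i) * (x i.+1 - y) by rewrite mulr_ge0 // subr_ge0 ltW.
move/(mulr_ge0 s0); have -> : (y - x i) * (x i.+1 - y) * (P^`().[c] * P^`().[c']) =
  (P^`().[c] * (y - x i)) * (P^`().[c'] * (x i.+1 - y)) by ring.
rewrite -e1 -e2; move: P.[y] P.[x i] P.[x i.+1] => p s t.
by have := sqr_ge0 (p - s - t); lra.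
Qed.

Lemma spacing_legendre_sqr i j : (i < N)%N -> (j == i) || (j == i.+1) ->
  lam * (h i * P.[x j] ^+ 2) <= 26.
Proof.
move=> iN ij; have [r _] := spacing_weight N2 nodes iN ij.
have jN : (j <= N)%N by lia.
have P0 := legendre_node_neq0 N1 nodes jN.
have P2 : 0 < P.[x j] ^+ 2 by rewrite exprn_even_gt0.
have e : rho j * (lam * P.[x j] ^+ 2) = 2.
  by rewrite /weight divfK // gt_eqF // mulr_gt0.
have := ler_wpM2r (ltW (mulr_gt0 lam0 P2)) r; rewrite -mulrA e.
by move: (lam) => l; lra.
Qed.

(** The mean value theorem for [w] between [y] and 1 gives [(1 + y) P'(y) = lam P(c)] with
    [P(c) <= 1], and [1 + y >= 2 / 11] by the ratio of adjacent distances to [-1]. *)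
Lemma deriv_legendre_last y : x N.-1 < y < 1 -> 0 <= P^`().[y] /\ P^`().[y] <= 6 * lam.
Proof.
have P'_ge0 z : x N.-1 < z < 1 -> 0 <= P^`().[z].
  move=> /andP[az z1]; rewrite leNgt; apply/negP => P'z.
  have : P^`().[z] * P^`().[1] < 0.
    by rewrite nmulr_rlt0 // deriv_legendre1 divr_gt0.
  move/(poly_ivtoo (ltW z1))=> [c]; rewrite in_itv /= => /andP[zc c1] /rootP.
  by apply/eqP/(deriv_legendre_neq0 nodes pN); rewrite NE xN c1 (lt_trans az).
move=> ay; split; first exact: P'_ge0.
have /andP[ay' y1] := ay.
have [c] := poly_mvt w y1; rewrite in_itv /= => /andP[yc c1].
rewrite horner_deriv_lobatto_poly -{1}xN (lobatto_poly_node nodes) // sub0r horner_lobatto_poly.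
have [c'] := poly_mvt P c1; rewrite in_itv /= => /andP[cc' c'1].
rewrite legendre1 => e1 e2.
have : 0 <= P^`().[c'] * (1 - c).
  by rewrite mulr_ge0 ?P'_ge0 ?subr_ge0 ?(ltW c1) // c'1 andbT; lra.
rewrite -e1 => Pc.
have D11 : 1 + x N <= 11 * (1 + x N.-1).
  by have := distN1_ratio N2 nodes (i := N.-1); rewrite NE; apply; lia.
have y10 : 0 < 1 - y by rewrite subr_gt0.
have : (1 + y) * P^`().[y] <= lam.
  rewrite -(ler_pM2l y10); have -> : (1 - y) * ((1 + y) * P^`().[y]) = lam * P.[c] * (1 - y).
    by move: e2; move: (lam) => l; lra.
  by rewrite mulrC ler_wpM2l ?(ltW y10) // ler_piMr ?(ltW lam0) //; lra.
have := P'_ge0 y ay; rewrite xN in D11.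
move: (lam) (P^`().[y]) => l p p0 le1.
have : 2 / 11 * p <= (1 + y) * p by rewrite ler_wpM2r //; lra.
lra.
Qed.

(* As [int P_N u' = 0], the last increment is [int (1 - P_N) u'] over the last interval minus
   [int P_N u'] over the others. *)
Lemma last_increment u : (size u <= N.+1)%N ->
  (u.[1] - u.[x N.-1]) ^+ 2 <= 3000 * pint (-1) 1 ((1 - 'X) * u^`() ^+ 2).
Proof.
move=> su; set v := u^`(); have sv : (size v <= N)%N by apply: size_deriv_le.
set A := pint (-1) 1 _; pose a := x N.-1.
have a1 : a < 1 by apply: (node_lt nodes).
have aN : -1 <= a by apply: (node_ge nodes); exact: ltnW.
pose gam i := pint (x i) (x i.+1) ((1 - 'X) * v ^+ 2).
have gam0 i : (i < N)%N -> 0 <= gam i.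
  move=> iN; apply: pint_ge0 => [|y /andP[_ y1]]; first exact/ltW/(node_ltS nodes).
  rewrite hornerM horner_exp mulr_ge0 ?sqr_ge0 //.
  by rewrite !(hornerD, hornerN, hornerC, hornerX); have := node_le nodes iN; lra.
have AE : A = \sum_(i < N) gam i by rewrite /A pint_nodes.
have AE' : A = \sum_(i < N.-1) gam i + gam N.-1 by rewrite AE (big_ord_pred gam N1).
have S0 : 0 <= \sum_(i < N.-1) gam i.
  by apply: sumr_ge0 => i _; apply: gam0; have := ltn_ord i; lia.
have gN := gam0 _ pN.
have I1 : u.[1] - u.[a] = pint a 1 ((1 - P) * v) - \sum_(i < N.-1) pint (x i) (x i.+1) (P * v).
  have : pint (-1) 1 (P * v) = 0 by rewrite legendre_orth.
  rewrite pint_nodes (big_ord_pred (fun i => pint (x i) (x i.+1) (P * v)) N1) NE xN -/a.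
  rewrite -pint_deriv -/v mulrBl mul1r pintB => e; move: e.
  by move: (\sum_(_ < _) _) (pint _ _ (P * v)) => s t; lra.
(* Here [0 <= 1 - P <= 6 lam (1 - x)], and [36 lam^2] times the integral of [1 - x] is
   [18 (lam d)^2 <= 18 * 81]. *)
have T1 : pint a 1 ((1 - P) * v) ^+ 2 <= 1458 * gam N.-1.
  have /factor_theorem[k ek] : root (1 - P) 1.
    by apply/rootP; rewrite hornerD hornerN legendre1 hornerC subrr.
  have -> : (1 - P) * v = (1 - 'X) * (- k) * v.
    by rewrite ek polyC1; ring.
  apply: le_trans (pint_CS _ _ (ltW a1) _) _.
    by move=> y /andP[_ y1]; rewrite !(hornerD, hornerN, hornerC, hornerX); lra.
  rewrite /gam NE xN -/a; apply: ler_wpM2r; first by have := gN; rewrite /gam NE xN.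
  apply: (@le_trans _ _ (pint a 1 (((6 * lam) ^+ 2)%:P * (1 - 'X)))).
    apply: le_pint => [|y yi]; first exact: ltW.
    have /andP[ay y1] := yi.
    have [c] := poly_mvt P y1; rewrite in_itv /= legendre1 => /andP[yc c1] ec.
    have ky : (- k).[y] = P^`().[c].
      have := congr1 (fun q : {poly R} => q.[y]) ek.
      rewrite hornerM hornerXsubC hornerN => e; have y10 : 1 - y != 0 by rewrite subr_eq0 gt_eqF.
      apply: (mulIf y10); rewrite -ec.
      have -> : 1 - P.[y] = (1 - P).[y] by rewrite hornerD hornerN hornerC.
      by rewrite e; ring.
    have [k0 k6] : 0 <= P^`().[c] /\ P^`().[c] <= 6 * lam.
      by apply: deriv_legendre_last; rewrite c1 andbT; apply: lt_trans yc.
    rewrite [leRHS]hornerM hornerC hornerM horner_exp ky mulrC.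
    apply: ler_wpM2r; first by rewrite !(hornerD, hornerN, hornerC, hornerX); lra.
    exact: le_sqr.
  rewrite pintCM; have := pint_1subX a.
  have l9 : (lam * (1 - a)) ^+ 2 <= 9 ^+ 2.
    by apply: le_sqr; [rewrite mulr_ge0 ?(ltW lam0) // subr_ge0 ltW | exact: last_spacing_upper].
  move: l9; move: (lam) (pint _ _ _) => l I l9 e.
  have -> : (6 * l) ^+ 2 * I = 18 * l ^+ 2 * (2 * I) by ring.
  by rewrite e; move: l9; lra.
(* On each of these intervals [lam int P^2 <= 52], and inserting the weight [1 - x] costs
   [1 / d_(i+1)]; these costs sum to at most [lam / 4]. *)
have T2 : (\sum_(i < N.-1) pint (x i) (x i.+1) (P * v)) ^+ 2 <= 13 * \sum_(i < N.-1) gam i.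
  have := @sum_CS R N.-1 (fun i => pint (x i) (x i.+1) (P * v)) (fun i => 52 / lam * (d i.+1)^-1) gam.
  move=> CS; apply: le_trans (CS _ _ _) _.
  - move=> i; rewrite mulr_ge0 ?divr_ge0 ?(ltW lam0) // invr_ge0 subr_ge0 (node_le nodes) //.
    by have := ltn_ord i; lia.
  - by move=> i; apply: gam0; have := ltn_ord i; lia.
  - move=> i; have iN : (i.+1 < N)%N by have := ltn_ord i; lia.
    have iN' := ltnW iN; have le_xx := ltW (node_ltS nodes iN').
    have := @pint_CS R (x i) (x i.+1) 1 P v le_xx; rewrite !mul1r => CSi.
    have {CSi} : pint (x i) (x i.+1) (P * v) ^+ 2 <=
       pint (x i) (x i.+1) (P ^+ 2) * pint (x i) (x i.+1) (v ^+ 2).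
      by apply: CSi => y _; rewrite hornerC.
    move/le_trans; apply.
    have [wlo _] := pint_dist1_sqr_bounds nodes v iN'; rewrite -/(gam i) in wlo.
    have Pup : lam * pint (x i) (x i.+1) (P ^+ 2) <= 52.
      have : pint (x i) (x i.+1) (P ^+ 2) <= h i * (P.[x i] ^+ 2 + P.[x i.+1] ^+ 2).
        rewrite mulrC -pintC; apply: le_pint => // y yi.
        by rewrite horner_exp hornerC legendre_sqr_le.
      move/(ler_wpM2l (ltW lam0)).
      have := @spacing_legendre_sqr i i iN'; rewrite eqxx => /(_ isT).
      have := @spacing_legendre_sqr i i.+1 iN'; rewrite eqxx orbT => /(_ isT).
      by move: (lam) (pint _ _ _) => l I; lra.
    have d0 : 0 < d i.+1 by rewrite subr_gt0 (node_lt nodes).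
    have v0 : 0 <= pint (x i) (x i.+1) (v ^+ 2).
      by apply: pint_ge0 => // y _; rewrite horner_exp sqr_ge0.
    have -> : 52 / lam / d i.+1 * gam i = 52 * gam i / (lam * d i.+1).
      have l0 : lam != 0 by rewrite gt_eqF.
      by move: (lam) (gam i) (d i.+1) l0 d0 => l g dd l0 /lt0r_neq0 d0; field; rewrite l0 d0.
    rewrite ler_pdivlMr ?mulr_gt0 //.
    apply: (@le_trans _ _ (52 * (d i.+1 * pint (x i) (x i.+1) (v ^+ 2)))); last by rewrite ler_pM2l.
    have -> : pint (x i) (x i.+1) (P ^+ 2) * pint (x i) (x i.+1) (v ^+ 2) * (lam * d i.+1) =
       lam * pint (x i) (x i.+1) (P ^+ 2) * (d i.+1 * pint (x i) (x i.+1) (v ^+ 2)).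
      by move: (lam) => l; ring.
    by rewrite ler_wpM2r // mulr_ge0 // ltW.
  rewrite -mulr_sumr; apply: ler_wpM2r => //.
  have : \sum_(i < N.-1) (d i.+1)^-1 <= lam / 4.
    rewrite -(sum_inv_dist1 N1 nodes) (big_ord_pred_recl (fun i => (d i)^-1) N1).
    rewrite lerDr invr_ge0 subr_ge0.
    exact: (node_le nodes).
  move/(ler_wpM2l (_ : 0 <= 52 / lam)); rewrite divr_ge0 ?(ltW lam0) // => /(_ isT).
  move/le_trans; apply; rewrite le_eqVlt; apply/orP; left; apply/eqP.
  by have l0 : lam != 0 by [rewrite gt_eqF]; move: (lam) l0 => l l0; field.
rewrite -/a I1; move: T1 T2 S0 gN; rewrite AE'.
move: (pint a 1 _) (\sum_(_ < _) pint _ _ _) (gam _) (\sum_(_ < _) gam _) => s t g S.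
by have := sqr_ge0 (s + t); lra.
Qed.

Lemma deriv_chord u i : (chord x u i)^`() = ((u.[x i.+1] - u.[x i]) / h i)%:P.
Proof. by rewrite /chord /line derivD derivC derivZ derivXsubC add0r alg_polyC. Qed.

(** The last chord has energy [(u(1) - u(x_(N-1)))^2 / 2], so [last_increment] contributes 1500; the
    other intervals contribute 11, the variation of [1 - x]. *)
Lemma weighted_H1_lower u : (size u <= N.+1)%N ->
  \sum_(i < N) pint (x i) (x i.+1) ((1 - 'X) * (chord x u i)^`() ^+ 2) <=
  1511 * pint (-1) 1 ((1 - 'X) * u^`() ^+ 2).
Proof.
move=> su; have := last_increment su.
set A := pint (-1) 1 _ => inc.
rewrite (big_ord_pred (fun i => pint (x i) (x i.+1) ((1 - 'X) * (chord x u i)^`() ^+ 2)) N1).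
pose gam i := pint (x i) (x i.+1) ((1 - 'X) * u^`() ^+ 2).
have gam0 i : (i < N)%N -> 0 <= gam i.
  move=> iN; apply: pint_ge0 => [|y /andP[_ y1]]; first exact/ltW/(node_ltS nodes).
  rewrite hornerM horner_exp mulr_ge0 ?sqr_ge0 //.
  by rewrite !(hornerD, hornerN, hornerC, hornerX); have := node_le nodes iN; lra.
have AE' : A = \sum_(i < N.-1) gam i + gam N.-1.
  by rewrite /A pint_nodes (big_ord_pred gam N1).
have : \sum_(i < N.-1) pint (x i) (x i.+1) ((1 - 'X) * (chord x u i)^`() ^+ 2) <=
    11 * \sum_(i < N.-1) gam i.
  rewrite mulr_sumr; apply: ler_sum => i _.
  have iN : (i.+1 < N)%N by have := ltn_ord i; lia.
  have iN' := ltnW iN; have h0 : 0 < h i by rewrite subr_gt0 (node_ltS nodes).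
  have [_ up] := pint_dist1_sqr_bounds nodes (chord x u i)^`() iN'.
  have [lo _] := pint_dist1_sqr_bounds nodes u^`() iN'.
  apply: (le_trans up); apply: (@le_trans _ _ (d i * pint (x i) (x i.+1) (u^`() ^+ 2))).
    apply: ler_wpM2l; first by rewrite subr_ge0 (node_le nodes) // ltnW.
    rewrite deriv_chord -[_%:P ^+ 2]rmorphXn /= pintC expr_div_n.
    have := pint_CS1 u^`() (ltW (node_ltS nodes iN')); rewrite pint_deriv => CS.
    rewrite mulrAC ler_pdivrMr ?exprn_gt0 // [_ ^+ 2 as X in _ <= _ * X]expr2.
    by have := ler_wpM2r (ltW h0) CS; move: (h i) (pint _ _ _) => hh I; lra.
  have d11 := dist1_ratio N1 nodes iN.
  have v0 : 0 <= pint (x i) (x i.+1) (u^`() ^+ 2).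
    by apply: pint_ge0 => [|y _]; rewrite ?horner_exp ?sqr_ge0 ?ltW ?(node_ltS nodes).
  have := ler_wpM2r v0 d11; rewrite /gam; lra.
have : 2 * pint (x N.-1) (x N.-1.+1) ((1 - 'X) * (chord x u N.-1)^`() ^+ 2) =
    (u.[1] - u.[x N.-1]) ^+ 2.
  rewrite deriv_chord NE xN -[_%:P ^+ 2]rmorphXn /= [(1 - 'X) * _]mulrC pintCM mulrCA pint_1subX.
  by rewrite -exprMn divfK // subr_eq0 gt_eqF // (node_lt nodes).
have S0 : 0 <= \sum_(i < N.-1) gam i.
  by apply: sumr_ge0 => i _; apply: gam0; have := ltn_ord i; lia.
have := gam0 _ pN; move: inc S0; rewrite AE'.
lra.
Qed.

End DerivativeLower.

(** * A Jacobi operator *)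

Section JacobiOperator.
Variable R : realType.
Implicit Types (s t r q : {poly R}).

(** For [u = (1 + X) s] and [v = (1 + X) t] this is the integral of [u v / (1 + x)]. Dividing out
    the zero at [-1] keeps the singular weight polynomial. *)
Definition bform s t : R := pint (-1) 1 ((1 + 'X) * s * t).
Definition aform s t : R :=
  pint (-1) 1 ((1 - 'X) * ((1 + 'X) * s)^`() * ((1 + 'X) * t)^`()).
(** The operator that represents [aform] with respect to [bform]; its eigenpolynomials are, up to
    scaling, the Jacobi polynomials with parameters [(0, 1)]. *)
Definition jacobi_op s : {poly R} := - ((1 - 'X) * ((1 + 'X) * s)^`())^`().
Local Notation tau := jacobi_op.

Lemma bformC s t : bform s t = bform t s.
Proof. by rewrite /bform mulrAC. Qed.

Lemma bformDl s s' t : bform (s + s') t = bform s t + bform s' t.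
Proof. by rewrite /bform mulrDr mulrDl pintD. Qed.

Lemma bformZl c s t : bform (c *: s) t = c * bform s t.
Proof. by rewrite /bform -scalerAr -scalerAl pintZ. Qed.

Lemma bformBl s s' t : bform (s - s') t = bform s t - bform s' t.
Proof. by rewrite -scaleN1r bformDl bformZl mulN1r. Qed.

Lemma bformDr s t t' : bform s (t + t') = bform s t + bform s t'.
Proof. by rewrite bformC bformDl !(bformC s). Qed.

Lemma bformZr c s t : bform s (c *: t) = c * bform s t.
Proof. by rewrite bformC bformZl bformC. Qed.

Lemma bform_ge0 s : 0 <= bform s s.
Proof.
apply: pint_ge0 => [|y y1]; first by lra.
rewrite -mulrA -expr2 hornerM horner_exp mulr_ge0 ?sqr_ge0 //.
by rewrite !(hornerD, hornerC, hornerX); lra.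
Qed.

Lemma bform_eq0 s : bform s s = 0 -> s = 0.
Proof.
rewrite /bform -mulrA -expr2; apply: pint_sqr_eq0; first by lra.
by move=> y y1; rewrite !(hornerD, hornerC, hornerX); lra.
Qed.

Lemma aformE s t : aform s t = bform (tau s) t.
Proof.
rewrite /aform /bform /tau mulrC pint_by_parts.
set q := (1 - 'X) * _; set u := (1 + 'X) * t.
have q1 : q.[1] = 0.
  by rewrite hornerM !(hornerD, hornerN, hornerC, hornerX) subrr mul0r.
have u1 : u.[-1] = 0 by rewrite hornerM !(hornerD, hornerC, hornerX) subrr mul0r.
by rewrite q1 u1 mulr0 mul0r subrr sub0r -pintN; congr pint; rewrite /u; ring.
Qed.

Lemma bform_tau s t : bform (tau s) t = bform s (tau t).
Proof.
by rewrite [RHS]bformC -!aformE /aform; congr pint; rewrite -!mulrA; congr (_ * _); rewrite mulrC.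
Qed.

Lemma jacobi_opD s t : tau (s + t) = tau s + tau t.
Proof. by rewrite /tau mulrDr derivD mulrDr derivD opprD. Qed.

Lemma jacobi_opZ c s : tau (c *: s) = c *: tau s.
Proof. by rewrite /tau -scalerAr derivZ -scalerAr derivZ scalerN. Qed.

Lemma coef_jacobi_op s n : (size s <= n.+1)%N -> (tau s)`_n = (n.+1 ^ 2)%:R * s`_n.
Proof.
move=> ss; have uE k : ((1 + 'X) * s)`_k.+1 = s`_k.+1 + s`_k.
  by rewrite mulrDl mul1r coefD coefXM.
rewrite coefN coef_deriv mulrBl mul1r coefB coefXM /= !coef_deriv !uE.
rewrite [s`_n.+2]nth_default ?[s`_n.+1]nth_default //; last exact: leqW.
by rewrite !addr0 mul0rn !add0r mulNrn opprK -mulrnA -mulnn mulr_natl.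
Qed.

Lemma size_jacobi_op s n : (size s <= n)%N -> (size (tau s) <= n)%N.
Proof.
move=> ss; apply/leq_sizeP => j nj; rewrite coef_jacobi_op.
  by rewrite nth_default ?mulr0 // (leq_trans ss).
by rewrite (leq_trans ss) // leqW.
Qed.

Lemma size_sub_lead t q n : (size t <= n.+1)%N -> (size q <= n.+1)%N -> q`_n = 1 ->
  (size (t - t`_n *: q)%R <= n)%N.
Proof.
move=> st sq qn; apply: size_sub_coef => //.
  by rewrite (leq_trans (size_scale_leq _ _)).
by rewrite coefZ qn mulr1.
Qed.

(** Gram-Schmidt without a basis: the induction hypothesis holds for all [q], so it also projects
    ['X^n] and thereby provides the next orthogonal direction [e]. *)
Lemma bform_projection n q : exists2 s : {poly R}, (size s <= n)%N &
  forall t, (size t <= n)%N -> bform (q - s) t = 0.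
Proof.
elim: n q => [|n IH] q.
  exists 0; rewrite ?size_poly0 // => t; rewrite size_poly_leq0 => /eqP ->.
  by rewrite /bform mulr0 pint0.
have [s0 ss0 qs0] := IH q; have [p0 sp0 Xp0] := IH 'X^n.
pose e := 'X^n - p0.
have se : (size e <= n.+1)%N.
  by rewrite (leq_trans (size_polyD _ _)) // geq_max size_polyXn leqnn size_polyN leqW.
have en : e`_n = 1 by rewrite coefB coefXn eqxx nth_default // subr0.
have e0 : bform e e != 0.
  apply/eqP => /bform_eq0 e0; move: en; rewrite e0 coef0 => /eqP.
  by rewrite eq_sym oner_eq0.
exists (s0 + bform q e / bform e e *: e).
  rewrite (leq_trans (size_polyD _ _)) // geq_max leqW //=.
  by rewrite (leq_trans (size_scale_leq _ _)).
move=> t st; have st' := size_sub_lead st se en; rewrite -/e in Xp0; clearbody e.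
rewrite -(subrK (t`_n *: e) t) opprD addrA bformBl.
move: (t - _) st' => t' st'; rewrite !bformDr !bformZr !bformZl (qs0 t' st') (Xp0 t' st') (bformBl q s0).
have -> : bform s0 e = 0 by rewrite bformC Xp0.
by move: (bform q e) (bform e e) (t`_n) e0 => a b c b0; field.
Qed.

(** [tau] is symmetric and triangular, so [tau q - (n + 1)^2 q] drops in degree while staying
    orthogonal to all lower degrees; it is therefore orthogonal to itself. *)
Lemma orthogonal_eigenpoly n : exists q : {poly R}, [/\ (size q <= n.+1)%N, q`_n = 1,
  forall t, (size t <= n)%N -> bform q t = 0 &
  tau q = (n.+1 ^ 2)%:R *: q].
Proof.
have [p0 sp0 Xp0] := bform_projection n 'X^n; exists ('X^n - p0).
set e := 'X^n - p0 in Xp0 *.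
have se : (size e <= n.+1)%N.
  by rewrite (leq_trans (size_polyD _ _)) // geq_max size_polyXn leqnn size_polyN leqW.
have en : e`_n = 1 by rewrite coefB coefXn eqxx nth_default // subr0.
split => //; apply/eqP; rewrite -subr_eq0; apply/eqP/bform_eq0.
have sd : (size (tau e - (n.+1 ^ 2)%:R *: e)%R <= n)%N.
  apply: size_sub_coef; first exact: size_jacobi_op.
    by rewrite (leq_trans (size_scale_leq _ _)).
  by rewrite coef_jacobi_op // coefZ.
rewrite {1}bformBl bformZl bform_tau !Xp0 ?mulr0 ?subrr //.
exact: size_jacobi_op.
Qed.

Lemma eigen_split n q s c : (forall t, (size t <= n)%N -> bform q t = 0) ->
  tau q = (n.+1 ^ 2)%:R *: q -> (size s <= n)%N ->
  bform (s + c *: q) (s + c *: q) = bform s s + c ^+ 2 * bform q q /\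
  aform (s + c *: q) (s + c *: q) = aform s s + (n.+1 ^ 2)%:R * (c ^+ 2 * bform q q).
Proof.
move=> qt tq ss; rewrite !aformE jacobi_opD jacobi_opZ tq.
rewrite !(bformDl, bformDr, bformZl, bformZr) (bform_tau s q) tq bformZr.
by rewrite (bformC s q) qt //; split; ring.
Qed.

(** Top eigencomponents are split off one at a time; both forms are diagonal, and the eigenvalues on
    degrees below [n] are at most [n^2]. *)
Lemma inverse_inequality n s : (size s <= n)%N -> aform s s <= (n ^ 2)%:R * bform s s.
Proof.
elim: n s => [|n IH] s.
  by rewrite size_poly_leq0 => /eqP ->; rewrite aformE /bform !mulr0 pint0 mulr0.
move=> ss; have [q [sq qn qt tq]] := orthogonal_eigenpoly n.
rewrite -(subrK (s`_n *: q) s); have ss' := size_sub_lead ss sq qn.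
have [-> ->] := eigen_split (s`_n) qt tq ss'.
rewrite [leRHS]mulrDr lerD2r; apply: (le_trans (IH _ ss')).
by rewrite ler_wpM2r ?bform_ge0 // ler_nat leq_exp2r.
Qed.

(** The same peeling, now from the degree of [s] down to [n]: orthogonality leaves only eigenvalues
    from [(n + 1)^2] on. *)
Lemma spectral_gap n s : (forall t, (size t <= n)%N -> bform s t = 0) ->
  (n.+1 ^ 2)%:R * bform s s <= aform s s.
Proof.
have [m sm] := ubnP (size s); elim: m s sm => // m IH s; rewrite ltnS => sm st.
have [ns|sn] := leqP (size s) n.
  have /bform_eq0 -> := st _ ns.
  by rewrite aformE /bform !mulr0 pint0 mulr0.
case: m IH sm => [|m] IH sm; first by rewrite leqNgt (leq_trans _ sn) in sm.
have nm : (n <= m)%N by rewrite -ltnS (leq_trans sn).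
have [q [sq qm qt tq]] := orthogonal_eigenpoly m.
have ss' := size_sub_lead sm sq qm; set s' := s - _ in ss'.
have [e1 e2] := eigen_split (s`_m) qt tq ss'.
rewrite -(subrK (s`_m *: q) s) -/s' e1 e2 [leLHS]mulrDr; apply: lerD.
  apply: IH => // t tn; rewrite bformBl bformZl st // qt ?mulr0 ?subrr //.
  exact: leq_trans nm.
apply: ler_wpM2r; first by rewrite mulr_ge0 ?sqr_ge0 ?bform_ge0.
by rewrite ler_nat leq_exp2r.
Qed.

End JacobiOperator.

(** * Stability of interpolation *)

(** The pointwise bound [r(b)^2 <= 2 r(y)^2 + 2 (r(b) - r(y))^2] is integrated over [y], the
    increment being bounded by Cauchy-Schwarz. *)
Lemma trace_sqr (R : realType) (a b : R) (r : {poly R}) : a < b ->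
  (b - a) * r.[b] ^+ 2 <= 2 * pint a b (r ^+ 2) + 2 * (b - a) ^+ 2 * pint a b (r^`() ^+ 2).
Proof.
move=> ab; set E := pint a b (r^`() ^+ 2).
have -> : 2 * pint a b (r ^+ 2) + 2 * (b - a) ^+ 2 * E =
    pint a b (2 *: r ^+ 2 + (2 * (b - a) * E)%:P).
  by rewrite pintD pintZ pintC; ring.
rewrite [leLHS]mulrC -(pintC a b (r.[b] ^+ 2)); apply: le_pint => [|y /andP[ay yb]]; first exact: ltW.
rewrite hornerD !hornerC hornerZ horner_exp.
have : (r.[b] - r.[y]) ^+ 2 <= (b - a) * E.
  rewrite -pint_deriv; apply: (le_trans (pint_CS1 _ (ltW yb))).
  have r0 z : 0 <= (r^`() ^+ 2).[z] by rewrite horner_exp sqr_ge0.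
  have E0 : 0 <= pint y b (r^`() ^+ 2) by apply: pint_ge0 => //; exact: ltW.
  have Ea0 : 0 <= pint a y (r^`() ^+ 2) by apply: pint_ge0 => //; exact: ltW.
  have -> : E = pint a y (r^`() ^+ 2) + pint y b (r^`() ^+ 2) by rewrite pint_cat.
  by apply: ler_pM => //; move: (pint a y _) (pint y b _) E0 Ea0 => s t; lra.
by have := sqr_ge0 (r.[b] - 2 * r.[y]); lra.
Qed.

(* A product, because the numeral 2000000 would be a unary [nat]. *)
Definition stability_const (R : realType) : R := 2000 * 1000.

Lemma stability_const_gt0 (R : realType) : 0 < stability_const R.
Proof. by rewrite mulr_gt0 ?ltr0n. Qed.

Section InterpolationStability.
Variable R : realType.
Variables (N : nat) (x : nat -> R).
Hypotheses (N2 : (2 <= N)%N) (nodes : lobatto_nodes N x).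
Local Notation lam := ((N * N.+1)%:R : R).
Local Notation rho := (weight N x).
Local Notation h i := (x i.+1 - x i).
Implicit Types u v g r : {poly R}.

Let N1 : (1 <= N)%N := ltnW N2.
Let x0 := x0E nodes.
Let xN := xNE nodes.
Let lam0 := lam_gt0 R N1.
Let NE : N.-1.+1 = N. Proof. by rewrite prednK. Qed.
Let pN : (N.-1 < N)%N. Proof. by rewrite NE. Qed.

Let N'0 : (0 < N.-1)%N. Proof. by lia. Qed.
Let NE' : N.-2.+1 = N.-1. Proof. by lia. Qed.
Let ltPS (i : 'I_N.-1) : (i.+1 < N)%N. Proof. by have := ltn_ord i; lia. Qed.

Lemma bform_exact (k : {poly R}) : (size k <= N)%N ->
  bform k k = \sum_(j < N.+1) rho j * ((1 + x j) * k.[x j] ^+ 2).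
Proof.
move=> sk; rewrite /bform -mulrA -expr2 (quad_exact N1 nodes); last first.
  have s1 : (size (1 + 'X : {poly R})%R <= 2)%N.
    by rewrite addrC -polyC1 size_XaddC.
  have s2 : (size (k ^+ 2)%R <= (2 * N).-1)%N by rewrite expr2; apply: (size_mul_le sk sk); lia.
  by apply: (size_mul_le s1 s2); lia.
by apply: eq_bigr => j _; rewrite hornerM horner_exp !(hornerD, hornerC, hornerX).
Qed.

Lemma sqr_lam : lam <= 3 / 2 * (N ^ 2)%:R.
Proof.
have n2 : (2 : R) <= N%:R by rewrite (ler_nat _ 2).
have -> : (N ^ 2)%:R = N%:R * N%:R :> R by rewrite -mulnn natrM.
rewrite natrM -natr1; move: (N%:R : R) n2 => n n2.
by have : n * 2 <= n * n by [rewrite ler_wpM2l //; lra]; lra.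
Qed.

Definition energy v : R := pint (-1) 1 ((1 - 'X) * v^`() ^+ 2).

Lemma energy_ge0 v : 0 <= energy v.
Proof.
apply: pint_ge0 => [|y y1]; first by lra.
rewrite hornerM horner_exp mulr_ge0 ?sqr_ge0 //.
by rewrite !(hornerD, hornerN, hornerC, hornerX); lra.
Qed.

Lemma energyD_le u v : energy (u + v) <= 2 * energy u + 2 * energy v.
Proof.
have -> : 2 * energy u + 2 * energy v = energy (u + v) + energy (u - v).
  by rewrite /energy -!pintZ -!pintD; congr pint; rewrite derivD derivB -!mul_polyC; ring.
by rewrite lerDl energy_ge0.
Qed.

Lemma energy_aform (s : {poly R}) : energy ((1 + 'X) * s) = aform s s.
Proof. by rewrite /energy /aform expr2 mulrA. Qed.

Let sqr_N_le_lam : (N ^ 2)%:R <= lam.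
Proof. by rewrite ler_nat -mulnn leq_mul2l leqnSn orbT. Qed.

(** The node is the right end of the interval because both weights then compare in the useful
    direction: [1 + y <= 1 + x_(i+1)] for the mass, [1 - y >= 1 - x_(i+1)] for the energy. The bound
    [lam h^2 <= 198 (1 - x)(1 + x)] turns the derivative term of the trace inequality into
    energy. *)
Let sqr_term_le (r' : {poly R}) i : (i.+1 < N)%N ->
  (N ^ 2)%:R * (rho i.+1 * (((1 + 'X) * r').[x i.+1] ^+ 2)) <=
  (1 + x i.+1) *
  (86 * (N ^ 2)%:R * pint (x i) (x i.+1) ((1 + 'X) * r' ^+ 2) +
   86 * 198 * pint (x i) (x i.+1) ((1 - 'X) * ((1 + 'X) * r')^`() ^+ 2)).
Proof.
move=> iN; have iN' := ltnW iN; set r := (1 + 'X) * r'.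
have le_xx := ltW (node_ltS nodes iN').
have xi := node_ge nodes (ltnW iN').
have D0 : 0 < 1 + x i.+1 by have := node_gt nodes (i := i.+1); rewrite iN' => /(_ isT); lra.
have [_ rw] := spacing_weight N2 nodes iN' (j := i.+1) (introT orP (or_intror (eqxx _))).
have tr := trace_sqr r (node_ltS nodes iN').
have [] := pint_dist1_sqr_bounds nodes r^`() iN'.
set E := pint _ _ ((1 - 'X) * _) => dE _.
have rE : pint (x i) (x i.+1) (r ^+ 2) <= (1 + x i.+1) * pint (x i) (x i.+1) ((1 + 'X) * r' ^+ 2).
  rewrite -pintCM; apply: le_pint => // y /andP[iy yi].
  have -> : r ^+ 2 = (1 + 'X) * ((1 + 'X) * r' ^+ 2) by rewrite /r; ring.
  have : 0 <= ((1 + 'X) * r' ^+ 2).[y].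
    by rewrite hornerM horner_exp mulr_ge0 ?sqr_ge0 // !(hornerD, hornerC, hornerX); lra.
  move: ((1 + 'X) * r' ^+ 2) => z z0; rewrite !hornerM ler_wpM2r //.
  by rewrite !(hornerD, hornerC, hornerX); lra.
have hp := spacing_sqr_upper N2 nodes iN' (j := i.+1) _ (introT orP (or_intror (eqxx _))).
have {}hp : lam * h i ^+ 2 <= 198 * ((1 - x i.+1) * (1 + x i.+1)) by apply: hp; rewrite iN.
move: rE tr; set W := pint _ _ ((1 + 'X) * _); set I1 := pint _ _ (r ^+ 2).
move: dE; set I2 := pint _ _ (r^`() ^+ 2) => dE rE tr.
have I20 : 0 <= I2 by apply: pint_ge0 => // y _; rewrite horner_exp sqr_ge0.
have n0 : 0 <= (N ^ 2)%:R :> R by rewrite ler0n.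
have s0 : 0 <= r.[x i.+1] ^+ 2 by rewrite sqr_ge0.
apply: (@le_trans _ _ ((N ^ 2)%:R * (43 * (2 * I1 + 2 * h i ^+ 2 * I2)))).
  apply: ler_wpM2l => //; have := ler_wpM2r s0 rw; lra.
have l1 := ler_wpM2l n0 rE.
have l2 : (N ^ 2)%:R * (h i ^+ 2 * I2) <= lam * (h i ^+ 2 * I2).
  by rewrite ler_wpM2r ?sqr_N_le_lam // mulr_ge0 // sqr_ge0.
have l3 := ler_wpM2r I20 hp.
have l4 := ler_wpM2l (ltW D0) dE.
move: l1 l2 l3 l4; move: (lam) (h i ^+ 2) (_ ^ 2)%:R => l hh n; lra.
Qed.

(** After division by [1 + x], [g] becomes [q = s + r'] with [s] its projection on degrees below
    [N], and [u] becomes [m]. The low-degree [k = m - s] agrees with [r'] at the nodes other than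
    [-1]. The inverse inequality and exact quadrature bound its energy by nodal values of [r'];
    traces and the spectral gap bound these by the energy of [r']. The traces stop before the node
    1, which is why the last increment of [g] appears. *)
Lemma energy_le_of_vanishing u g : (size u <= N.+1)%N ->
  (forall i, (i <= N)%N -> u.[x i] = g.[x i]) -> g.[-1] = 0 ->
  energy u <= stability_const R * (energy g + (g.[1] - g.[x N.-1]) ^+ 2).
Proof.
move=> su ug g1.
have /factor_theorem[q gE] : root g (-1) by apply/rootP.
have /factor_theorem[m uE] : root u (-1) by apply/rootP; rewrite -x0 ug // x0.
have X1 : 'X - (-1)%:P = 1 + 'X :> {poly R} by rewrite polyCN opprK polyC1 addrC.
rewrite X1 mulrC in gE; rewrite X1 mulrC in uE.
move: gE uE => gE uE.
have sm : (size m <= N)%N.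
  have [->|m0] := eqVneq m 0; first by rewrite size_poly0.
  have X0 : 1 + 'X != 0 :> {poly R} by rewrite -X1 polyXsubC_eq0.
  have := size_mul X0 m0; rewrite -uE -{1}X1 size_XsubC add2n /= => e.
  by move: su; rewrite e.
have [s ss] := bform_projection N q.
have [r' qE] : exists r', q = s + r' by exists (q - s); rewrite addrC subrK.
rewrite {1}qE addrC addKr => rs.
have aq : energy g = aform s s + aform r' r'.
  rewrite gE energy_aform qE !aformE jacobi_opD !(bformDl, bformDr).
  by rewrite (bform_tau r' s) (bformC _ r') (rs (jacobi_op s)) ?size_jacobi_op //; ring.
pose k := m - s; have sk : (size k <= N)%N.
  by rewrite (leq_trans (size_polyD _ _)) // geq_max sm size_polyN.
have kr i : (i <= N)%N -> ((1 + 'X) * k).[x i] = ((1 + 'X) * r').[x i].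
  move=> iN; have -> : (1 + 'X) * r' = g - (1 + 'X) * s by rewrite gE qE; ring.
  by rewrite mulrBr -uE !hornerD (ug i iN).
have gap := spectral_gap rs.
have inv := inverse_inequality sk.
have b0 := bform_ge0 r'; have a0 : 0 <= aform s s by rewrite -energy_aform energy_ge0.
have nlt : (N ^ 2)%:R <= (N.+1 ^ 2)%:R :> R by rewrite ler_nat leq_exp2r.
have {}gap : (N ^ 2)%:R * bform r' r' <= aform r' r'.
  by apply: le_trans gap; rewrite ler_wpM2r.
pose r := (1 + 'X) * r'; pose beta i := pint (x i) (x i.+1) ((1 + 'X) * r' ^+ 2).
pose alpha i := pint (x i) (x i.+1) ((1 - 'X) * r^`() ^+ 2).
have beta0 i : (i < N)%N -> 0 <= beta i.
  move=> iN; apply: pint_ge0 => [|y /andP[iy _]]; first exact/ltW/(node_ltS nodes).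
  rewrite hornerM horner_exp mulr_ge0 ?sqr_ge0 //.
  by rewrite !(hornerD, hornerC, hornerX); have := node_ge nodes (ltnW iN); lra.
have alpha0 i : (i < N)%N -> 0 <= alpha i.
  move=> iN; apply: pint_ge0 => [|y /andP[_ yi]]; first exact/ltW/(node_ltS nodes).
  rewrite hornerM horner_exp mulr_ge0 ?sqr_ge0 //.
  by rewrite !(hornerD, hornerN, hornerC, hornerX); have := node_le nodes iN; lra.
have betaE : bform r' r' = \sum_(i < N) beta i.
  by rewrite /bform -mulrA -expr2 (pint_nodes nodes).
have alphaE : aform r' r' = \sum_(i < N) alpha i.
  by rewrite -energy_aform /energy (pint_nodes nodes).
pose M := 86 * (N ^ 2)%:R * bform r' r' + 86 * 198 * aform r' r'.
have MM : M <= 86 * 199 * aform r' r' by rewrite /M; lra.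
(* The terms of the quadrature for [N^2 bform k k]; [T 0] vanishes because [1 + x_0 = 0]. *)
pose T j := (N ^ 2)%:R * (rho j * ((1 + x j) * k.[x j] ^+ 2)).
have TE j : (0 < j <= N)%N -> (1 + x j) * T j = (N ^ 2)%:R * (rho j * r.[x j] ^+ 2).
  move=> /andP[j0 jN]; rewrite /r -kr // /T hornerM.
  by rewrite !(hornerD, hornerC, hornerX); move: (N ^ 2)%:R => n; ring.
have T_le i : (i.+1 < N)%N -> T i.+1 <= 86 * (N ^ 2)%:R * beta i + 86 * 198 * alpha i.
  move=> iN; have := sqr_term_le r' iN; rewrite -/r -TE; last by rewrite (ltnW iN).
  by rewrite ler_pM2l //; have := node_gt nodes (i := i.+1); rewrite /= (ltnW iN) => /(_ isT); lra.
have sumT : \sum_(i < N.-1) T i.+1 <= M.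
  apply: (@le_trans _ _ (\sum_(i < N.-1) (86 * (N ^ 2)%:R * beta i + 86 * 198 * alpha i))).
    by apply: ler_sum => i _; exact/T_le/ltPS.
  rewrite big_split /= -!mulr_sumr /M betaE alphaE (big_ord_pred beta N1) (big_ord_pred alpha N1).
  by apply: lerD; rewrite ler_wpM2l ?mulr_ge0 ?ler0n // lerDl ?beta0 ?alpha0.
have T0 j : (j <= N)%N -> 0 <= T j.
  move=> jN; rewrite /T mulr_ge0 ?ler0n // mulr_ge0 ?(ltW (weight_gt0 N1 nodes jN)) //.
  by rewrite mulr_ge0 ?sqr_ge0 //; have := node_ge nodes jN; lra.
have TN1 : T N.-1 <= M.
  apply: le_trans sumT; rewrite (big_ord_pred (fun i => T i.+1) N'0) NE' lerDr.
  apply: sumr_ge0 => i _; apply: T0; apply: leq_trans (ltn_ord i) _.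
  by rewrite (leq_trans (leq_pred _)) // leq_pred.
have ra : r.[x N.-1] ^+ 2 <= 20 * M.
  have jN : (0 < N.-1 <= N)%N by rewrite N'0 leq_pred.
  have := TE _ jN; set a := N.-1 in jN TN1 *.
  have Da : 0 <= 1 + x a by have := node_ge nodes (i := a); case/andP: jN => _ -> /(_ isT); lra.
  have Da2 : 1 + x a <= 2 by have := node_le nodes (i := a); case/andP: jN => _ -> /(_ isT); lra.
  have M0 : 0 <= M by apply: le_trans TN1; apply: T0; case/andP: jN.
  have : (1 + x a) * T a <= 2 * M by apply: ler_pM => //; apply: T0; case/andP: jN.
  move=> le1 e; rewrite e in le1.
  have [hr _] := spacing_weight N2 nodes pN (introT orP (or_introl (eqxx N.-1))).
  have d4 := dist1_lower N1 nodes pN; rewrite NE xN in hr; rewrite -/a in hr d4.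
  (* From [h <= 13 rho], [lam h >= 4] and [lam <= 3 / 2 N^2]. *)
  have rr : 8 / 39 <= (N ^ 2)%:R * rho a.
    have := ler_wpM2l (ltW lam0) hr; have := ler_wpM2r (ltW (weight_gt0 N1 nodes (ltnW pN))) sqr_lam.
    by rewrite -/a; move: (lam) (N ^ 2)%:R d4 => l n; lra.
  have := ler_wpM2r (sqr_ge0 r.[x a]) rr; rewrite -mulrA; lra.
(* The value [r(1)] is reached from [r(x_(N-1))]: the increment of [r = g - G] is that of [g] minus
   that of [G], and [G] has degree at most [N]. *)
have G1 := last_increment N2 nodes (u := (1 + 'X) * s).
have {G1} : (((1 + 'X) * s).[1] - ((1 + 'X) * s).[x N.-1]) ^+ 2 <= 3000 * aform s s.
  rewrite -energy_aform; apply: G1; apply: (@size_mul_le _ _ _ 2 N) => //.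
  by rewrite -X1 size_XsubC.
set G := (1 + 'X) * s => G1.
have gr y : g.[y] = G.[y] + r.[y].
  by rewrite -hornerD gE qE /G /r mulrDr.
have TN : T N <= r.[1] ^+ 2.
  have := TE N; rewrite N1 leqnn => /(_ isT); rewrite weightN // xN => e.
  have : (N ^ 2)%:R * (2 / lam * r.[1] ^+ 2) <= 2 * r.[1] ^+ 2.
    rewrite mulrA ler_wpM2r ?sqr_ge0 // mulrCA ler_piMr // ler_pdivrMr //.
    by rewrite mul1r sqr_N_le_lam.
  by rewrite -e -[1 + 1]/2 ler_pM2l.
have ak : aform k k <= \sum_(j < N.+1) T j.
  by apply: (le_trans inv); rewrite bform_exact // mulr_sumr.
have T00 : T 0%N = 0 by rewrite /T x0 subrr mul0r !mulr0.
have sT : \sum_(j < N.+1) T j = \sum_(i < N.-1) T i.+1 + T N.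
  rewrite (big_ord_pred_recl T) // T00 add0r (big_ord_pred (fun i => T i.+1)) //.
  by rewrite NE.
have : energy u <= 2 * aform s s + 2 * aform k k.
  by rewrite -!energy_aform uE -[m](subrK s) -/k mulrDr addrC energyD_le.
rewrite sT in ak.
move: gr G1 ra TN; rewrite aq => gr.
rewrite !gr; move: r.[1] r.[x N.-1] G.[1] G.[x N.-1] (aform s s) (aform r' r') (aform k k) (T N) (\sum_(_ < _) _) (M) a0 sumT ak MM => r1 ra G1 Ga as_ ar ak TN S M' a0 sumT ak' MM h1 h2 h3 h4.
have ar0 : 0 <= M' by have := sqr_ge0 ra; lra.
have l1 : r1 ^+ 2 <= 2 * ra ^+ 2 + 2 * (r1 - ra) ^+ 2 by have := sqr_ge0 (r1 - 2 * ra); lra.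
have l2 : (r1 - ra) ^+ 2 <= 2 * (G1 + r1 - (Ga + ra)) ^+ 2 + 2 * (G1 - Ga) ^+ 2.
  by have := sqr_ge0 (G1 + r1 - (Ga + ra) + (G1 - Ga)); lra.
have l3 := sqr_ge0 (G1 + r1 - (Ga + ra)).
rewrite /stability_const; lra.
Qed.

(** Subtracting the constant [g(-1)] changes neither the energies nor the increments. *)
Lemma interpolation_stability u g : (size u <= N.+1)%N ->
  (forall i, (i <= N)%N -> u.[x i] = g.[x i]) ->
  energy u <= stability_const R * (energy g + (g.[1] - g.[x N.-1]) ^+ 2).
Proof.
move=> su ug; pose c := g.[-1].
have eC v : energy (v - c%:P) = energy v by rewrite /energy derivB derivC subr0.
have := @energy_le_of_vanishing (u - c%:P) (g - c%:P); rewrite !eC.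
rewrite !(hornerD, hornerN, hornerC) subrr.
have -> : g.[1] - c - (g.[x N.-1] - c) = g.[1] - g.[x N.-1] by ring.
apply=> //.
  rewrite (leq_trans (size_polyD _ _)) // geq_max su size_polyN.
  by rewrite (leq_trans (size_polyC_leq1 _)).
by move=> i iN; rewrite !(hornerD, hornerN, hornerC) ug.
Qed.

End InterpolationStability.

(** * Polynomial approximation of the piecewise linear interpolant *)

Lemma expr_small (R : realType) (k e : R) : 0 <= k < 1 -> 0 < e -> exists n, k ^+ n < e.
Proof.
move=> /andP[k0 k1] e0; have k1' : `|k| < 1 by rewrite ger0_norm.
have /cvgr0_norm_lt /(_ e e0) [n _ /(_ n (leqnn n))] := cvg_expr k1'.
by move=> /= h; exists n; rewrite ger0_norm ?exprn_ge0 in h.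
Qed.

Section StepApproximation.
Variable R : realType.
Implicit Types (a b c e t y : R).

(** This cubic fixes 0, 1/2 and 1 and is symmetric about 1/2; 0 and 1 attract, so its iterates
    approach a step. *)
Definition smoothstep : {poly R} := 3 *: 'X^2 - 2 *: 'X^3.

Lemma smoothstepE t : smoothstep.[t] = t ^+ 2 * (3 - 2 * t).
Proof. by rewrite hornerD hornerN !hornerZ !horner_exp hornerX; ring. Qed.

Lemma smoothstep_sub1 t : smoothstep.[1 - t] = 1 - smoothstep.[t].
Proof. by rewrite !smoothstepE; ring. Qed.

Lemma smoothstep_itv t : 0 <= t <= 1 -> 0 <= smoothstep.[t] <= 1.
Proof.
move=> t1; have St s : 0 <= s <= 1 -> 0 <= smoothstep.[s].
  by move=> s1; rewrite smoothstepE mulr_ge0 ?sqr_ge0 //; lra.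
rewrite St //= -subr_ge0 -smoothstep_sub1 St //; lra.
Qed.

(** The affine start sends [c] to 1/2 and maps [[-1, 1]] into [[0, 1]] for every [c] in [[-1, 1]];
    the iterates then approximate the unit step at [c]. *)
Definition smoothstep_iter n c : {poly R} :=
  iter n (fun p => smoothstep \Po p) (2^-1%:P + 4^-1 *: ('X - c%:P)).
Local Notation S := smoothstep_iter.

Lemma smoothstep_iter0E c y : (S 0 c).[y] = 1 / 2 + (y - c) / 4.
Proof. by rewrite hornerD hornerC hornerZ hornerXsubC; field. Qed.

Lemma smoothstep_iterSE n c y : (S n.+1 c).[y] = smoothstep.[(S n c).[y]].
Proof. exact: horner_comp. Qed.

Lemma smoothstep_iter_itv n c y : -1 <= c <= 1 -> -1 <= y <= 1 ->
  0 <= (S n c).[y] <= 1.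
Proof.
move=> c1 y1; elim: n => [|n IH]; last by rewrite smoothstep_iterSE smoothstep_itv.
by rewrite smoothstep_iter0E; lra.
Qed.

Lemma smoothstep_iter_opp n c y : (S n c).[y] = 1 - (S n c).[2 * c - y].
Proof.
elim: n => [|n IH]; first by rewrite !smoothstep_iter0E; field.
by rewrite !smoothstep_iterSE IH smoothstep_sub1.
Qed.

Lemma smoothstep_iter_small c e : 0 < e <= 1 -> -1 <= c <= 1 ->
  exists n, forall y, c - 2 <= y <= c - e -> 0 <= (S n c).[y] <= e.
Proof.
move=> e01 c1; pose t0 : R := 1 / 2 - e / 4; pose k := t0 * (3 - 2 * t0).
have k01 : 0 <= k < 1.
  have : 0 < (1 - 2 * t0) * (1 - t0) by rewrite mulr_gt0 /t0; lra.
  by rewrite /k => h; apply/andP; split; [rewrite mulr_ge0 /t0; lra | lra].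
have e0 : 0 < e by lra.
have [n kn] := expr_small k01 e0; exists n => y yc.
have : 0 <= (S n c).[y] /\ (S n c).[y] <= k ^+ n * t0.
  elim: n {kn} => [|n [IH0 IH1]].
    by rewrite expr0 mul1r smoothstep_iter0E /t0; lra.
  have kn1 : k ^+ n <= 1 by rewrite exprn_ile1 //; lra.
  have le_t0 : (S n c).[y] <= t0.
    by apply: (le_trans IH1); rewrite ler_piMl // /t0; lra.
  rewrite smoothstep_iterSE smoothstepE; move: (S n c).[y] IH0 IH1 le_t0 => t t00 IH1 le_t0.
  split; first by rewrite mulr_ge0 ?sqr_ge0 //; rewrite /t0 in le_t0; lra.
  have tk : t * (3 - 2 * t) <= k.
    have : 0 <= (t0 - t) * (3 - 2 * (t + t0)) by rewrite mulr_ge0 //; rewrite /t0 in le_t0 *; lra.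
    by rewrite /k; lra.
  rewrite expr2 -mulrA mulrC exprS -mulrA; apply: ler_pM => //.
  by rewrite mulr_ge0 //; rewrite /t0 in le_t0; lra.
move=> [-> h]; apply: (le_trans h); have : k ^+ n * t0 <= k ^+ n * 1.
  by rewrite ler_wpM2l ?exprn_ge0 // /t0; lra.
lra.
Qed.

(** Split at [c - e]: before it [p ^+ 2 <= e] on a length at most 2, after it [p ^+ 2 <= 1] on a
    length at most [e]. *)
Lemma pint_sqr_small (p : {poly R}) a b c e : 0 < e <= 1 -> -1 <= a <= b -> b <= 1 -> b <= c ->
  (forall y, a <= y <= b -> 0 <= p.[y] <= 1) ->
  (forall y, a <= y <= b -> y <= c - e -> p.[y] <= e) ->
  pint a b (p ^+ 2) <= 3 * e.
Proof.
move=> e01 ab b1 bc p01 pe.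
have far a' b' : a <= a' -> a' <= b' -> b' <= b -> b' <= c - e -> pint a' b' (p ^+ 2) <= 2 * e.
  move=> aa ab' bb bce; apply: (@le_trans _ _ (pint a' b' e%:P)); last first.
    by rewrite pintC mulrC ler_wpM2r //; lra.
  apply: le_pint => // y yab; rewrite horner_exp hornerC.
  have y1 : a <= y <= b by lra.
  have := p01 y y1; have : p.[y] <= e by apply: pe => //; lra.
  move=> h1 h2; apply: (@le_trans _ _ (1 * p.[y])); last by rewrite mul1r.
  by rewrite expr2 ler_wpM2r //; lra.
have near a' b' : a <= a' -> a' <= b' -> b' <= b -> b' - a' <= e -> pint a' b' (p ^+ 2) <= e.
  move=> aa ab' bb bce; apply: (@le_trans _ _ (pint a' b' 1%:P)); last by rewrite pintC mul1r.
  apply: le_pint => // y yab; rewrite horner_exp hornerC.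
  have := p01 y; have -> : a <= y <= b by lra.
  by move=> /(_ isT) h; rewrite expr2; have := mulr_ge0 (_ : 0 <= p.[y]) (_ : 0 <= 1 - p.[y]); lra.
have [ca|ac] := leP (c - e) a.
  by apply: (@le_trans _ _ e); [apply: near; lra | lra].
have [cb|bc'] := leP b (c - e).
  by apply: (@le_trans _ _ (2 * e)); [apply: far; lra | lra].
rewrite -(pint_cat a (c - e) b).
have := far a (c - e); have := near (c - e) b; lra.
Qed.

Lemma step_approximation c e : 0 < e -> -1 <= c <= 1 -> exists q : {poly R},
  forall a b, -1 <= a <= b -> b <= 1 ->
    (b <= c -> pint a b (q ^+ 2) <= e) /\ (c <= a -> pint a b ((q - 1) ^+ 2) <= e).
Proof.
move=> e0 c1; pose e' := Num.min 1 (e / 3).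
have e01 : 0 < e' <= 1 by rewrite /e' lt_min ge_min lexx; lra.
have ee : 3 * e' <= e by rewrite /e'; have : Num.min 1 (e / 3) <= e / 3 by [rewrite ge_min lexx orbT]; lra.
have [n small] := smoothstep_iter_small e01 c1; exists (S n c) => a b ab b1; split => bc.
  apply: (le_trans _ ee); apply: (pint_sqr_small (c := c)) => // y yab.
    by apply: smoothstep_iter_itv; lra.
  by move=> yc; have /andP[] := small y (ltac:(lra)).
apply: (le_trans _ ee).
have -> : pint a b ((S n c - 1) ^+ 2) = pint (- b) (- a) ((1 - (S n c \Po - 'X)) ^+ 2).
  rewrite -pint_comp_oppX; congr pint; rewrite rmorphXn rmorphB rmorph1 /=.
  by rewrite -comp_polyA rmorphN /= comp_polyX opprK comp_polyXr -sqrrN opprB.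
have qE y : (1 - (S n c \Po - 'X)).[y] = (S n c).[2 * c + y].
  rewrite hornerD hornerC hornerN horner_comp hornerN hornerX smoothstep_iter_opp.
  by congr (1 - _.[_]); ring.
apply: (pint_sqr_small (c := - c)) => //; try lra.
  move=> y yab; have := @smoothstep_iter_itv n c (- y) c1.
  rewrite hornerD hornerC hornerN horner_comp hornerN hornerX.
  by move=> h; have := h (ltac:(lra)); lra.
move=> y yab yc; rewrite qE; have /andP[] := small (2 * c + y) (ltac:(lra)); by [].
Qed.

End StepApproximation.

Section Density.
Variable R : realType.
Variables (N : nat) (x : nat -> R).
Hypotheses (N2 : (2 <= N)%N) (nodes : lobatto_nodes N x).
Local Notation h i := (x i.+1 - x i).
Implicit Types u v g : {poly R}.

Let N1 : (1 <= N)%N := ltnW N2.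
Let x0 := x0E nodes.
Let xN := xNE nodes.

Lemma pint_sqrD_le (a b : R) u v : a <= b ->
  pint a b ((u + v) ^+ 2) <= 2 * pint a b (u ^+ 2) + 2 * pint a b (v ^+ 2).
Proof.
move=> ab; have -> : 2 * pint a b (u ^+ 2) + 2 * pint a b (v ^+ 2) =
    pint a b ((u + v) ^+ 2) + pint a b ((u - v) ^+ 2).
  by rewrite -!pintZ -!pintD; congr pint; rewrite -!mul_polyC; ring.
by rewrite lerDl pint_ge0 // => y _; rewrite horner_exp sqr_ge0.
Qed.

(** Induction on the number of jumps: [minn j n] freezes the values after index [n], and passing to
    [n.+1] adds one scaled step at [x_(n+1)]. Two errors of [e / 4] become [e] after doubling. *)
Lemma piecewise_constant_approximation (sg : nat -> R) n e : (n < N)%N -> 0 < e ->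
  exists Q : {poly R}, forall j, (j < N)%N ->
    pint (x j) (x j.+1) ((Q - (sg (minn j n))%:P) ^+ 2) <= e.
Proof.
elim: n e => [|n IH] e nN e0.
  by exists (sg 0%N)%:P => j jN; rewrite minn0 subrr expr0n pint0 ltW.
have [|Q HQ] := IH (e / 4) (ltnW nN); first by lra.
pose d := sg n.+1 - sg n.
have d1 : 0 < d ^+ 2 + 1 by have := sqr_ge0 d; lra.
have [||q Hq] := @step_approximation R (x n.+1) (e / (4 * (d ^+ 2 + 1))).
- by rewrite divr_gt0 ?mulr_gt0.
- by rewrite (node_ge nodes) ?(node_le nodes) // ltnW.
exists (Q + d *: q) => j jN.
have le_xx := ltW (node_ltS nodes jN).
have xx1 : -1 <= x j <= x j.+1 by rewrite (node_ge nodes) // ltnW.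
have [q0 q1] := Hq _ _ xx1 (node_le nodes jN).
have small (r : {poly R}) : pint (x j) (x j.+1) (r ^+ 2) <= e / (4 * (d ^+ 2 + 1)) ->
    pint (x j) (x j.+1) ((d *: r) ^+ 2) <= e / 4.
  move=> r_le; rewrite exprZn pintZ; apply: (le_trans (ler_wpM2l (sqr_ge0 d) r_le)).
  rewrite mulrA ler_pdivrMr ?mulr_gt0 //.
  have -> : e / 4 * (4 * (d ^+ 2 + 1)) = d ^+ 2 * e + e by field.
  by rewrite lerDl ltW.
have [jn|nj] := leqP j n.
  have -> : minn j n.+1 = minn j n by rewrite !(minn_idPl _) // leqW.
  have -> : Q + d *: q - (sg (minn j n))%:P = (Q - (sg (minn j n))%:P) + d *: q by ring.
  have := small q (q0 _); rewrite (lex nodes) ?ltnS ?jn ?(ltnW nN) // => /(_ isT) le2.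
  by apply: (le_trans (pint_sqrD_le _ _ le_xx)); have := HQ j jN; lra.
have -> : Q + d *: q - (sg (minn j n.+1))%:P = (Q - (sg (minn j n))%:P) + d *: (q - 1).
  rewrite (minn_idPr nj) (minn_idPr (ltnW nj)) scalerBr -[d *: 1]/(d%:A) alg_polyC /d polyCB.
  ring.
have := small (q - 1) (q1 _); rewrite (lex nodes) ?nj ?(ltnW jN) // => /(_ isT) le2.
by apply: (le_trans (pint_sqrD_le _ _ le_xx)); have := HQ j jN; lra.
Qed.

(** [K] depends on the mesh, which is harmless: it only multiplies nodal errors that are chosen
    afterwards, as small as desired. *)
Lemma energy_lobatto_lagrange_le : exists2 K : R, 0 <= K & forall e : 'I_N.+1 -> R,
  energy (\sum_j e j *: lobatto_lagrange x j) <= (\sum_j e j ^+ 2) * K.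
Proof.
exists (\sum_(j < N.+1) energy (lobatto_lagrange x j)).
  by apply: sumr_ge0 => j _; exact: energy_ge0.
move=> e; rewrite /energy -pint_sum -pintCM; apply: le_pint => [|y y1]; first by lra.
rewrite -mulr_sumr mulrA [_%:P * _]mulrC -mulrA !hornerM.
apply: ler_wpM2l; first by rewrite !(hornerD, hornerN, hornerC, hornerX); lra.
rewrite hornerC -expr2 (big_morph _ (@derivD R) (deriv0 R)) !horner_sum.
apply: sum_CS => [j|j|j]; rewrite ?horner_exp ?sqr_ge0 //.
by rewrite derivZ hornerZ exprMn.
Qed.

Definition chord_energy u : R :=
  \sum_(i < N) pint (x i) (x i.+1) ((1 - 'X) * (chord x u i)^`() ^+ 2).

(* Integrate a polynomial close to the slopes of [u_h], then correct the small errors at the nodes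
   by Lagrange polynomials. *)
Lemma polynomial_interpolant_energy u e : 0 < e -> exists g : {poly R},
  (forall i, (i <= N)%N -> g.[x i] = u.[x i]) /\
  energy g <= 3 * chord_energy u + e.
Proof.
move=> e0; have [K K0 HK] := energy_lobatto_lagrange_le.
pose C : R := 6 * N%:R + 3 * (N.+1%:R * (N%:R * N%:R * 2) * K).
have n0 : 0 <= N%:R :> R by rewrite ler0n.
have C0 : 0 <= C by rewrite addr_ge0 // ?mulr_ge0.
pose eta := e / (C + 1).
have eta0 : 0 < eta by rewrite divr_gt0 //; lra.
have Ceta : C * eta <= e by rewrite /eta mulrCA ler_piMr ?(ltW e0) // ler_pdivrMr; lra.
pose sg i := (u.[x i.+1] - u.[x i]) / h i.
have pN : (N.-1 < N)%N by rewrite prednK.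
have [Q HQ'] := piecewise_constant_approximation sg pN eta0.
have HQ j : (j < N)%N -> pint (x j) (x j.+1) ((Q - (sg j)%:P) ^+ 2) <= eta.
  by move=> jN; have := HQ' j jN; rewrite (minn_idPl _) // -ltnS prednK.
pose g0 := (u.[-1] - (primitive Q).[-1])%:P + primitive Q.
(* The nodal errors of [g0] are accumulated integrals of [Q] minus the slopes, so their squares are
   of order [eta]. *)
pose del k := u.[x k] - g0.[x k].
have delS k : (k < N)%N -> del k.+1 = del k - pint (x k) (x k.+1) (Q - (sg k)%:P).
  move=> kN; rewrite pintB pintC /sg divfK; last by rewrite gt_eqF // subr_gt0 (node_ltS nodes).
  by rewrite /del /g0 !hornerD !hornerC /pint; ring.
have delE k : (k <= N)%N -> del k = - \sum_(i < k) pint (x i) (x i.+1) (Q - (sg i)%:P).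
  elim: k => [|k IH] kN.
    by rewrite big_ord0 oppr0 /del /g0 x0 hornerD hornerC; ring.
  by rewrite delS // IH ?(ltnW kN) // big_ord_recr /= [RHS]opprD.
have del_le k : (k <= N)%N -> del k ^+ 2 <= N%:R * N%:R * 2 * eta.
  move=> kN; rewrite delE // sqrrN.
  have := @sum_CS R k (fun i => pint (x i) (x i.+1) (Q - (sg i)%:P)) (fun=> 1) (fun=> 2 * eta).
  have i1 (i : 'I_k) : pint (x i) (x i.+1) (Q - (sg i)%:P) ^+ 2 <= 1 * (2 * eta).
    have iN : (i < N)%N by apply: leq_trans kN.
    have le_xx := ltW (node_ltS nodes iN).
    rewrite mul1r; apply: (le_trans (pint_CS1 _ le_xx)); apply: ler_pM; rewrite ?HQ //.
    - by rewrite subr_ge0.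
    - by apply: pint_ge0 => // y _; rewrite horner_exp sqr_ge0.
    - by have := node_ge nodes (ltnW iN); have := node_le nodes iN; lra.
  move=> /(_ (fun=> ler01)) CS; have {CS} := CS (fun=> mulr_ge0 (ler0n R 2) (ltW eta0)) i1.
  move/le_trans; apply; rewrite !sumr_const card_ord -[1 *+ k]/(k%:R) -[2 * eta *+ k]mulr_natl.
  have kN' : k%:R <= N%:R :> R by rewrite ler_nat.
  have kk : k%:R * k%:R <= N%:R * N%:R :> R by apply: ler_pM.
  by have := ler_wpM2r (ltW eta0) kk; move: (k%:R : R) (N%:R : R) (eta) => s t z; lra.
pose L := \sum_(j < N.+1) del j *: lobatto_lagrange x j.
exists (g0 + L); split.
  move=> i; rewrite -ltnS => iN; rewrite hornerD /L horner_sum (bigD1 (Ordinal iN)) //=.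
  rewrite hornerZ (lobatto_lagrangeE N1 nodes _ (Ordinal iN)) eqxx mulr1 big1 => [|j /negPf ji].
    by rewrite addr0 /del addrC subrK.
  by rewrite hornerZ (lobatto_lagrangeE N1 nodes _ (Ordinal iN)) ji mulr0.
have EL : energy L <= N.+1%:R * (N%:R * N%:R * 2) * K * eta.
  apply: (le_trans (HK (fun j => del j))); rewrite mulrAC; apply: ler_wpM2r => //.
  apply: (@le_trans _ _ (\sum_(j < N.+1) (N%:R * N%:R * 2 * eta))).
    by apply: ler_sum => j _; apply: del_le; exact: leq_ord.
  by rewrite sumr_const card_ord -[leLHS]mulr_natl [leLHS]mulrA.
have gE : (g0 + L)^`() = Q + L^`().
  by rewrite derivD /g0 derivD derivC add0r deriv_primitive.
rewrite /energy gE (pint_nodes nodes).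
apply: (@le_trans _ _ (\sum_(i < N) (3 * pint (x i) (x i.+1) ((1 - 'X) * (chord x u i)^`() ^+ 2)
    + 6 * eta + 3 * pint (x i) (x i.+1) ((1 - 'X) * L^`() ^+ 2)))).
  apply: ler_sum => i _; have iN := ltn_ord i; have le_xx := ltW (node_ltS nodes iN).
  have := HQ i iN; rewrite deriv_chord -/(sg i) => Hi.
  apply: (@le_trans _ _ (3 * pint (x i) (x i.+1) ((1 - 'X) * ((sg i)%:P) ^+ 2)
     + 6 * pint (x i) (x i.+1) ((Q - (sg i)%:P) ^+ 2)
     + 3 * pint (x i) (x i.+1) ((1 - 'X) * L^`() ^+ 2))); last by lra.
  rewrite -!pintZ -!pintD; apply: le_pint => // y yi.
  have y1 : -1 <= y <= 1 by have := node_ge nodes (ltnW iN); have := node_le nodes iN; lra.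
  move: (L^`()) => l.
  rewrite !hornerD !hornerZ !(hornerM (1 - 'X)) !horner_exp !(hornerD, hornerN, hornerC, hornerX).
  move: Q.[y] l.[y] (sg i) => q t s.
  (* The factor 3 arises here: the derivative is a sum of three terms, the slope, its approximation
     error and the nodal correction. *)
  have : (q + t) ^+ 2 <= 3 * s ^+ 2 + 3 * (q - s) ^+ 2 + 3 * t ^+ 2.
    have := sqr_ge0 (s - (q - s)); have := sqr_ge0 (s - t); have := sqr_ge0 (q - s - t); lra.
  have y0 : 0 <= 1 - y by lra.
  move/(ler_wpM2l y0); have : (1 - y) * (q - s) ^+ 2 <= 2 * (q - s) ^+ 2.
    by rewrite ler_wpM2r ?sqr_ge0 //; lra.
  lra.
rewrite !big_split /= -mulr_sumr -[X in _ + X <= _]mulr_sumr -(pint_nodes nodes) -/(chord_energy u) -/(energy L).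
rewrite sumr_const card_ord -[6 * eta *+ N]mulr_natl.
have : C * eta = 6 * N%:R * eta + 3 * (N.+1%:R * (N%:R * N%:R * 2) * K * eta).
  by rewrite /C; ring.
lra.
Qed.

Lemma chord_energy_last u : (u.[1] - u.[x N.-1]) ^+ 2 <= 2 * chord_energy u.
Proof.
have NE : N.-1.+1 = N by rewrite prednK.
have pN : (N.-1 < N)%N by rewrite NE.
have e : 2 * pint (x N.-1) (x N.-1.+1) ((1 - 'X) * (chord x u N.-1)^`() ^+ 2) =
    (u.[1] - u.[x N.-1]) ^+ 2.
  rewrite deriv_chord NE xN -[_%:P ^+ 2]rmorphXn /= [(1 - 'X) * _]mulrC pintCM mulrCA pint_1subX.
  by rewrite -exprMn divfK // subr_eq0 gt_eqF // (node_lt nodes).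
rewrite -e ler_pM2l // /chord_energy.
rewrite (big_ord_pred (fun i => pint (x i) (x i.+1) ((1 - 'X) * (chord x u i)^`() ^+ 2)) N1).
rewrite lerDr; apply: sumr_ge0 => i _.
have iN : (i < N)%N by rewrite (leq_trans (ltn_ord i)) // leq_pred.
apply: pint_ge0 => [|y /andP[_ y1]]; first exact/ltW/(node_ltS nodes).
rewrite hornerM horner_exp mulr_ge0 ?sqr_ge0 //.
by rewrite !(hornerD, hornerN, hornerC, hornerX); have := node_le nodes iN; lra.
Qed.

(** In the constant, [5 = 3 + 2]: 3 from the interpolating polynomial and 2 from the last increment
    of the chord. The remaining error [e] is arbitrary. *)
Lemma weighted_H1_upper u : (size u <= N.+1)%N ->
  energy u <= 5 * stability_const R * chord_energy u.
Proof.
move=> su; have k0 := stability_const_gt0 R.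
have stab := @interpolation_stability R N x N2 nodes u _ su.
move: (stability_const R) k0 stab => k k0 stab.
apply/ler_addgt0Pr => e e0.
have [|g [gu gE]] := @polynomial_interpolant_energy u (k^-1 * e).
  by rewrite mulr_gt0 ?invr_gt0.
have ug i : (i <= N)%N -> u.[x i] = g.[x i] by move=> iN; rewrite gu.
have := stab g ug; have := ug N; rewrite xN => <- //; rewrite -ug ?leq_pred //.
have h1 := chord_energy_last u => h2; apply: (le_trans h2).
apply: (@le_trans _ _ (k * (3 * chord_energy u + k^-1 * e + 2 * chord_energy u))).
  by rewrite ler_pM2l //; lra.
rewrite !mulrDr mulVKf ?gt_eqF //.
by move: (chord_energy u) => z; lra.
Qed.

End Density.

(** * Lebesgue integrals *)

Section Lebesgue.
Variable R : realType.
Local Notation mu := (@lebesgue_measure R).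

Lemma integral_poly (a b : R) (q : {poly R}) : a < b ->
  (\int[mu]_(t in `]a, b[) (q.[t])%:E = (pint a b q)%:E)%E.
Proof.
move=> ab; have cq : continuous (horner q) := @continuous_horner R q.
rewrite -(@integral_itv_bndoo R a b (EFin \o horner q) true false); last first.
  apply/measurable_EFinP; apply: measurable_funTS; exact: continuous_measurable_fun.
rewrite (@continuous_FTC2 R (horner q) (horner (primitive q))) //.
- exact: continuous_subspaceT.
- split=> [t _||]; first exact: derivable_horner.
  + by apply: cvg_at_right_filter; exact: continuous_horner.
  + by apply: cvg_at_left_filter; exact: continuous_horner.
- by move=> t _; rewrite -derivE deriv_primitive.
Qed.

Lemma measurable_fun_pieces (x : nat -> R) n (f : R -> R) :
  (forall i j, (i < j <= n)%N -> x i < x j) ->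
  (forall i, (i < n)%N -> measurable_fun `]x i, x i.+1[ f) ->
  measurable_fun `]x 0%N, x n[ f.
Proof.
elim: n => [|n IH] ltx mf.
  by rewrite set_itvoo0; exact: measurable_fun_set0.
have [n0|n0] := posnP n; first by move: mf; rewrite n0; apply.
have -> : `]x 0%N, x n.+1[%classic = `]x 0%N, x n] `|` `]x n, x n.+1[.
  by rewrite -itv_bndbnd_setU // bnd_simp ?ltW // ltx; lia.
apply/measurable_funU => //; split; last by apply: mf.
apply: (@measurable_fun_itv_oc _ _ _ false true); apply: IH.
  by move=> i j ij; apply: ltx; lia.
by move=> i iN; apply: mf; lia.
Qed.

(** Hypotheses are on open pieces only, because the derivative of [u_h] has no useful value at a
    node; the nodes form a null set. *)
Lemma integral_pieces (x : nat -> R) n (f : R -> R) :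
  (forall i j, (i < j <= n)%N -> x i < x j) ->
  (forall i, (i < n)%N -> measurable_fun `]x i, x i.+1[ f) ->
  (forall t, 0 <= f t) ->
  (\int[mu]_(t in `]x 0%N, x n[) (f t)%:E =
   \sum_(i < n) \int[mu]_(t in `]x i, x i.+1[) (f t)%:E)%E.
Proof.
move=> + + f0; elim: n => [|n IH] ltx mf.
  by rewrite set_itvoo0 integral_set0 big_ord0.
have mf' : measurable_fun `]x 0%N, x n[ f.
  apply: measurable_fun_pieces => [i j ij|i iN]; [apply: ltx | apply: mf]; lia.
rewrite big_ord_recr /= -IH; last 2 first.
- by move=> i j ij; apply: ltx; lia.
- by move=> i iN; apply: mf; lia.
have [n0|n0] := posnP n.
  by rewrite n0 set_itvoo0 integral_set0 add0e.
have -> : `]x 0%N, x n.+1[%classic = `]x 0%N, x n] `|` `]x n, x n.+1[.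
  by rewrite -itv_bndbnd_setU // bnd_simp ?ltW // ltx; lia.
rewrite ge0_integral_setU //.
- by congr (_ + _)%E; rewrite (@integral_itv_bndoo R _ _ (EFin \o f) false false) //; exact/measurable_EFinP.
- apply/measurable_EFinP/measurable_funU => //; split; last by apply: mf.
  exact: (@measurable_fun_itv_oc _ _ _ false true).
- by move=> t _; rewrite lee_fin.
- apply/disj_setPLR => t /=; rewrite !in_itv /= => /andP[_ tx].
  by apply/negP; rewrite negb_and -leNgt tx.
Qed.

(** Two polynomial bounds per piece are needed for [u_h^2 / (1 - x)], which is not polynomial; with
    equal bounds the norm is computed exactly. *)
Lemma sqnorm0_between (x : nat -> R) n (g : R -> R) (q r : nat -> {poly R}) :
  x 0%N = -1 -> x n = 1 -> (forall i j, (i < j <= n)%N -> x i < x j) ->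
  (forall i, (i < n)%N -> measurable_fun `]x i, x i.+1[ g) ->
  (forall i t, (i < n)%N -> x i < t < x i.+1 -> 0 <= (q i).[t]) ->
  (forall i t, (i < n)%N -> x i < t < x i.+1 -> (q i).[t] <= g t ^+ 2 <= (r i).[t]) ->
  ((\sum_(i < n) pint (x i) (x i.+1) (q i))%:E <= sqnorm0 g)%E /\
  (sqnorm0 g <= (\sum_(i < n) pint (x i) (x i.+1) (r i))%:E)%E.
Proof.
move=> x0 xn ltx mg q0 qgr.
have mg2 i : (i < n)%N -> measurable_fun `]x i, x i.+1[ (fun t => g t ^+ 2).
  by move=> iN; apply: measurable_funX; exact: mg.
have mpoly (p : {poly R}) (D : set R) : measurable_fun D (horner p).
  have cp : continuous (horner p) := @continuous_horner R p.
  by apply: measurable_funTS; exact: continuous_measurable_fun.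
rewrite sqnorm0E -x0 -xn integral_pieces //; last by move=> t; rewrite sqr_ge0.
rewrite -!sumEFin; split; apply: lee_sum => i _;
  have iN := ltn_ord i; have xx : x i < x i.+1 by [apply: ltx; rewrite ltnSn];
  rewrite -integral_poly //; apply: ge0_le_integral => //.
- by move=> t; rewrite /= in_itv => ti; rewrite lee_fin q0.
- by apply/measurable_EFinP; exact: mpoly.
- by apply/measurable_EFinP; exact: mg2.
- by move=> t; rewrite /= in_itv => ti; rewrite lee_fin; have /andP[] := qgr i t iN ti.
- by move=> t _; rewrite lee_fin sqr_ge0.
- by apply/measurable_EFinP; exact: mg2.
- by apply/measurable_EFinP; exact: mpoly.
- by move=> t; rewrite /= in_itv => ti; rewrite lee_fin; have /andP[] := qgr i t iN ti.
Qed.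

End Lebesgue.

(** * The unweighted norm of the derivative *)

Section Mirror.
Variable R : realType.
Variables (N : nat) (x : nat -> R).
Hypotheses (N2 : (2 <= N)%N) (nodes : lobatto_nodes N x).
Implicit Types u : {poly R}.
Local Notation y := (fun i : nat => (- x (N - i)%N)%R).

Let ynodes : lobatto_nodes N y := lobatto_nodes_opp nodes.

Lemma energy_comp_oppX u :
  energy (u \Po - 'X) = pint (-1) 1 ((1 + 'X) * u^`() ^+ 2).
Proof.
rewrite /energy deriv_comp derivN derivX mulrN1 sqrrN.
have -> : (1 - 'X) * (u^`() \Po - 'X) ^+ 2 = ((1 + 'X) * u^`() ^+ 2) \Po - 'X.
  by rewrite !expr2 !comp_polyM comp_polyD comp_polyC comp_polyX.
by rewrite pint_comp_oppX opprK.
Qed.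

Lemma chord_energy_comp_oppX u :
  chord_energy N y (u \Po - 'X) =
  \sum_(i < N) pint (x i) (x i.+1) ((1 + 'X) * (chord x u i)^`() ^+ 2).
Proof.
rewrite /chord_energy (reindex_inj rev_ord_inj) /=; apply: eq_bigr => i _.
have iN := ltn_ord i; rewrite !deriv_chord.
have -> : (N - (N - i.+1))%N = i.+1 by lia.
have -> : (N - (N - i.+1).+1)%N = i by lia.
rewrite !horner_comp !hornerN !hornerX !opprK.
set s := _ / _; have -> : (u.[x i.+1] - u.[x i]) / (x i.+1 - x i) = - s.
  by rewrite /s [- x i + _]addrC -mulNr opprB.
have <- : ((1 + 'X) * (- s)%:P ^+ 2) \Po - 'X = (1 - 'X) * s%:P ^+ 2.
  by rewrite polyCN sqrrN !expr2 !comp_polyM comp_polyD !comp_polyC comp_polyX.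
by rewrite pint_comp_oppX !opprK.
Qed.

Lemma H1_equiv u : (size u <= N.+1)%N ->
  pint (-1) 1 (u^`() ^+ 2) <=
    5 * stability_const R * \sum_(i < N) pint (x i) (x i.+1) ((chord x u i)^`() ^+ 2) /\
  \sum_(i < N) pint (x i) (x i.+1) ((chord x u i)^`() ^+ 2) <=
    1511 * pint (-1) 1 (u^`() ^+ 2).
Proof.
move=> su; have sv : (size (u \Po - 'X) <= N.+1)%N by rewrite size_comp_poly2 // size_polyN size_polyX.
have twice a b (q : {poly R}) :
    pint a b ((1 - 'X) * q) + pint a b ((1 + 'X) * q) = 2 * pint a b q.
  by rewrite -pintD -mulrDl addrACA addNr addr0 mulrDl mul1r pintD; ring.
have up := weighted_H1_upper N2 nodes su; have lo := weighted_H1_lower N2 nodes su.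
have := weighted_H1_upper N2 ynodes sv; have := weighted_H1_lower N2 ynodes sv.
rewrite -!/(energy _) -!/(chord_energy _ _ _) energy_comp_oppX chord_energy_comp_oppX.
move: lo up; rewrite -!/(energy _) /energy /chord_energy.
have := twice (-1) 1 (u^`() ^+ 2).
have : \sum_(i < N) pint (x i) (x i.+1) ((1 - 'X) * (chord x u i)^`() ^+ 2) +
   \sum_(i < N) pint (x i) (x i.+1) ((1 + 'X) * (chord x u i)^`() ^+ 2) =
   2 * \sum_(i < N) pint (x i) (x i.+1) ((chord x u i)^`() ^+ 2).
  by rewrite -big_split mulr_sumr; apply: eq_bigr => i _; exact: twice.
move: (stability_const R) => k.
move: (\sum_(_ < _) _) (\sum_(_ < _) _) (\sum_(_ < _) _) (pint _ _ _) (pint _ _ _) (pint _ _ _).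
move=> a b c d e f e1 e2 h1 h2 h3 h4.
have := congr1 (fun t => 5 * k * t) e1; lra.
Qed.
End Mirror.

(** * Equivalences of norms *)

Section Transfer.
Variable R : realType.

Lemma sqnorm0_ge0 (g : R -> R) : (0 <= sqnorm0 g)%E.
Proof.
by rewrite sqnorm0E; apply: integral_ge0 => t _; rewrite lee_fin sqr_ge0.
Qed.

Lemma eq_sqnorm0 (g1 g2 : R -> R) :
  (forall t, -1 < t < 1 -> g1 t = g2 t) -> sqnorm0 g1 = sqnorm0 g2.
Proof.
move=> g12; rewrite !sqnorm0E; apply: eq_integral => t.
by rewrite inE /= in_itv => /g12 ->.
Qed.

Lemma equiv_with_refl (C : R) (a : \bar R) : 1 <= C -> (0 <= a)%E -> equiv_with C a a.
Proof.
move=> C1 a0; have C0 : 0 < C by rewrite (lt_le_trans _ C1).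
split; first by rewrite -[leRHS]mul1e lee_wpmul2r // lee_fin invf_le1.
by rewrite -[leLHS]mul1e lee_wpmul2r // lee_fin.
Qed.

Lemma equiv_with_between (C c c' : R) (a b : \bar R) (p s s' : R) :
  0 < c -> c <= C -> c' <= C -> (0 <= a)%E -> a = p%:E ->
  (s%:E <= b)%E /\ (b <= s'%:E)%E -> p <= c * s /\ s' <= c' * p -> equiv_with C a b.
Proof.
move=> c0 cC c'C + e; rewrite {}e lee_fin => p0 [sb bs'] [ps s'p].
have s0 : 0 <= s by rewrite -(pmulr_rge0 _ c0) (le_trans p0).
have C0 : 0 < C := lt_le_trans c0 cC.
split.
  rewrite (@le_trans _ _ (C^-1%:E * s'%:E)%E) //.
    by rewrite lee_pmul2l // lte_fin invr_gt0.
  by rewrite -EFinM lee_fin ler_pdivrMl // (le_trans s'p) // ler_wpM2r.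
rewrite (@le_trans _ _ (C%:E * s%:E)%E) //; last by rewrite lee_pmul2l.
by rewrite -EFinM lee_fin (le_trans ps) // ler_wpM2r.
Qed.

Lemma powRh_sqr (y : R) : 0 <= y -> (y `^ 2^-1) ^+ 2 = y.
Proof. by move=> y0; rewrite powR12_sqrt // sqr_sqrtr. Qed.

Lemma powRNh_sqr (y : R) : 0 <= y -> (y `^ (- 2^-1)) ^+ 2 = y^-1.
Proof. by move=> y0; rewrite powRN exprVn powRh_sqr. Qed.

Lemma measurable_powR_1sub (r : R) : measurable_fun setT (fun t : R => (1 - t) `^ r).
Proof.
apply: (measurableT_comp (measurable_powR r)).
exact: measurable_funB.
Qed.

Section Pieces.
Variables (N : nat) (x : nat -> R).
Hypothesis nodes : lobatto_nodes N x.

Lemma sqnorm0_weight_between (w : R -> R) (p q r : nat -> {poly R}) (g : R -> R) :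
  measurable_fun setT w ->
  (forall i t, (i < N)%N -> x i < t < x i.+1 -> g t = w t * (p i).[t]) ->
  (forall i t, (i < N)%N -> x i < t < x i.+1 -> 0 <= (q i).[t]) ->
  (forall i t, (i < N)%N -> x i < t < x i.+1 ->
     (q i).[t] <= w t ^+ 2 * (p i).[t] ^+ 2 <= (r i).[t]) ->
  ((\sum_(i < N) pint (x i) (x i.+1) (q i))%:E <= sqnorm0 g)%E /\
  (sqnorm0 g <= (\sum_(i < N) pint (x i) (x i.+1) (r i))%:E)%E.
Proof.
move=> mw gE q0 qr.
apply: sqnorm0_between => //; rewrite ?(x0E nodes) ?(xNE nodes) //; first exact: (ltx nodes).
  move=> i iN; apply: (eq_measurable_fun (fun t => w t * (p i).[t])).
    by move=> t; rewrite inE /= in_itv => ti; rewrite (gE i).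
  apply: measurable_funM; first exact: measurable_funTS.
  have cp : continuous (horner (p i)) := @continuous_horner R (p i).
  by apply: measurable_funTS; exact: continuous_measurable_fun.
by move=> i t iN ti; rewrite (gE i) // exprMn qr.
Qed.

Lemma sqnorm0_weight (w : R -> R) (W : {poly R}) (p : nat -> {poly R}) (g : R -> R) :
  measurable_fun setT w -> (forall t, -1 < t < 1 -> w t ^+ 2 = W.[t]) ->
  (forall i t, (i < N)%N -> x i < t < x i.+1 -> g t = w t * (p i).[t]) ->
  sqnorm0 g = (\sum_(i < N) pint (x i) (x i.+1) (W * p i ^+ 2))%:E.
Proof.
move=> mw wW gE.
have pE i t : (i < N)%N -> x i < t < x i.+1 ->
    (W * p i ^+ 2).[t] = w t ^+ 2 * (p i).[t] ^+ 2.
  move=> iN /andP[it ti]; rewrite hornerM horner_exp wW //.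
  by rewrite (le_lt_trans (node_ge nodes (ltnW iN)) it) (lt_le_trans ti (node_le nodes iN)).
have [||le1 le2] := @sqnorm0_weight_between w p (fun i => W * p i ^+ 2)
  (fun i => W * p i ^+ 2) g mw gE.
- by move=> i t iN ti; rewrite pE // mulr_ge0 ?sqr_ge0.
- by move=> i t iN ti; rewrite pE // lexx.
- by apply/eqP; rewrite eq_le le1 le2.
Qed.

Lemma chord_affine (u : {poly R}) (c d : R) i : (i < N)%N ->
  c * x i + d = u.[x i] -> c * x i.+1 + d = u.[x i.+1] ->
  forall t, c * t + d = (chord x u i).[t].
Proof.
move=> iN e1 e2 t; rewrite lineE -e1 -e2 opprD addrACA subrr addr0 -mulrBr mulfK.
  by ring.
by rewrite subr_eq0 gt_eqF // (ltx nodes) // ltnSn.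
Qed.

End Pieces.

Lemma derive1_eq_poly (a b : R) (v : R -> R) (p : {poly R}) :
  (forall t, a < t < b -> v t = p.[t]) ->
  forall t, a < t < b -> v^`()%classic t = p^`().[t].
Proof.
move=> vp t tab; rewrite derivE !derive1E; apply: near_eq_derive.
have : t \in `]a, b[ by rewrite in_itv.
move/near_in_itvoo; apply: filterS => y; rewrite in_itv; exact: vp.
Qed.

End Transfer.

(** The sum dominates all constants at once: 2838 covers 39, 150, 258 and 1511, and the second term
    covers the upper bounds for the derivatives. *)
Definition equivalence_const (R : realType) : R := 2838 + 5 * stability_const R.

Section Equivalences.
Variable R : realType.
Local Notation C := (equivalence_const R).

Variables (N : nat) (x : nat -> R).
Hypotheses (N1 : (1 <= N)%N) (nodes : lobatto_nodes N x).
Variables (u : {poly R}) (uh : R -> R).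
Hypothesis su : (size u <= N.+1)%N.
Hypothesis uhE : forall i t, (i < N)%N -> x i <= t <= x i.+1 -> uh t = (chord x u i).[t].

Local Notation w := (fun t : R => (1 - t) `^ 2^-1).
Local Notation wV := (fun t : R => (1 - t) `^ (- 2^-1)).

Let k0 := stability_const_gt0 R.
Let C1 : 1 <= C.
Proof. by have := k0; rewrite /equivalence_const; move: (stability_const R) => k; lra. Qed.
Let uhE' i t : (i < N)%N -> x i < t < x i.+1 -> uh t = (chord x u i).[t].
Proof. by move=> iN /andP[it ti]; apply: uhE => //; rewrite !ltW. Qed.
Let duhE i t : (i < N)%N -> x i < t < x i.+1 -> uh^`()%classic t = (chord x u i)^`().[t].
Proof. by move=> iN; apply: derive1_eq_poly => {}t; exact: uhE'. Qed.
Let mw : measurable_fun setT w := @measurable_powR_1sub R _.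
Let w_sqr t : -1 < t < 1 -> w t ^+ 2 = (1 - 'X : {poly R}).[t].
Proof. by move=> /andP[_ t1]; rewrite powRh_sqr ?subr_ge0 ?ltW // !hornerE. Qed.

Lemma equiv_with_weighted_pieces (v : R -> R) (W p : {poly R}) (q : nat -> {poly R})
    (W1 : R -> R) (c c' : R) :
  measurable_fun setT W1 -> (forall t, -1 < t < 1 -> W1 t ^+ 2 = W.[t]) ->
  (forall i t, (i < N)%N -> x i < t < x i.+1 -> v t = (q i).[t]) ->
  0 < c -> c <= C -> c' <= C ->
  pint (-1) 1 (W * p ^+ 2) <= c * \sum_(i < N) pint (x i) (x i.+1) (W * q i ^+ 2) /\
  \sum_(i < N) pint (x i) (x i.+1) (W * q i ^+ 2) <= c' * pint (-1) 1 (W * p ^+ 2) ->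
  equiv_with C (sqnorm0 (fun t => W1 t * p.[t])) (sqnorm0 (fun t => W1 t * v t)).
Proof.
move=> mW W1E vE c0 cC c'C bounds.
apply: (equiv_with_between c0 cC c'C (sqnorm0_ge0 _) _ _ bounds).
  rewrite (pint_nodes nodes); apply: (sqnorm0_weight nodes (p := fun=> p) mW W1E).
  by [].
rewrite (sqnorm0_weight nodes (p := q) mW W1E) ?lexx // => i t iN ti.
by rewrite (vE i).
Qed.

Lemma equiv_with_pieces (v : R -> R) (p : {poly R}) (q : nat -> {poly R}) (c c' : R) :
  (forall i t, (i < N)%N -> x i < t < x i.+1 -> v t = (q i).[t]) ->
  0 < c -> c <= C -> c' <= C ->
  pint (-1) 1 (p ^+ 2) <= c * \sum_(i < N) pint (x i) (x i.+1) (q i ^+ 2) /\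
  \sum_(i < N) pint (x i) (x i.+1) (q i ^+ 2) <= c' * pint (-1) 1 (p ^+ 2) ->
  equiv_with C (sqnorm0 (horner p)) (sqnorm0 v).
Proof.
move=> vE c0 cC c'C bounds.
have := @equiv_with_weighted_pieces v 1 p q (fun=> 1) c c'.
rewrite (@eq_sqnorm0 _ (fun t => 1 * p.[t]) (horner p)) => [|t _]; last exact: mul1r.
rewrite (@eq_sqnorm0 _ (fun t => 1 * v t) v) => [|t _]; last exact: mul1r.
apply=> //; first by move=> t _; rewrite expr1n hornerC.
rewrite mul1r (eq_bigr (fun i : 'I_N => pint (x i) (x i.+1) (q i ^+ 2))) //.
by move=> i _; rewrite mul1r.
Qed.

(** With one interval, the chord and [u] both have degree at most 1 and agree at both nodes. This
    settles [N = 1], which lies outside the range of the mesh estimates. *)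
Lemma uh_interpolant : N = 1%N -> forall t, -1 < t < 1 -> uh t = u.[t].
Proof.
move=> NE t t1; have x0 := x0E nodes; have := xNE nodes; rewrite NE => x1.
rewrite (uhE' (i := 0)) ?x0 ?x1 //; apply/eqP; rewrite -subr_eq0 -hornerN -hornerD.
rewrite [_ - u](poly_nodes_eq0 nodes) ?horner0 //.
  rewrite (leq_trans (size_polyD _ _)) // geq_max size_polyN su andbT NE /chord /line.
  rewrite (leq_trans (size_polyD _ _)) // geq_max (leq_trans (size_polyC_leq1 _)) //.
  by rewrite (leq_trans (size_scale_leq _ _)) // size_XsubC.
move=> i; rewrite NE hornerD hornerN /chord; case: i => [|[|//]] _.
  by rewrite line_left subrr.
by rewrite line_right ?subrr // x0 x1 lt_eqF //; lra.
Qed.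

Lemma duh_interpolant : N = 1%N -> forall t, -1 < t < 1 -> uh^`()%classic t = u^`().[t].
Proof. by move=> NE; apply: derive1_eq_poly; exact: uh_interpolant. Qed.

Lemma equiv_L2 : equiv_with C (sqnorm0 (horner u)) (sqnorm0 uh).
Proof.
have [/esym/uh_interpolant uhN|N2] := eqVneq 1%N N.
  by rewrite (eq_sqnorm0 uhN); apply: equiv_with_refl C1 (sqnorm0_ge0 _).
apply: (equiv_with_pieces uhE' _ _ _ (L2_equiv _ nodes su)); last by lia.
all: by have := k0; rewrite /equivalence_const; move: (stability_const R) => k; lra.
Qed.

Lemma equiv_H1 : equiv_with C (sqnorm0 (horner u^`())) (sqnorm0 uh^`()%classic).
Proof.
have [/esym/duh_interpolant uhN|N2] := eqVneq 1%N N.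
  by rewrite (eq_sqnorm0 uhN); apply: equiv_with_refl C1 (sqnorm0_ge0 _).
apply: (equiv_with_pieces duhE _ _ _ (H1_equiv _ nodes su)); last by lia.
all: by have := k0; rewrite /equivalence_const; move: (stability_const R) => k; lra.
Qed.

Lemma equiv_weighted_H1 :
  equiv_with C (sqnorm0 (fun t => w t * u^`().[t])) (sqnorm0 (fun t => w t * uh^`()%classic t)).
Proof.
have [/esym/duh_interpolant uhN|N1'] := eqVneq 1%N N.
  rewrite (@eq_sqnorm0 _ (fun t => w t * uh^`()%classic t) (fun t => w t * u^`().[t])).
    exact: equiv_with_refl C1 (sqnorm0_ge0 _).
  by move=> t /uhN ->.
have N2 : (2 <= N)%N by lia.
have := conj (weighted_H1_upper N2 nodes su) (weighted_H1_lower N2 nodes su).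
apply: (equiv_with_weighted_pieces mw w_sqr duhE).
all: by have := k0; rewrite /equivalence_const; move: (stability_const R) => k; lra.
Qed.

Lemma equiv_weighted_L2 : (size u <= N)%N ->
  equiv_with C (sqnorm0 (fun t => w t * u.[t])) (sqnorm0 (fun t => w t * uh t)).
Proof.
move=> su'; have [/esym/uh_interpolant uhN|N1'] := eqVneq 1%N N.
  rewrite (@eq_sqnorm0 _ (fun t => w t * uh t) (fun t => w t * u.[t])).
    exact: equiv_with_refl C1 (sqnorm0_ge0 _).
  by move=> t /uhN ->.
have N2 : (2 <= N)%N by lia.
apply: (equiv_with_weighted_pieces mw w_sqr uhE' _ _ _ (weighted_L2_equiv N2 nodes su')).
all: by have := k0; rewrite /equivalence_const; move: (stability_const R) => k; lra.
Qed.

Lemma equiv_Hardy : u.[1] = 0 ->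
  equiv_with C (sqnorm0 (fun t => wV t * u.[t])) (sqnorm0 (fun t => wV t * uh t)).
Proof.
move=> u1; have [/esym/uh_interpolant uhN|N1'] := eqVneq 1%N N.
  rewrite (@eq_sqnorm0 _ (fun t => wV t * uh t) (fun t => wV t * u.[t])).
    exact: equiv_with_refl C1 (sqnorm0_ge0 _).
  by move=> t /uhN ->.
have N2 : (2 <= N)%N by lia.
have NE : N.-1.+1 = N by rewrite prednK.
have pN : (N.-1 < N)%N by rewrite NE.
have [g ug] : exists g, u = (1 - 'X) * g.
  have /factor_theorem[g ->] : root u 1 by apply/rootP.
  by exists (- g); rewrite polyC1 mulrN -mulNr opprB mulrC.
have sg : (size g <= N)%N.
  have [->|g0] := eqVneq g 0; first by rewrite size_poly0.
  move: su; rewrite ug size_mul //; last by rewrite -size_poly_eq0 size_1subX.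
  by rewrite size_1subX.
have mwV : measurable_fun setT wV := @measurable_powR_1sub R _.
have wV_sqr t : t < 1 -> wV t ^+ 2 = (1 - t)^-1.
  by move=> t1; rewrite powRNh_sqr // subr_ge0 ltW.
have oneX t : (1 - 'X : {poly R}).[t] = 1 - t.
  by rewrite hornerD hornerN hornerX hornerC.
(* As [u(1) = 0], the last chord is [s (1 - t)], so [last] is the exact integrand [u_h^2 / (1 - t)]
   there. *)
set a := x N.-1; pose s := u.[a] / (1 - a).
have a1 : a < 1 by rewrite /a (node_lt nodes).
pose last : {poly R} := (1 - 'X) * (s%:P) ^+ 2.
pose q i := if i == N.-1 then last else (1 - x i)^-1 *: chord x u i ^+ 2.
pose r i := if i == N.-1 then last else (1 - x i.+1)^-1 *: chord x u i ^+ 2.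
have lastE t : t < 1 -> wV t ^+ 2 * (chord x u N.-1).[t] ^+ 2 = last.[t].
  move=> t1; rewrite wV_sqr // hornerM horner_exp oneX hornerC lineE NE (xNE nodes) -/a u1 /s.
  have : 1 - t != 0 by rewrite subr_eq0 gt_eqF.
  have : 1 - a != 0 by rewrite subr_eq0 gt_eqF.
  by move=> A B; field; rewrite A B.
have int_last : pint (x N.-1) (x N.-1.+1) last = u.[a] ^+ 2 / 2.
  have e := pint_1subX a.
  rewrite NE (xNE nodes) -/a /last mulrC -rmorphXn pintCM /= /s expr_div_n -e.
  have : 2 * pint a 1 (1 - 'X) != 0 by rewrite e expf_neq0 // subr_eq0 gt_eqF.
  by rewrite mulf_eq0 negb_or => /andP[_]; move: (pint _ _ _) => I I0; field.
have sumE (f : nat -> R) : \sum_(i < N) pint (x i) (x i.+1)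
     (if i == N.-1 :> nat then last else f i *: chord x u i ^+ 2) =
   \sum_(i < N.-1) f i * pint (x i) (x i.+1) (chord x u i ^+ 2) + u.[a] ^+ 2 / 2.
  rewrite (big_ord_pred (fun i => pint (x i) (x i.+1)
     (if i == N.-1 :> nat then last else f i *: chord x u i ^+ 2)) N1) eqxx int_last.
  congr (_ + _); apply: eq_bigr => i _; rewrite ifF ?pintZ //.
  by apply/negbTE; rewrite neq_ltn ltn_ord.
have : sqnorm0 (fun t => wV t * u.[t]) = (pint (-1) 1 ((1 - 'X) * g ^+ 2))%:E.
  (* Since [(1 - t)^(-1/2) (1 - t) = (1 - t)^(1/2)], the norm of [u] is a norm of [g] with the
     weight [1 - x]. *)
  rewrite (@eq_sqnorm0 _ _ (fun t => w t * g.[t])) => [|t /andP[_ t1]].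
    by rewrite (pint_nodes nodes); apply: (sqnorm0_weight nodes (p := fun=> g) mw w_sqr).
  rewrite ug hornerM oneX mulrA; congr (_ * _).
  have t0 : 0 < 1 - t by rewrite subr_gt0.
  rewrite -{2}[1 - t]powRr1 ?ltW // -powRD ?(gt_eqF t0) ?implybT //; congr (_ `^ _).
  by field.
move/(equiv_with_between (_ : 0 < 258) _ _ (sqnorm0_ge0 _)) => H.
apply: H (Hardy_equiv N2 nodes sg) => //.
- by have := k0; rewrite /equivalence_const; move: (stability_const R) => k; lra.
- by have := k0; rewrite /equivalence_const; move: (stability_const R) => k; lra.
rewrite -ug -/a -(sumE (fun i => (1 - x i)^-1)) -(sumE (fun i => (1 - x i.+1)^-1)).
apply: (sqnorm0_weight_between nodes (p := chord x u) (q := q) (r := r) mwV); rewrite /q /r.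
- by move=> i t iN ti; rewrite (uhE' iN ti).
- move=> i t iN /andP[_ ti]; have t1 := lt_le_trans ti (node_le nodes iN).
  case: ifP => _; first by rewrite -lastE // mulr_ge0 ?sqr_ge0.
  by rewrite hornerZ horner_exp mulr_ge0 ?sqr_ge0 // invr_ge0 subr_ge0 (node_le nodes (ltnW iN)).
- move=> i t iN /andP[it ti]; have t1 := lt_le_trans ti (node_le nodes iN).
  case: ifP => [/eqP->|iN']; first by rewrite lastE ?lexx.
  have iN1 : x i.+1 < 1 by rewrite (node_lt nodes) //; move/eqP: iN'; lia.
  rewrite !hornerZ !horner_exp wV_sqr // !ler_wpM2r ?sqr_ge0 // lef_pV2 ?posrE ?subr_gt0 //.
    by rewrite lerD2l lerN2 ltW.
    by rewrite lerD2l lerN2 ltW.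
  exact: lt_trans it t1.
Qed.

End Equivalences.

Lemma gauss_lobatto_nodes (R : realType) N (xi : 'I_N.+1 -> R) :
  gauss_lobatto xi -> lobatto_nodes N (fun k => xi (inord k)).
Proof.
case=> x0 xN ltx rE; split.
- by rewrite -x0; congr xi; apply: val_inj; rewrite /= inordK.
- by rewrite -xN; congr xi; apply: val_inj; rewrite /= inordK.
- by move=> i j /andP[ij jN]; apply: ltx; rewrite !inordK //; lia.
- by move=> i _; apply/rE; exists (inord i).
- by move=> y /rE[i ->]; exists i; [rewrite -ltnS | rewrite inord_val].
Qed.

Lemma piecewise_linear_chord (R : realType) N (xi : 'I_N.+1 -> R) (u : {poly R}) (uh : R -> R) :
  gauss_lobatto xi -> continuous_piecewise_linear xi uh ->
  (forall i, uh (xi i) = u.[xi i]) ->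
  forall i t, (i < N)%N -> xi (inord i) <= t <= xi (inord i.+1) ->
  uh t = (chord (fun k => xi (inord k)) u i).[t].
Proof.
move=> /gauss_lobatto_nodes nodes [_ lin] uhxi i t iN ti.
have [|c [d uhE]] := lin (inord i) (inord i.+1); first by rewrite !inordK //; lia.
have xx : xi (inord i) <= xi (inord i.+1) by exact/ltW/(node_ltS nodes).
rewrite uhE // (chord_affine nodes (u := u) (c := c) (d := d) iN) //.
- by rewrite -uhE ?lexx // uhxi.
- by rewrite -uhE ?lexx ?andbT // uhxi.
Qed.

Theorem lemma1 (R : realType) :
  exists C : R, 0 < C /\
  forall (N : nat) (xi f : 'I_N.+1 -> R) (uN : {poly R}) (uh : R -> R),
    (1 <= N)%N ->
    gauss_lobatto xi ->
    (size uN <= N.+1)%N ->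
    (forall i : 'I_N.+1, uN.[xi i] = f i) ->
    continuous_piecewise_linear xi uh ->
    (forall i : 'I_N.+1, uh (xi i) = f i) ->
    [/\ equiv_with C (sqnorm0 (fun x => uN.[x])) (sqnorm0 uh),
        equiv_with C (sqnorm0 (fun x => (uN^`()).[x]))
                     (sqnorm0 uh^`()%classic),
        equiv_with C
          (sqnorm0 (fun x => ((1 - x) `^ 2^-1) * (uN^`()).[x]))
          (sqnorm0 (fun x => ((1 - x) `^ 2^-1) * uh^`()%classic x)),
        (uN.[1] = 0 ->
         equiv_with C
           (sqnorm0 (fun x => ((1 - x) `^ (- 2^-1)) * uN.[x]))
           (sqnorm0 (fun x => ((1 - x) `^ (- 2^-1)) * uh x))) &
        ((size uN <= N)%N ->
         equiv_with C
           (sqnorm0 (fun x => ((1 - x) `^ 2^-1) * uN.[x]))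
           (sqnorm0 (fun x => ((1 - x) `^ 2^-1) * uh x)))].
Proof.
exists (equivalence_const R); split=> [|N xi f u uh N1 gl su uxi pl uhxi].
  by have := stability_const_gt0 R; rewrite /equivalence_const; move: (stability_const R) => k; lra.
have nodes := gauss_lobatto_nodes gl.
have uhE := @piecewise_linear_chord R N xi u uh gl pl.
have {}uhE := uhE (fun i => etrans (uhxi i) (esym (uxi i))).
split.
- exact: (equiv_L2 N1 nodes su uhE).
- exact: (equiv_H1 N1 nodes su uhE).
- exact: (equiv_weighted_H1 N1 nodes su uhE).
- exact: (equiv_Hardy N1 nodes su uhE).
- exact: (equiv_weighted_L2 N1 nodes su uhE).
Qed.
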